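(* Suppose $\mathfrak g$ is an $L_\infty$-algebra and $V$ is a $BV_\infty$-algebra. There exists a canonical bijection $$\mathrm{Hom}_{BV_\infty}(S(\mathfrak g[-1]),V)\;\cong\;\mathrm{Hom}_{L_\infty}(\mathfrak g,V[[\hbar]][1]),$$ where the $L_\infty$-structure on $V[[\hbar]][1]$ is given by the modified higher derived brackets $$L_n(a_1,\dots,a_n)=\frac{1}{\hbar^{n-1}}[[\dots[\Delta,L_{a_1}],\dots],L_{a_n}]1,\qquad n\ge1.$$ This bijection is natural in the $L_\infty$-algebra $\mathfrak g$ and in the $BV_\infty$-algebra $V$.
   Context: Conventions. $k$ is a field of characteristic zero; everything is $\mathbb Z$-graded over $k$ with the Koszul sign rule. $V[n]^p:=V^{n+p}$. $\hbar$ is a formal variable of degree $2$, and $V[[\hbar]]$ is the graded $k[[\hbar]]$-module of formal power series in $\hbar$ with values in $V$ (graded by total degree). Graded commutative algebras are unital; $L_a(b)=ab$ (not to be confused with the brackets $L_n$). $L_\infty$-algebras. $S(\mathfrak g[1])$ is the cofree cocommutative coalgebra with the shuffle comultiplication. An $L_\infty$-structure on $\mathfrak g$ is a coderivation $D$ of $S(\mathfrak g[1])$ of degree one with $D^2=0$, $D(1)=0$; $D=D_1+D_2+\dots$, where $D_n$ is the coderivation extending the component $l_n:S^n(\mathfrak g[1])\to\mathfrak g[1]$ of $D$: for $m\ge n$, $$D_n(x_1\cdots x_m)=\sum_{\sigma\in \mathrm{Sh}_{n,m-n}}(-1)^{|x_\sigma|}l_n(x_{\sigma(1)},\dots,x_{\sigma(n)})\,x_{\sigma(n+1)}\cdots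 x_{\sigma(m)},$$ and $D_n=0$ on $S^m$ for $m<n$ ($\mathrm{Sh}_{n,m-n}$: $(n,m-n)$-shuffles; $(-1)^{|x_\sigma|}$: Koszul sign). An $L_\infty$-morphism $\mathfrak g\to\mathfrak g'$ is a morphism $S(\mathfrak g[1])\to S(\mathfrak g'[1])$ of counital graded coalgebras commuting with the codifferentials and sending $1$ to $1$; it is determined by its projection to the cogenerators $\mathfrak g'[1]$. For a $BV_\infty$-algebra $V$, the brackets $L_n$, viewed as degree-one maps $S^n(V[2])[[\hbar]]\to V[[\hbar]][2]$, make $V[[\hbar]][1]$ an $L_\infty$-algebra over $k[[\hbar]]$, with codifferential on $S(V[2])[[\hbar]]$; an $L_\infty$-morphism $\mathfrak g\to V[[\hbar]][1]$ is a coalgebra morphism $F:S(\mathfrak g[1])[[\hbar]]\to S(V[2])[[\hbar]]$ over $k[[\hbar]]$ (continuous), commuting with codifferentials, $F(1)=1$, determined by its projection $f:S(\mathfrak g[1])\to V[[\hbar]][2]$. $BV_\infty$-algebras. A linear operator $D$ on a graded commutative algebra $V$ is a differential operator of order $\le n$ if $[[\dots[D,L_{a_0}],\dots],L_{a_n}]=0$ for all $a_0,\dots,a_n\in V$. A $BV_\infty$-algebra is a graded commutative algebra $V$ with a $k$-linear degree-one map $\Delta=\frac1\hbar\sum_{n\ge1}\hbar^n\Delta_n:V\to V[[\hbar]]$, $\Delta_n$ a differential operator of order $\le n$ on $V$, such that $\Delta^2=0$ (after continuous $k[[\hbar]]$-linear extension) and $\Delta(1)=0$. For an $L_\infty$-algebra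 $\mathfrak g$, $S(\mathfrak g[-1])$ is a $BV_\infty$-algebra with $\Delta=\frac1\hbar\sum_{n\ge1}\hbar^nD_n$, where $S^m(\mathfrak g[1])$ and $S^m(\mathfrak g[-1])$ are identified by the $m$-fold double suspension (degree shift $2m$, no signs). The same formula is used when $\mathfrak g[[\hbar]]$ is a topological $L_\infty$-algebra over $k[[\hbar]]$ (the $D_n$ being then power series in $\hbar$). $BV_\infty$-morphisms. For a degree-zero linear map $\varphi:S(U)\to V'[[\hbar]]$ with $\varphi(1)=0$, $\exp(\varphi):S(U)[[\hbar]]\to V'[[\hbar]]$ is the continuous $k[[\hbar]]$-linear map with $\exp(\varphi)(1)=1$ and, for $x_i\in U$, $m\ge1$, $$\exp(\varphi)(x_1\cdots x_m)=\sum_{k=1}^m\frac1{k!}\sum_{\substack{i_1,\dots,i_k\ge1\\ i_1+\dots+i_k=m}}\frac1{i_1!\cdots i_k!}\sum_{\sigma\in S_m}(-1)^{|x_\sigma|}\varphi(x_{\sigma(1)}\cdots x_{\sigma(i_1)})\cdots\varphi(x_{\sigma(m-i_k+1)}\cdots x_{\sigma(m)}).$$ For a degree-zero $\Phi:S(U)\to V'[[\hbar]]$ with $\Phi(1)=1$, $\log(\Phi)$ is defined by the same formula with $\varphi$ replaced by $\Phi$ and $\frac1{k!}$ by $\frac{(-1)^{k-1}}{k}$, and $\log(\Phi)(1)=0$; it is inverse to $\exp$. A $BV_\infty$-morphism from $(S(U),\Delta)$ to a $BV_\infty$-algebra $(V',\Delta')$ is a degree-zero $k$-linear map $\varphi:S(U)\to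 V'[[\hbar]]$ such that (1) $\varphi(1)=0$; (2) $\exp(\varphi)\Delta=\Delta'\exp(\varphi)$; (3) $\varphi=\frac1\hbar\sum_{n\ge1}\hbar^n\varphi_n$ with $\varphi_n:S(U)\to V'$ vanishing on $S^{>n}(U)$. $\mathrm{Hom}_{BV_\infty}$ denotes the set of all $BV_\infty$-morphisms (not only pure ones). Composition is $\psi\diamond\varphi=\log(\exp(\psi)\circ\exp(\varphi))$. Naturality. An $L_\infty$-morphism $\mathfrak g'\to\mathfrak g$ with projection $\varphi:S(\mathfrak g'[1])\to\mathfrak g[1]$ induces the $BV_\infty$-morphism $S(\mathfrak g'[-1])\to S(\mathfrak g[-1])$ equal to $\hbar^{n-1}\varphi$ on $S^n$ (via double suspension); naturality in $\mathfrak g$ is compatibility with precomposition. $BV_\infty$-morphisms are only defined out of $BV_\infty$-algebras free as algebras, so naturality in $V$ refers to $BV_\infty$-morphisms $\chi:V=S(U)\to V'$, acting on the left by $\varphi\mapsto\chi\diamond\varphi$ and on the right by composition with the induced $L_\infty$-morphism $V[[\hbar]][1]\to V'[[\hbar]][1]$, which is defined as follows. Give $S(V)$ the $BV_\infty$-structure coming from the $L_\infty$-algebra $(V[[\hbar]][1],L_n)$ over $k[[\hbar]]$; the projection $p_1:S(V)\to V=S^1(V)\subset V[[\hbar]]$ is a $BV_\infty$-morphism whose exponential is the multiplication map $S(V)\to V$. The induced $L_\infty$-morphism is the coalgebra morphism whose projection to cogenerators restricted to the $j$-th symmetric power is $\hbar^{1-j}(\chi\diamond p_1)$. *)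

(* Defs.v *)
From HB Require Import structures.
From mathcomp Require Import all_boot all_order all_algebra.
From mathcomp Require Import perm generic_quotient.
From mathcomp Require Import boolp.

Set Implicit Arguments.
Unset Strict Implicit.
Unset Printing Implicit Defensive.

Import GRing.Theory.
Local Open Scope ring_scope.
Local Open Scope quotient_scope.

(* [P W f] says that the family [f : T -> W] satisfies some relations, for
   every module [W].  [pres P] is the module generated by [T] subject to these
   relations: two formal sums are identified when every family satisfying the
   relations gives them the same value. *)
Section Presentation.
Variables (k : fieldType) (T : Type).
Variable P : forall W : lmodType k, (T -> W) -> Prop.

Definition formal_sum : Type := seq (k * T).
HB.instance Definition _ := gen_eqMixin formal_sum.
HB.instance Definition _ := gen_choiceMixin formal_sum.

Definition fsum_val (W : lmodType k) (f : T -> W) (s : formal_sum) : W :=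
  \sum_(t <- s) t.1 *: f t.2.

Definition fsum_eq (s t : formal_sum) : bool :=
  `[< forall (W : lmodType k) (f : T -> W), P f -> fsum_val f s = fsum_val f t >].

Lemma fsum_eq_refl : reflexive fsum_eq.
Proof. by move=> s; apply/asboolP. Qed.

Lemma fsum_eq_sym : symmetric fsum_eq.
Proof.
by move=> s t; apply/asboolP/asboolP => H W f Pf; rewrite (H W f Pf).
Qed.

Lemma fsum_eq_trans : transitive fsum_eq.
Proof.
move=> t s u /asboolP H1 /asboolP H2; apply/asboolP => W f Pf.
by rewrite (H1 W f Pf) (H2 W f Pf).
Qed.

Canonical fsum_equiv := EquivRel fsum_eq fsum_eq_refl fsum_eq_sym fsum_eq_trans.

Definition pres := {eq_quot fsum_eq}.
HB.instance Definition _ := Choice.on pres.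
HB.instance Definition _ := EqQuotient.on pres.

Definition pres_gen (t : T) : pres := \pi_pres [:: (1, t)].

(* The linear map [pres -> W] given by [f] on generators, when [f] satisfies the
   relations (see [pres_lift_gen], [pres_lift_linear]). *)
Definition pres_lift (W : lmodType k) (f : T -> W) (x : pres) : W :=
  fsum_val f (repr x).

Lemma pres_lift_pi (W : lmodType k) (f : T -> W) s :
  P f -> pres_lift f (\pi_pres s) = fsum_val f s.
Proof.
move=> Pf; have /eqmodP/asboolP H : repr (\pi_pres s) = s %[mod pres].
  by rewrite reprK.
exact: H.
Qed.

Lemma pres_ext (x y : pres) :
  (forall (W : lmodType k) (f : T -> W), P f -> pres_lift f x = pres_lift f y) ->
  x = y.
Proof.
move=> H; rewrite -[x]reprK -[y]reprK; apply/eqmodP/asboolP => W f Pf.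
exact: H.
Qed.

Definition pres_zero : pres := \pi_pres [::].
Definition pres_add (x y : pres) : pres := \pi_pres (repr x ++ repr y).
Definition pres_scale (c : k) (x : pres) : pres :=
  \pi_pres [seq (c * t.1, t.2) | t <- repr x].
Definition pres_opp (x : pres) : pres := pres_scale (-1) x.

Section LiftOps.
Variables (W : lmodType k) (f : T -> W).
Hypothesis Pf : P f.

Lemma pres_lift0 : pres_lift f pres_zero = 0.
Proof. by rewrite pres_lift_pi // /fsum_val big_nil. Qed.

Lemma pres_liftD_subproof x y :
  pres_lift f (pres_add x y) = pres_lift f x + pres_lift f y.
Proof. by rewrite pres_lift_pi // /fsum_val big_cat. Qed.

Lemma pres_liftZ_subproof c x :
  pres_lift f (pres_scale c x) = c *: pres_lift f x.
Proof.
rewrite pres_lift_pi // /fsum_val big_map scaler_sumr.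
by apply: eq_bigr => t _; rewrite scalerA.
Qed.

Lemma pres_liftN_subproof x : pres_lift f (pres_opp x) = - pres_lift f x.
Proof. by rewrite pres_liftZ_subproof scaleN1r. Qed.

Lemma pres_lift_gen t : pres_lift f (pres_gen t) = f t.
Proof. by rewrite pres_lift_pi // /fsum_val big_seq1 scale1r. Qed.
End LiftOps.

Lemma pres_addA : associative pres_add.
Proof.
by move=> x y z; apply: pres_ext => W f Pf; rewrite !pres_liftD_subproof // addrA.
Qed.
Lemma pres_addC : commutative pres_add.
Proof.
by move=> x y; apply: pres_ext => W f Pf; rewrite !pres_liftD_subproof // addrC.
Qed.
Lemma pres_add0 : left_id pres_zero pres_add.
Proof.
by move=> x; apply: pres_ext => W f Pf; rewrite pres_liftD_subproof // pres_lift0 // add0r.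
Qed.
Lemma pres_addN : left_inverse pres_zero pres_opp pres_add.
Proof.
move=> x; apply: pres_ext => W f Pf.
by rewrite pres_liftD_subproof // pres_liftN_subproof // pres_lift0 // addNr.
Qed.

HB.instance Definition _ :=
  GRing.isZmodule.Build pres pres_addA pres_addC pres_add0 pres_addN.

Lemma pres_scaleA c d x : pres_scale c (pres_scale d x) = pres_scale (c * d) x.
Proof.
by apply: pres_ext => W f Pf; rewrite !pres_liftZ_subproof // scalerA.
Qed.
Lemma pres_scale1 : left_id 1 pres_scale.
Proof.
by move=> x; apply: pres_ext => W f Pf; rewrite pres_liftZ_subproof // scale1r.
Qed.
Lemma pres_scaleDr : right_distributive pres_scale +%R.
Proof.
move=> c x y; apply: pres_ext => W f Pf.
by rewrite pres_liftZ_subproof // !pres_liftD_subproof // !pres_liftZ_subproof // scalerDr.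
Qed.
Lemma pres_scaleDl x : {morph pres_scale^~ x : c d / c + d}.
Proof.
move=> c d; apply: pres_ext => W f Pf.
by rewrite pres_liftD_subproof // !pres_liftZ_subproof // scalerDl.
Qed.

HB.instance Definition _ := GRing.Zmodule_isLmodule.Build k pres
  pres_scaleA pres_scale1 pres_scaleDr pres_scaleDl.

Lemma pres_lift_linear (W : lmodType k) (f : T -> W) :
  P f -> linear (pres_lift f).
Proof.
by move=> Pf c x y; rewrite pres_liftD_subproof // pres_liftZ_subproof.
Qed.

Lemma presE (x : pres) : x = \sum_(t <- repr x) t.1 *: pres_gen t.2.
Proof.
apply: pres_ext => W f Pf; rewrite {1}/pres_lift /fsum_val.
elim: (repr x) => [|t s IH].
  by rewrite !big_nil pres_lift0.
by rewrite !big_cons pres_lift_linear // pres_lift_gen // IH.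
Qed.

Lemma pres_ind (Q : pres -> Prop) :
  Q 0 -> (forall c t x, Q x -> Q (c *: pres_gen t + x)) -> forall x, Q x.
Proof.
move=> Q0 QS x; rewrite (presE x); elim: (repr x) => [|t s IH].
  by rewrite big_nil.
by rewrite big_cons; apply: QS.
Qed.

End Presentation.

Record gvect (k : fieldType) := GVect {
  gcar :> lmodType k;
  ghom : int -> gcar -> Prop;
  ghom0 : forall p, ghom p 0;
  ghom_lin : forall p c x y, ghom p x -> ghom p y -> ghom p (c *: x + y);
  ghom_span : forall x, exists sc : seq int * (int -> gcar),
    [/\ uniq sc.1, forall p, ghom p (sc.2 p) & x = \sum_(p <- sc.1) sc.2 p];
  ghom_free : forall (s : seq int) (c : int -> gcar),
    uniq s -> (forall p, ghom p (c p)) -> \sum_(p <- s) c p = 0 ->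
    forall p, p \in s -> c p = 0
}.

(* V[n]^p = V^(n+p) on the same underlying space. *)
Section Shift.
Variables (k : fieldType) (V : gvect k) (n : int).

Definition shift_hom (p : int) (x : V) : Prop := ghom (n + p) x.

Lemma shift_hom_span (x : V) : exists sc : seq int * (int -> V),
  [/\ uniq sc.1, forall p, shift_hom p (sc.2 p) & x = \sum_(p <- sc.1) sc.2 p].
Proof.
have [[s c] /= [us hc xE]] := ghom_span x.
exists ([seq p - n | p <- s], fun p => c (n + p)); split=> /=.
- by rewrite map_inj_uniq //; apply: addIr.
- by move=> p; apply: hc.
- by rewrite big_map xE; apply: eq_bigr => p _; rewrite addrC subrK.
Qed.

Lemma shift_hom_free (s : seq int) (c : int -> V) :
  uniq s -> (forall p, shift_hom p (c p)) -> \sum_(p <- s) c p = 0 ->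
  forall p, p \in s -> c p = 0.
Proof.
move=> us hc c0 p ps.
have := @ghom_free k V [seq n + p | p <- s] (fun p => c (p - n)) _ _ _ (n + p).
rewrite addrAC subrr add0r; apply.
- by rewrite map_inj_uniq //; apply: addrI.
- by move=> q; have := hc (q - n); rewrite /shift_hom addrC subrK.
- by rewrite big_map -[RHS]c0; apply: eq_bigr => q _; rewrite addrAC subrr add0r.
- exact: map_f.
Qed.

Definition shift : gvect k :=
  @GVect k (gcar V) shift_hom (fun p => @ghom0 k V (n + p))
    (fun p => @ghom_lin k V (n + p)) shift_hom_span shift_hom_free.
End Shift.

Definition ksgn (k : fieldType) (n : int) : k := (-1) ^+ `|n|%N.

Record letter (k : fieldType) (U : gvect k) := Letter {
  ldeg : int;
  lval : U;
  lvalP : ghom ldeg lval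
}.
Arguments Letter {k U} ldeg lval lvalP.

(* For x homogeneous of degree p, this is the letter x (and 0 otherwise). *)
Definition to_letter (k : fieldType) (U : gvect k) (p : int) (x : U) : letter U :=
  match pselect (ghom p x) with
  | left hx => Letter p x hx
  | right _ => Letter p 0 (ghom0 U p)
  end.

Section Sym.
Variables (k : fieldType) (U : gvect k).

Definition word : Type := seq (letter U).
Definition wdeg (w : word) : int := \sum_(a <- w) ldeg a.

(* Multilinearity in each letter and graded symmetry. *)
Definition sym_rel (W : lmodType k) (f : word -> W) : Prop :=
  (forall (u v : word) (c : k) (a b d : letter U),
      ldeg a = ldeg d -> ldeg b = ldeg d -> lval d = c *: lval a + lval b ->
      f (u ++ d :: v) = c *: f (u ++ a :: v) + f (u ++ b :: v)) /\
  (forall (u v : word) (a b : letter U),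
      f (u ++ a :: b :: v) = ksgn k (ldeg a * ldeg b) *: f (u ++ b :: a :: v)).

Definition Sym : Type := pres sym_rel.
HB.instance Definition _ := GRing.Lmodule.on Sym.

(* The product x_1 ... x_m in S(U). *)
Definition mono (w : word) : Sym := pres_gen sym_rel w.

Definition sym_lift (W : lmodType k) (f : word -> W) : Sym -> W :=
  @pres_lift k word sym_rel W f.

Lemma mono_rel : sym_rel mono.
Proof.
split=> [u v c a b d e1 e2 e3|u v a b]; apply: pres_ext => W f Pf.
  by rewrite pres_lift_linear // !pres_lift_gen // (proj1 Pf _ _ _ _ _ _ e1 e2 e3).
have -> : ksgn k (ldeg a * ldeg b) *: mono (u ++ b :: a :: v) =
          ksgn k (ldeg a * ldeg b) *: mono (u ++ b :: a :: v) + 0 by rewrite addr0.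
rewrite pres_lift_linear // !pres_lift_gen // (proj2 Pf).
by rewrite [pres_lift f 0]pres_lift0 // addr0.
Qed.

Lemma sym_lift_mono (W : lmodType k) (f : word -> W) w :
  sym_rel f -> sym_lift f (mono w) = f w.
Proof. by move=> Pf; apply: (@pres_lift_gen k word sym_rel W f Pf). Qed.

Lemma sym_lift_linear (W : lmodType k) (f : word -> W) :
  sym_rel f -> linear (sym_lift f).
Proof. by move=> Pf; apply: (@pres_lift_linear k word sym_rel W f Pf). Qed.

Lemma sym_lift0 (W : lmodType k) (f : word -> W) :
  sym_rel f -> sym_lift f 0 = 0.
Proof. by move=> Pf; apply: (@pres_lift0 _ _ _ _ f Pf). Qed.

Lemma sym_liftZ (W : lmodType k) (f : word -> W) c x :
  sym_rel f -> sym_lift f (c *: x) = c *: sym_lift f x.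
Proof. by move=> Pf; rewrite -[c *: x]addr0 sym_lift_linear // sym_lift0 // addr0. Qed.

Lemma sym_ind (Q : Sym -> Prop) :
  Q 0 -> (forall c w x, Q x -> Q (c *: mono w + x)) -> forall x, Q x.
Proof. exact: pres_ind. Qed.

Definition sym_one : Sym := mono [::].

Definition sym_mul (x y : Sym) : Sym :=
  sym_lift (fun u => sym_lift (fun v => mono (u ++ v)) y) x.

Lemma catl_rel (W : lmodType k) (f : word -> W) u :
  sym_rel f -> sym_rel (fun v => f (u ++ v)).
Proof.
case=> H1 H2; split=> [u' v c a b d e1 e2 e3|u' v a b]; rewrite !catA.
  exact: H1.
exact: H2.
Qed.

Lemma catr_rel (W : lmodType k) (f : word -> W) v :
  sym_rel f -> sym_rel (fun u => f (u ++ v)).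
Proof.
case=> H1 H2; split=> [u' v' c a b d e1 e2 e3|u' v' a b]; rewrite -!catA /=.
  exact: H1.
exact: H2.
Qed.

Lemma mul_rel y : sym_rel (fun u => sym_lift (fun v => mono (u ++ v)) y).
Proof.
have H u : sym_rel (fun v => mono (u ++ v)) := catl_rel u mono_rel.
elim/sym_ind: y => [|c w y [IH1 IH2]].
  split=> *; rewrite !sym_lift0 ?scaler0 ?addr0 //; exact: H.
have [M1 M2] := catr_rel w mono_rel.
split=> [u v c' a b d e1 e2 e3|u v a b]; rewrite !sym_lift_linear ?sym_lift_mono //.
  rewrite (IH1 _ _ _ _ _ _ e1 e2 e3) (M1 _ _ _ _ _ _ e1 e2 e3).
  by rewrite !scalerDr !scalerA [c * c']mulrC -!addrA; congr (_ + _); rewrite addrCA.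
by rewrite IH2 M2 scalerDr !scalerA [ksgn _ _ * c]mulrC.
Qed.

Lemma sym_mul_mono u v : sym_mul (mono u) (mono v) = mono (u ++ v).
Proof.
rewrite /sym_mul sym_lift_mono; last exact: mul_rel.
by rewrite sym_lift_mono //; apply: (catl_rel u mono_rel).
Qed.

Lemma sym_mulDl c x x' y :
  sym_mul (c *: x + x') y = c *: sym_mul x y + sym_mul x' y.
Proof. by rewrite /sym_mul sym_lift_linear //; apply: mul_rel. Qed.

Lemma sym_mul0l y : sym_mul 0 y = 0.
Proof. by rewrite /sym_mul sym_lift0 //; apply: mul_rel. Qed.

Lemma sym_mulDr c x y y' :
  sym_mul x (c *: y + y') = c *: sym_mul x y + sym_mul x y'.
Proof.
elim/sym_ind: x => [|d w x IH]; first by rewrite !sym_mul0l scaler0 addr0.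
have H := catl_rel w mono_rel.
have E z : sym_mul (mono w) z = sym_lift (fun v => mono (w ++ v)) z.
  by rewrite /sym_mul sym_lift_mono //; apply: mul_rel.
rewrite !sym_mulDl IH !E sym_lift_linear // !scalerDr !scalerA [d * c]mulrC.
by rewrite -!addrA; congr (_ + _); rewrite addrCA.
Qed.

Lemma sym_mul0r x : sym_mul x 0 = 0.
Proof.
have := sym_mulDr 1 x 0 0; rewrite !scale1r addr0 => /eqP.
by rewrite -subr_eq subrr eq_sym => /eqP.
Qed.

Lemma sym_mulA : associative sym_mul.
Proof.
move=> x y z; elim/sym_ind: x => [|c u x IHx]; first by rewrite !sym_mul0l.
rewrite !sym_mulDl IHx; congr (_ *: _ + _) => {x IHx}.
elim/sym_ind: y => [|d v y IHy]; first by rewrite !(sym_mul0l, sym_mul0r).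
rewrite !(sym_mulDl, sym_mulDr) IHy; congr (_ *: _ + _) => {y IHy}.
elim/sym_ind: z => [|e w z IHz]; first by rewrite !(sym_mul0l, sym_mul0r).
by rewrite !sym_mulDr IHz !sym_mul_mono catA.
Qed.

Lemma sym_mul1l : left_id sym_one sym_mul.
Proof.
move=> x; elim/sym_ind: x => [|c u x IH]; first by rewrite sym_mul0r.
by rewrite sym_mulDr IH sym_mul_mono.
Qed.

(* The elements of degree p are the combinations of products of degree p. *)
Definition sym_hom (p : int) (x : Sym) : Prop :=
  exists n (c : 'I_n -> k) (w : 'I_n -> word),
    (forall i, wdeg (w i) = p) /\ x = \sum_(i < n) c i *: mono (w i).

Definition sym_pr (p : int) : Sym -> Sym :=
  sym_lift (fun w => if wdeg w == p then mono w else 0).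

Lemma wdeg_cat u v : wdeg (u ++ v) = wdeg u + wdeg v.
Proof. by rewrite /wdeg big_cat. Qed.

Lemma wdeg_cons a v : wdeg (a :: v) = ldeg a + wdeg v.
Proof. by rewrite /wdeg big_cons. Qed.

Lemma sym_pr_rel p : sym_rel (fun w => if wdeg w == p then mono w else 0).
Proof.
split=> [u v c a b d e1 e2 e3|u v a b]; rewrite !wdeg_cat !wdeg_cons.
  rewrite e1 e2; case: ifP => _; last by rewrite scaler0 addr0.
  exact: (proj1 mono_rel _ _ _ _ _ _ e1 e2 e3).
rewrite [ldeg a + (ldeg b + _)]addrCA; case: ifP => _; last by rewrite scaler0.
exact: (proj2 mono_rel).
Qed.

Lemma sym_pr_linear p : linear (sym_pr p).
Proof. by apply: sym_lift_linear; apply: sym_pr_rel. Qed.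

Lemma sym_pr0 p : sym_pr p 0 = 0.
Proof. by apply: sym_lift0; apply: sym_pr_rel. Qed.

Lemma sym_pr_mono p w : sym_pr p (mono w) = if wdeg w == p then mono w else 0.
Proof. by rewrite /sym_pr sym_lift_mono //; apply: sym_pr_rel. Qed.

Lemma sym_pr_sum p (I : Type) (r : seq I) (F : I -> Sym) :
  sym_pr p (\sum_(i <- r) F i) = \sum_(i <- r) sym_pr p (F i).
Proof.
elim: r => [|i r IH]; first by rewrite !big_nil sym_pr0.
by rewrite !big_cons -[F i]scale1r sym_pr_linear IH !scale1r.
Qed.

Lemma sym_hom0 p : sym_hom p 0.
Proof.
exists 0%N, (fun _ => 0), (fun _ => [::]); split; first by case.
by rewrite big_ord0.
Qed.

Lemma sym_hom_lin p c x y : sym_hom p x -> sym_hom p y -> sym_hom p (c *: x + y).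
Proof.
move=> [n [a [u [hu ->]]]] [m [b [v [hv ->]]]].
exists (n + m)%N, (fun i => match split i with inl i => c * a i | inr j => b j end).
exists (fun i => match split i with inl i => u i | inr j => v j end); split.
  by move=> i; case: (split i).
rewrite big_split_ord scaler_sumr /=; congr (_ + _); apply: eq_bigr => i _.
  by rewrite (unsplitK (inl i)) scalerA.
by rewrite (unsplitK (inr i)).
Qed.

Lemma sym_hom_mono w : sym_hom (wdeg w) (mono w).
Proof.
exists 1%N, (fun _ => 1), (fun _ => w); split=> //.
by rewrite big_ord_recl big_ord0 scale1r addr0.
Qed.

Lemma sym_pr_hom p x : sym_hom p (sym_pr p x).
Proof.
elim/sym_ind: x => [|c w x IH]; first by rewrite sym_pr0; apply: sym_hom0.
rewrite sym_pr_linear; apply: sym_hom_lin => //; rewrite sym_pr_mono.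
by case: eqP => [<-|_]; [apply: sym_hom_mono|apply: sym_hom0].
Qed.

Lemma sym_pr_id p q x : sym_hom p x -> sym_pr q x = if p == q then x else 0.
Proof.
move=> [n [c [w [hw ->]]]]; rewrite sym_pr_sum.
under eq_bigr => i _.
  rewrite -[_ *: _]addr0 sym_pr_linear sym_pr0 addr0 sym_pr_mono hw; over.
case: ifP => _; first by [].
by rewrite big1 // => i _; rewrite scaler0.
Qed.

Lemma sym_hom_span x : exists sc : seq int * (int -> Sym),
  [/\ uniq sc.1, forall p, sym_hom p (sc.2 p) & x = \sum_(p <- sc.1) sc.2 p].
Proof.
suff [s H] : exists s : seq int,
    forall s', uniq s' -> {subset s <= s'} -> x = \sum_(p <- s') sym_pr p x.
  exists (undup s, fun p => sym_pr p x); split=> /=; first exact: undup_uniq.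
  - by move=> p; apply: sym_pr_hom.
  - by apply: H; [apply: undup_uniq|move=> p; rewrite mem_undup].
elim/sym_ind: x => [|c w x [s IH]].
  by exists [::] => s' _ _; rewrite big1 // => p _; rewrite sym_pr0.
exists (wdeg w :: s) => s' us' sub.
under eq_bigr => p _ do rewrite sym_pr_linear sym_pr_mono.
rewrite big_split /= -IH //; last by move=> p ps; apply: sub; rewrite inE ps orbT.
congr (_ + _); rewrite -scaler_sumr (bigD1_seq (wdeg w)) //=; last first.
  by apply: sub; rewrite inE eqxx.
by rewrite eqxx big1 ?addr0 // => p; rewrite eq_sym => /negbTE ->.
Qed.

Lemma sym_hom_free (s : seq int) (c : int -> Sym) :
  uniq s -> (forall p, sym_hom p (c p)) -> \sum_(p <- s) c p = 0 ->
  forall p, p \in s -> c p = 0.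
Proof.
move=> us hc c0 p ps; have := congr1 (sym_pr p) c0.
rewrite sym_pr0 sym_pr_sum (bigD1_seq p) //= (sym_pr_id p (hc p)) eqxx.
rewrite big1 ?addr0 // => q /negbTE qp.
by rewrite (sym_pr_id p (hc q)) qp.
Qed.

Definition symG : gvect k :=
  @GVect k Sym sym_hom sym_hom0 sym_hom_lin sym_hom_span sym_hom_free.

Lemma sym_hom_one : sym_hom 0 sym_one.
Proof. by have := sym_hom_mono [::]; rewrite /wdeg big_nil. Qed.

Lemma sym_hom_mul p q x y :
  sym_hom p x -> sym_hom q y -> sym_hom (p + q) (sym_mul x y).
Proof.
move=> [n [a [u [hu ->]]]] [m [b [v [hv ->]]]].
elim/big_ind: _ => [|x1 x2 h1 h2|i _]; first by rewrite sym_mul0l; apply: sym_hom0.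
  by rewrite -[x1]scale1r sym_mulDl; apply: sym_hom_lin.
rewrite -[_ *: _]addr0 sym_mulDl sym_mul0l; apply: sym_hom_lin; last exact: sym_hom0.
elim/big_ind: _ => [|x1 x2 h1 h2|j _]; first by rewrite sym_mul0r; apply: sym_hom0.
  by rewrite -[x1]scale1r sym_mulDr; apply: sym_hom_lin.
rewrite -[_ *: _]addr0 sym_mulDr sym_mul0r; apply: sym_hom_lin; last exact: sym_hom0.
by rewrite sym_mul_mono -(hu i) -(hv j) -wdeg_cat; apply: sym_hom_mono.
Qed.

Lemma ksgnD (m n : int) : ksgn k (m + n) = ksgn k m * ksgn k n.
Proof.
have E (z : int) : ksgn k z = (-1) ^ z.
  by case: z => z; rewrite /ksgn //= -[LHS]invr_sign.
by rewrite !E expfzDr // oppr_eq0 oner_eq0.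
Qed.

Lemma mono_move w (a : letter U) v z :
  mono (w ++ a :: v ++ z) = ksgn k (ldeg a * wdeg v) *: mono (w ++ v ++ a :: z).
Proof.
elim: v w => [|b v IH] w /=; first by rewrite /wdeg big_nil mulr0 /ksgn scale1r.
rewrite (proj2 mono_rel) -cat_rcons IH cat_rcons scalerA -ksgnD.
by rewrite wdeg_cons mulrDr.
Qed.

Lemma sym_mul_monoC u v :
  sym_mul (mono u) (mono v) = ksgn k (wdeg u * wdeg v) *: sym_mul (mono v) (mono u).
Proof.
rewrite !sym_mul_mono -[u ++ v]cat0s -[v ++ u]cat0s; move: ([::] : word) => w.
elim: u w => [|a u IH] w.
  by rewrite /= cats0 /wdeg big_nil mul0r /ksgn scale1r.
rewrite cat_cons -cat_rcons IH cat_rcons mono_move scalerA -ksgnD wdeg_cons mulrDl.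
by rewrite addrC.
Qed.

Lemma sym_mulC p q x y : sym_hom p x -> sym_hom q y ->
  sym_mul x y = ksgn k (p * q) *: sym_mul y x.
Proof.
have ml I (r : seq I) (F : I -> Sym) z :
    sym_mul (\sum_(i <- r) F i) z = \sum_(i <- r) sym_mul (F i) z.
  elim: r => [|i r IH]; first by rewrite !big_nil sym_mul0l.
  by rewrite !big_cons -[F i]scale1r sym_mulDl IH !scale1r.
have mr I (r : seq I) (F : I -> Sym) z :
    sym_mul z (\sum_(i <- r) F i) = \sum_(i <- r) sym_mul z (F i).
  elim: r => [|i r IH]; first by rewrite !big_nil sym_mul0r.
  by rewrite !big_cons -[F i]scale1r sym_mulDr IH !scale1r.
have zl c z t : sym_mul (c *: z) t = c *: sym_mul z t.
  by rewrite -[c *: z]addr0 sym_mulDl sym_mul0l addr0.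
have zr c z t : sym_mul z (c *: t) = c *: sym_mul z t.
  by rewrite -[c *: t]addr0 sym_mulDr sym_mul0r addr0.
move=> [n [a [u [hu ->]]]] [m [b [v [hv ->]]]].
rewrite ml mr scaler_sumr; apply: eq_bigr => i _; rewrite ml scaler_sumr mr.
apply: eq_bigr => j _; rewrite !zl !zr !scalerA sym_mul_monoC hu hv !scalerA.
by congr (_ *: _); rewrite mulrC [a i * _]mulrC mulrA.
Qed.

End Sym.

Arguments sym_lift {k U W} f x.

Record gcalg (k : fieldType) := GCAlg {
  gca_car :> gvect k;
  gmul : gca_car -> gca_car -> gca_car;
  gone : gca_car;
  gmul_linl : forall c x x' y, gmul (c *: x + x') y = c *: gmul x y + gmul x' y;
  gmul_linr : forall c x y y', gmul x (c *: y + y') = c *: gmul x y + gmul x y';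
  gmulA : associative gmul;
  gmul1 : left_id gone gmul;
  gone_hom : ghom 0 gone;
  gmul_hom : forall p q x y, ghom p x -> ghom q y -> ghom (p + q) (gmul x y);
  gmulC : forall p q x y, ghom p x -> ghom q y ->
    gmul x y = ksgn k (p * q) *: gmul y x
}.

Definition symA (k : fieldType) (U : gvect k) : gcalg k :=
  @GCAlg k (symG U) (@sym_mul k U) (sym_one U) (@sym_mulDl k U) (@sym_mulDr k U)
    (@sym_mulA k U) (@sym_mul1l k U) (@sym_hom_one k U) (@sym_hom_mul k U)
    (@sym_mulC k U).

Definition tens_rel (k : fieldType) (A B W : lmodType k) (f : A * B -> W) : Prop :=
  (forall b, linear (fun a => f (a, b))) /\ (forall a, linear (fun b => f (a, b))).

Definition tens (k : fieldType) (A B : lmodType k) : lmodType k :=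
  pres (@tens_rel k A B).

Definition tpure (k : fieldType) (A B : lmodType k) (a : A) (b : B) : tens A B :=
  pres_gen (@tens_rel k A B) (a, b).

(* The linear map out of the tensor product given by a bilinear map. *)
Definition tens_lift (k : fieldType) (A B W : lmodType k) (f : A -> B -> W) :
  tens A B -> W :=
  @pres_lift k (A * B) (@tens_rel k A B) W (fun ab => f ab.1 ab.2).

Section Coalgebra.
Variables (k : fieldType) (U : gvect k).

Definition wperm (w : word U) (s : 'S_(size w)) : word U :=
  [seq tnth (in_tuple w) (s i) | i : 'I_(size w)].

(* The Koszul sign of w |-> wperm w s. *)
Definition wsgn (w : word U) (s : 'S_(size w)) : k :=
  \prod_(i < size w) \prod_(j < size w | (i < j)%N && (s j < s i)%N)
    ksgn k (ldeg (tnth (in_tuple w) (s i)) * ldeg (tnth (in_tuple w) (s j))).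

(* s is an (n, m - n)-shuffle *)
Definition shuffle (m n : nat) (s : 'S_m) : bool :=
  [forall i : 'I_m, forall j : 'I_m,
     ((i < j)%N && ((j < n)%N || (n <= i)%N)) ==> (s i < s j)%N].

Definition comul : Sym U -> tens (Sym U) (Sym U) :=
  sym_lift (fun w => \sum_(n < (size w).+1) \sum_(s : 'S_(size w) | shuffle n s)
    wsgn s *: tpure (mono (take n (wperm s))) (mono (drop n (wperm s)))).

Definition counit : Sym U -> k :=
  @sym_lift k U k^o (fun w => if w is [::] then 1 else 0).

(* x |-> (-1)^|x| x *)
Definition parity : Sym U -> Sym U :=
  sym_lift (fun w => ksgn k (wdeg w) *: mono w).

(* (D (x) 1 + 1 (x) D) for D of degree one *)
Definition tens_der (D : Sym U -> Sym U) :
  tens (Sym U) (Sym U) -> tens (Sym U) (Sym U) :=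
  tens_lift (fun a b => tpure (D a) b + tpure (parity a) (D b)).

Definition is_coderivation (D : Sym U -> Sym U) : Prop :=
  linear D /\ forall x, comul (D x) = tens_der D (comul x).

(* The inclusion of U = S^1(U). *)
Definition inj1 (x : U) : Sym U :=
  let sc := projT1 (cid (ghom_span x)) in
  \sum_(p <- sc.1) mono [:: to_letter p (sc.2 p)].

(* The projection of S(U) to its cogenerators S^1(U) = U. *)
Definition pr_cogen : Sym U -> U :=
  sym_lift (fun w => if w is [:: a] then lval a else 0).

(* The coderivation extending the restriction of l to S^n(U). *)
Definition coder_word (n : nat) (l : Sym U -> U) (w : word U) : Sym U :=
  if (n <= size w)%N then
    \sum_(s : 'S_(size w) | shuffle n s)
      wsgn s *: sym_mul (inj1 (l (mono (take n (wperm s)))))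
                        (mono (drop n (wperm s)))
  else 0.

Definition coder (n : nat) (l : Sym U -> U) : Sym U -> Sym U :=
  sym_lift (coder_word n l).

(* The sum over n >= 1 of coder n l, a finite sum on each S^m(U). *)
Definition coder_sum (l : Sym U -> U) : Sym U -> Sym U :=
  sym_lift (fun w => \sum_(1 <= n < (size w).+1) coder_word n l w).

End Coalgebra.

(* The map S(U) -> S(U') induced by f : U -> U', where f raises degrees by the
   even integer n.  Used for f the identity of the underlying space, it is the
   m-fold double (de)suspension on each S^m. *)
Definition sym_map (k : fieldType) (U U' : gvect k) (n : int) (f : U -> U') :
  Sym U -> Sym U' :=
  sym_lift (fun w => mono [seq to_letter (ldeg a + n) (f (lval a)) | a <- w]).

(* The double suspensions S(V[1]) -> S(V[-1]) and S(V[2]) -> S(V), and the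
   inverse of the former. *)
Definition susp2 (k : fieldType) (V : gvect k) :
  Sym (shift V 1) -> Sym (shift V (-1)) :=
  @sym_map k (shift V 1) (shift V (-1)) 2 (fun x => x).
Definition desusp2 (k : fieldType) (V : gvect k) :
  Sym (shift V (-1)) -> Sym (shift V 1) :=
  @sym_map k (shift V (-1)) (shift V 1) (-2) (fun x => x).
Definition unshift2 (k : fieldType) (V : gvect k) : Sym (shift V 2) -> Sym V :=
  @sym_map k (shift V 2) V 2 (fun x => x).

(* An element of V[[hbar]] is its sequence of coefficients.  A continuous
   k[[hbar]]-linear map A[[hbar]] -> B[[hbar]] is given by its restriction
   A -> B[[hbar]], and [hext] is the extension. *)
Section Series.
Variable k : fieldType.

Definition hconst (V : lmodType k) (x : V) : nat -> V :=
  fun j => if j == 0%N then x else 0.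

(* Multiplication by hbar^n. *)
Definition hbarX (V : lmodType k) (n : nat) (s : nat -> V) : nat -> V :=
  fun j => if (n <= j)%N then s (j - n)%N else 0.

Definition hext (A B : lmodType k) (F : A -> nat -> B) (s : nat -> A) : nat -> B :=
  fun n => \sum_(i < n.+1) F (s i) (n - i)%N.

Definition hlinear (A B : lmodType k) (F : A -> nat -> B) : Prop :=
  forall j, linear (F^~ j).

(* F : A -> B[[hbar]] has degree d, hbar having degree 2. *)
Definition hdegree (A B : gvect k) (d : int) (F : A -> nat -> B) : Prop :=
  forall p x j, ghom p x -> ghom (p + d - 2 * j%:Z) (F x j).

Definition hmul (A : gcalg k) (s t : nat -> A) : nat -> A :=
  fun n => \sum_(i < n.+1) gmul (s i) (t (n - i)%N).

Definition hprod (A : gcalg k) (l : seq (nat -> A)) : nat -> A :=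
  foldr (@hmul A) (hconst (gone A)) l.

End Series.

Record linf (k : fieldType) := Linf {
  linf_car :> gvect k;
  linf_D : Sym (shift linf_car 1) -> Sym (shift linf_car 1);
  linf_coder : is_coderivation linf_D;
  linf_deg : forall p x, sym_hom p x -> sym_hom (p + 1) (linf_D x);
  linf_sq : forall x, linf_D (linf_D x) = 0;
  linf_one : linf_D (sym_one _) = 0
}.

(* D_n, the coderivation extending l_n, which is the projection of D to the
   cogenerators on S^n. *)
Definition linf_Dn (k : fieldType) (g : linf k) (n : nat) :
  Sym (shift g 1) -> Sym (shift g 1) :=
  coder n (fun x => pr_cogen (linf_D x)).

(* The operator (1/hbar) sum_(n >= 1) hbar^n D_n on S(g[-1]). *)
Definition linf_BV (k : fieldType) (g : linf k) :
  Sym (shift g (-1)) -> nat -> Sym (shift g (-1)) :=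
  fun x j => susp2 (linf_Dn j.+1 (desusp2 x)).

Arguments linf_BV {k} g x j.

Definition is_linf_mor (k : fieldType) (g' g : linf k)
    (F : Sym (shift g' 1) -> Sym (shift g 1)) : Prop :=
  [/\ linear F /\ (forall p x, sym_hom p x -> sym_hom p (F x)),
      forall x, comul (F x) = tens_lift (fun a b => tpure (F a) (F b)) (comul x),
      forall x, counit (F x) = counit x,
      F (sym_one _) = sym_one _ &
      forall x, F (linf_D x) = linf_D (F x)].

Definition linf_hom (k : fieldType) (g' g : linf k) : Type :=
  {F : Sym (shift g' 1) -> Sym (shift g 1) | is_linf_mor F}.

(* Morphisms of topological L_infinity-algebras over k[[hbar]]: S(U)[[hbar]] and
   S(W)[[hbar]] are the cofree coalgebras, D and D' the codifferentials. *)
Definition is_hlinf_mor (k : fieldType) (U W : gvect k)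
    (D : Sym U -> nat -> Sym U) (D' : Sym W -> nat -> Sym W)
    (F : Sym U -> nat -> Sym W) : Prop :=
  [/\ hlinear F /\ @hdegree k (symG U) (symG W) 0 F,
      forall x n, comul (F x n) =
        tens_lift (fun a b => \sum_(i < n.+1) tpure (F a i) (F b (n - i)%N))
          (comul x),
      forall x n, counit (F x n) = if n == 0%N then counit x else 0,
      F (sym_one _) = hconst (sym_one _) &
      forall x, hext F (D x) = hext D' (F x)].

Definition hlinf_hom (k : fieldType) (U W : gvect k)
    (D : Sym U -> nat -> Sym U) (D' : Sym W -> nat -> Sym W) : Type :=
  {F : Sym U -> nat -> Sym W | is_hlinf_mor D D' F}.

(* [[...[T, L_(a_1)], ...], L_(a_n)] for w = a_1 ... a_n and T of degree d;
   brackets are graded commutators. *)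
Fixpoint ncomm (k : fieldType) (A : gcalg k) (d : int) (T : A -> A) (w : word A) :
  A -> A :=
  if w is a :: w' then
    ncomm (d + ldeg a)
      (fun x => T (gmul (lval a) x) - ksgn k (d * ldeg a) *: gmul (lval a) (T x)) w'
  else T.

(* The operator T of degree d has order <= n. *)
Definition diffop (k : fieldType) (A : gcalg k) (n : nat) (d : int) (T : A -> A) :
  Prop :=
  linear T /\ forall (w : word A), size w = n.+1 -> forall x, ncomm d T w x = 0.

(* bv_op x j is Delta_(j+1) x, the coefficient of hbar^j in Delta x. *)
Record bvinf (k : fieldType) (A : gcalg k) := BVinf {
  bv_op :> A -> nat -> A;
  bv_deg : hdegree 1 bv_op;
  bv_order : forall j, diffop j.+1 (1 - 2 * j%:Z) (bv_op^~ j);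
  bv_sq : forall x, hext bv_op (bv_op x) = fun _ => 0;
  bv_one : bv_op (gone A) = fun _ => 0
}.

Section Brackets.
Variables (k : fieldType) (A : gcalg k) (B : bvinf A).

(* The coefficient of hbar^j in [[...[Delta, L_(a_1)], ...], L_(a_n)] 1. *)
Definition derived (w : word A) (j : nat) : A :=
  ncomm (1 - 2 * j%:Z) (B^~ j) w (gone A).

Lemma ncomm0 d (w : word A) x : ncomm d (fun _ => 0) w x = 0.
Proof.
elim: w d => [//|a w IH] d /=; rewrite -[RHS](IH (d + ldeg a)).
congr (ncomm _ _ _ _); apply: funext => y.
have -> : gmul (lval a) 0 = 0 :> A.
  have := gmul_linr 1 (lval a) 0 0; rewrite !scale1r addr0 => /eqP.
  by rewrite -subr_eq subrr eq_sym => /eqP.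
by rewrite scaler0 subr0.
Qed.

Lemma ncomm_cat d (T : A -> A) u v :
  ncomm d T (u ++ v) = ncomm (d + wdeg u) (ncomm d T u) v.
Proof.
elim: u d T => [|a u IH] d T /=; first by rewrite /wdeg big_nil addr0.
by rewrite IH wdeg_cons addrA.
Qed.

(* The n-fold iterated commutator is divisible by hbar^(n-1). *)
Lemma derived_div (w : word A) j : (j < (size w).-1)%N -> derived w j = 0.
Proof.
move=> jw; rewrite /derived -(cat_take_drop j.+2 w) ncomm_cat.
set T := ncomm _ _ (take _ _); suff -> : T = fun _ => 0 by apply: ncomm0.
apply: funext => x; apply: (proj2 (bv_order B j)).
by rewrite size_takel //; case: (size w) jw.
Qed.

(* L_n on each S^n(V), n >= 1, and 0 on S^0(V). *)
Definition hbracket (y : Sym A) (j : nat) : A :=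
  sym_lift (fun w => if w is [::] then 0 else derived w (j + (size w).-1)%N) y.

(* The codifferential on S(V[2])[[hbar]]. *)
Definition bv_codiff (x : Sym (shift A 2)) (j : nat) : Sym (shift A 2) :=
  @coder_sum k (shift A 2) (fun y => hbracket (unshift2 y) j) x.

End Brackets.

Section ExpLog.
Variables (k : fieldType) (U : gvect k) (A : gcalg k).

(* The common formula for exp and log: c is the sequence of coefficients, and
   i runs over the compositions i_0 + ... + i_(r-1) of the size of w. *)
Definition cumul_word (c : nat -> k) (phi : Sym U -> nat -> A) (w : word U)
    (j : nat) : A :=
  \sum_(1 <= r < (size w).+1) c r *:
    \sum_(i : {ffun 'I_r -> 'I_(size w).+1} |
            [forall t, (0 < i t)%N] && ((\sum_t i t)%N == size w))
      (\prod_t (i t)`!%:R)^-1 *: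
      \sum_(s : 'S_(size w)) wsgn s *:
        hprod [seq phi (mono b)
              | b <- reshape [seq (i t : nat) | t : 'I_r] (wperm s)] j.

Definition bv_exp (phi : Sym U -> nat -> A) (x : Sym U) (j : nat) : A :=
  sym_lift (fun w => if w is [::] then hconst (gone A) j
                     else cumul_word (fun r => r`!%:R^-1) phi w j) x.

(* On the empty word the sum is empty, so log(Phi)(1) = 0. *)
Definition bv_log (Phi : Sym U -> nat -> A) (x : Sym U) (j : nat) : A :=
  sym_lift (fun w => cumul_word (fun r => (-1) ^+ r.-1 / r%:R) Phi w j) x.

Definition is_bv_mor (Delta : Sym U -> nat -> Sym U) (Delta' : A -> nat -> A)
    (phi : Sym U -> nat -> A) : Prop :=
  [/\ hlinear phi /\ @hdegree k (symG U) A 0 phi,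
      phi (sym_one U) = fun _ => 0,
      forall x, hext (bv_exp phi) (Delta x) = hext Delta' (bv_exp phi x) &
      forall (n : nat) (w : word U), (n.+1 < size w)%N -> phi (mono w) n = 0].

Definition bv_hom (Delta : Sym U -> nat -> Sym U) (Delta' : A -> nat -> A) : Type :=
  {phi : Sym U -> nat -> A | is_bv_mor Delta Delta' phi}.

End ExpLog.

Definition bv_comp (k : fieldType) (U U' : gvect k) (A : gcalg k)
    (psi : Sym U' -> nat -> A) (phi : Sym U -> nat -> symA U') :
  Sym U -> nat -> A :=
  bv_log (fun x => hext (bv_exp psi) (bv_exp phi x)).

(* The map S(g'[-1]) -> S(g[-1])[[hbar]] equal to hbar^(n-1) times the projection
   of F to the cogenerators on S^n. *)
Definition bv_of_linf (k : fieldType) (g' g : linf k)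
    (F : Sym (shift g' 1) -> Sym (shift g 1)) :
  Sym (shift g' (-1)) -> nat -> Sym (shift g (-1)) :=
  fun x j => sym_lift (fun w =>
    if size w == j.+1
    then @inj1 k (shift g (-1)) (pr_cogen (F (desusp2 (mono w)))) else 0) x.

(* p_1 : S(V) -> V, seen in V[[hbar]] *)
Definition bv_p1 (k : fieldType) (V : gvect k) : Sym V -> nat -> V :=
  fun x => hconst (pr_cogen x).

(* Main.v *)
(* A BV-infinity morphism phi and an L-infinity morphism F correspond to each other when
   phi = hbar^(n-1) (p F) on S^n, p the projection to the cogenerators.  Let E be the
   map hbar^(-n) (multiplication) on S^n(V).  Then

     exp(phi) hbar^(-n) = E F,   Delta = hbar^(-n) D hbar^n on S(g[-1]),   Delta' E = E D',

   the last identity being the expansion of Delta' on a product in terms of the iterated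
   commutators.  Hence exp(phi) Delta = Delta' exp(phi) is the equation E (F D - D' F) = 0.
   As F D - D' F is a coderivation along F, by induction on n it takes primitive values on
   S^n as soon as it vanishes on the S^i with i < n; in characteristic zero the primitive
   elements are those of S^1, on which E is injective, so E (F D - D' F) = 0 implies
   F D = D' F.  Naturality follows from the same identities and log exp = id.  For the
   naturality in V one also needs that the n-th cumulant of exp(chi) with respect to the
   product of S(U) is divisible by hbar^(n-1); this is an induction based on the formula
   for a cumulant with an entry which is a product.  To avoid negative powers of hbar, E is
   replaced by hbar^m E on the sum of the S^i with i <= m ([mexp] below). *)

From mathcomp Require Import all_boot all_order all_algebra.
From mathcomp Require Import perm boolp functions ring.
Require Import Defs.

Set Implicit Arguments.
Unset Strict Implicit.
Unset Printing Implicit Defensive.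

Import GRing.Theory.
Local Open Scope ring_scope.

(** * Linear maps, signs and splittings of words *)

(** The formulas defining [bv_exp], [comul] and the codifferentials sum over compositions,
    permutations and shuffles, which are unsuited to induction. They are rewritten once as sums over
    splittings, [sp], which recurse on the first letter. Prepending a letter is a derivation of the
    convolution product, so exp(f)(a w) is the sum of f(a u) exp(f)(v) over the splittings (u, v) of
    w ([wexp_cons]); from there on this recursion replaces the permutation formula. A coalgebra
    morphism with projection f to the cogenerators is an exponential of the same kind, taken in the
    symmetric algebra with values [inj1 f]. Hence [bv_exp phi] and the coalgebra morphism attached
    to [phi] satisfy the same recursion in two algebras, and the multiplication map, corrected by
    powers of hbar, carries one to the other. Condition (3) on a BV-infinity morphism is what makes
    the divisions by hbar exact. Computations are made on words of homogeneous letters: signs then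
    depend on degrees of letters only, and shifts by even degrees leave them unchanged. *)

Section LinearFacts.
Variables (k : fieldType) (V W : lmodType k) (f : V -> W).
Hypothesis lf : linear f.

Lemma lin_D x y : f (x + y) = f x + f y.
Proof. by have := lf 1 x y; rewrite !scale1r. Qed.

Lemma lin_0 : f 0 = 0.
Proof. by apply: (addrI (f 0)); rewrite -lin_D !addr0. Qed.

Lemma lin_Z c x : f (c *: x) = c *: f x.
Proof. by have := lf c x 0; rewrite lin_0 !addr0. Qed.

Lemma lin_N x : f (- x) = - f x.
Proof. by rewrite -scaleN1r lin_Z scaleN1r. Qed.

Lemma lin_B x y : f (x - y) = f x - f y.
Proof. by rewrite lin_D lin_N. Qed.

Lemma lin_sum (I : Type) (r : seq I) (P : pred I) (F : I -> V) :
  f (\sum_(i <- r | P i) F i) = \sum_(i <- r | P i) f (F i).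
Proof. exact: (big_morph f lin_D lin_0). Qed.

Lemma lin_sum_scale (I : Type) (r : seq I) (P : pred I) (c : I -> k) (F : I -> V) :
  f (\sum_(i <- r | P i) c i *: F i) = \sum_(i <- r | P i) c i *: f (F i).
Proof. by rewrite lin_sum; apply: eq_bigr => i _; rewrite lin_Z. Qed.

End LinearFacts.

Lemma linear_comp (k : fieldType) (U V W : lmodType k) (f : V -> W) (g : U -> V) :
  linear f -> linear g -> linear (fun x => f (g x)).
Proof. by move=> lf lg c x y; rewrite lg lf. Qed.

Section Koszul.
Variables (k : fieldType).

Lemma ksgn_int (z : int) : ksgn k z = (-1) ^ z.
Proof. by case: z => z; rewrite /ksgn //= -[LHS]invr_sign. Qed.

Lemma ksgn_even (m : int) : ksgn k (m + m) = 1.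
Proof.
by rewrite ksgnD !ksgn_int -expfzMl mulrNN mulr1 exp1rz.
Qed.

(** Only the parity of the exponent matters; naming half of the difference, [z], turns a comparison
    of signs into an identity for [ring]. *)
Lemma ksgn_cong (z m n : int) : m = n + (z + z) -> ksgn k m = ksgn k n.
Proof. by move->; rewrite ksgnD ksgn_even mulr1. Qed.

Lemma ksgn_sq (m : int) : ksgn k m * ksgn k m = 1.
Proof. by rewrite -ksgnD ksgn_even. Qed.

End Koszul.

Section Letters.
Variables (k : fieldType) (U : gvect k).

Lemma letter_eq (a b : letter U) : ldeg a = ldeg b -> lval a = lval b -> a = b.
Proof.
case: a b => [p x hx] [q y hy] /= epq exy; move: hx hy; rewrite epq exy => hx hy.
by congr Letter; apply: Prop_irrelevance.
Qed.

Lemma ldeg_to_letter (p : int) (x : U) : ldeg (to_letter p x) = p.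
Proof. by rewrite /to_letter; case: pselect. Qed.

Lemma lval_to_letter (p : int) (x : U) : ghom p x -> lval (to_letter p x) = x.
Proof. by rewrite /to_letter; case: pselect. Qed.

Lemma wdeg_nil : wdeg ([::] : word U) = 0.
Proof. by rewrite /wdeg big_nil. Qed.

End Letters.

(* [sp w H] is the sum of [H u v] over the splittings of [w] into two
   complementary subwords [u], [v], with the Koszul sign of [w |-> u ++ v]. *)
Fixpoint sp (k : fieldType) (U : gvect k) (W : lmodType k) (w : word U)
    (H : word U -> word U -> W) : W :=
  if w is a :: w' then
    sp w' (fun u v => H (a :: u) v) +
    sp w' (fun u v => ksgn k (ldeg a * wdeg u) *: H u (a :: v))
  else H [::] [::].

Section Splittings.
Variables (k : fieldType) (U : gvect k).
Implicit Types (W : lmodType k) (w u v : word U) (a b : letter U).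

Lemma sp_ext W w (H H' : word U -> word U -> W) :
  (forall u v, (size u + size v = size w)%N -> wdeg u + wdeg v = wdeg w ->
     H u v = H' u v) ->
  sp w H = sp w H'.
Proof.
elim: w H H' => [|a w IH] H H' E /=; first by apply: E; rewrite // wdeg_nil addr0.
congr (_ + _); apply: IH => u v es ed.
  by apply: E; rewrite /= ?addSn ?es // !wdeg_cons -ed addrA.
by rewrite E //= ?addnS ?es // !wdeg_cons -ed addrCA.
Qed.

Lemma sp_lin W w c (H H' : word U -> word U -> W) :
  sp w (fun u v => c *: H u v + H' u v) = c *: sp w H + sp w H'.
Proof.
elim: w H H' => [|a w IH] H H' //=.
rewrite IH scalerDr addrACA; congr (_ + _); rewrite -IH.
by apply: sp_ext => u v _ _; rewrite scalerDr !scalerA mulrC.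
Qed.

Lemma sp_map W W' (g : W -> W') w (H : word U -> word U -> W) :
  linear g -> g (sp w H) = sp w (fun u v => g (H u v)).
Proof.
move=> lg; elim: w H => [|a w IH] H //=.
rewrite (lin_D lg) !IH; congr (_ + _); apply: sp_ext => u v _ _.
exact: lin_Z.
Qed.

Lemma spD W w (H H' : word U -> word U -> W) :
  sp w (fun u v => H u v + H' u v) = sp w H + sp w H'.
Proof.
rewrite -[sp w H]scale1r -sp_lin; apply: sp_ext => *; by rewrite scale1r.
Qed.

Lemma sp0 W w : sp w (fun _ _ => 0 : W) = 0.
Proof. by elim: w => [//|a w IH] /=; under [X in _ + X]sp_ext do rewrite scaler0; rewrite IH addr0. Qed.

Lemma spZ W w c (H : word U -> word U -> W) :
  sp w (fun u v => c *: H u v) = c *: sp w H.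
Proof.
by rewrite -[RHS]addr0 -(sp0 W w) -sp_lin; apply: sp_ext => *; rewrite addr0.
Qed.

Lemma sp_sum W w (I : Type) (r : seq I) (P : pred I) (H : I -> word U -> word U -> W) :
  sp w (fun u v => \sum_(i <- r | P i) H i u v) = \sum_(i <- r | P i) sp w (H i).
Proof.
elim: r => [|i r IH].
  by rewrite big_nil -[RHS](sp0 W w); apply: sp_ext => *; rewrite big_nil.
rewrite big_cons -IH; case: ifP => Pi; last first.
  by apply: sp_ext => *; rewrite big_cons Pi.
by rewrite -spD; apply: sp_ext => *; rewrite big_cons Pi.
Qed.

Lemma sp_eq0 W w (H : word U -> word U -> W) :
  (forall u v, (size u + size v = size w)%N -> wdeg u + wdeg v = wdeg w ->
     H u v = 0) -> sp w H = 0.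
Proof. by move=> E; rewrite (sp_ext E) sp0. Qed.

(** Coassociativity of the shuffle coproduct: both sides sum over splittings into three subwords,
    and the sign of moving [a] past [u1] and [u2] is the product of the signs of the two moves. *)
Lemma sp_coassoc W w (H : word U -> word U -> word U -> W) :
  sp w (fun x v => sp x (fun u1 u2 => H u1 u2 v)) =
  sp w (fun u x => sp x (fun v1 v2 => H u v1 v2)).
Proof.
elim: w H => [|a w IH] H //=.
rewrite spD (IH (fun u1 u2 v => H (a :: u1) u2 v)) -addrA; congr (_ + _).
rewrite (IH (fun u1 u2 v => ksgn k (ldeg a * wdeg u1) *: H u1 (a :: u2) v)).
under [RHS]sp_ext => u x _ _ do rewrite scalerDr.
rewrite spD; congr (_ + _); first by apply: sp_ext => u x _ _; rewrite spZ.
transitivity (sp w (fun x v => sp x (fun u1 u2 =>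
   ksgn k (ldeg a * (wdeg u1 + wdeg u2)) *: H u1 u2 (a :: v)))).
  by apply: sp_ext => x v _ _; rewrite -spZ; apply: sp_ext => u1 u2 _ <-.
rewrite (IH (fun u1 u2 v => _ *: H u1 u2 (a :: v))); apply: sp_ext => u x _ _.
by rewrite -spZ; apply: sp_ext => v1 v2 _ _; rewrite scalerA mulrDr ksgnD.
Qed.

Lemma sp_cocomm W w (H : word U -> word U -> W) :
  sp w H = sp w (fun u v => ksgn k (wdeg u * wdeg v) *: H v u).
Proof.
elim: w H => [|a w IH] H /=; first by rewrite wdeg_nil mul0r scale1r.
rewrite addrC IH (IH (fun u v => H (a :: u) v)); congr (_ + _).
  by apply: sp_ext => u v _ _; rewrite scalerA -ksgnD wdeg_cons mulrDl addrC.
apply: sp_ext => u v _ _; rewrite scalerA -ksgnD wdeg_cons; congr (_ *: _).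
by apply: (@ksgn_cong _ (- (ldeg a * wdeg u))); ring.
Qed.

(** Coassociativity and cocommutativity allow the second of three subwords to be split off first, at
    the cost of the sign of the exchange. *)
Lemma sp_exchange W w (H : word U -> word U -> word U -> W) :
  sp w (fun u x => sp x (fun v1 v2 => H u v1 v2)) =
  sp w (fun v x => sp x (fun u v2 => ksgn k (wdeg v * wdeg u) *: H u v v2)).
Proof.
rewrite -!sp_coassoc; apply: sp_ext => x v _ _; rewrite sp_cocomm.
by apply: sp_ext.
Qed.

Lemma sp_left0 W w (H : word U -> word U -> W) :
  sp w (fun u v => if u is [::] then H u v else 0) = H [::] w.
Proof.
elim: w H => [|a w IH] H //=; rewrite sp0 add0r.
rewrite -[RHS](IH (fun u v => H u (a :: v))); apply: sp_ext => -[|b u] v _ _.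
  by rewrite wdeg_nil mulr0 scale1r.
by rewrite scaler0.
Qed.

Lemma sp_right0 W w (H : word U -> word U -> W) :
  sp w (fun u v => if v is [::] then H u v else 0) = H w [::].
Proof.
elim: w H => [|a w IH] H //=.
rewrite [X in _ + X]sp_eq0 => [|*]; last by rewrite scaler0.
by rewrite addr0 (IH (fun u v => H (a :: u) v)).
Qed.

(** This makes sums over splittings descend to [Sym U]. Two neighbouring letters can be distributed
    over the two sides in four ways: two of them keep the letters together, and the two mixed ones
    are exchanged. *)
Lemma sp_rel W (H : word U -> word U -> W) :
  (forall v, sym_rel (fun u => H u v)) -> (forall u, sym_rel (H u)) ->
  sym_rel (fun w => sp w H).
Proof.
move=> H1 H2; split.
  move=> u v c a b d ea eb eab; elim: u H H1 H2 => [|e u IH] H H1 H2 /=.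
    rewrite scalerDr addrACA -!sp_lin; congr (_ + _); apply: sp_ext => x y _ _.
      exact: (proj1 (H1 y) [::] _ _ _ _ _ ea eb eab).
    rewrite (proj1 (H2 x) [::] _ _ _ _ _ ea eb eab) ea eb.
    by rewrite scalerDr !scalerA [c * _]mulrC.
  rewrite !IH; first by rewrite !scalerDr addrACA.
  - move=> y; split=> [u' v' c' a' b' d' ea' eb' eab'|u' v' a' b'].
      rewrite (proj1 (H1 _) _ _ _ _ _ _ ea' eb' eab') !wdeg_cat !wdeg_cons ea' eb'.
      by rewrite scalerDr !scalerA [c' * _]mulrC.
    rewrite (proj2 (H1 _)) !wdeg_cat !wdeg_cons !scalerA.
    by rewrite [ksgn k (ldeg e * _) * _]mulrC [ldeg a' + _]addrCA.
  - move=> x; split=> [u' v' c' a' b' d' ea' eb' eab'|u' v' a' b'].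
      rewrite (proj1 (H2 _) (e :: u') _ _ _ _ _ ea' eb' eab').
      by rewrite scalerDr !scalerA [c' * _]mulrC.
    by rewrite (proj2 (H2 _) (e :: u')) !scalerA [ksgn k (ldeg e * _) * _]mulrC.
  - by move=> y; apply: (catl_rel [:: e] (H1 y)).
  - by [].
move=> u v a b; elim: u H H1 H2 => [|e u IH] H H1 H2 /=.
  rewrite -addrA [X in _ + X]addrCA addrA !scalerDr -!spZ; congr (_ + _ + (_ + _)).
  - by apply: sp_ext => x y _ _; apply: (proj2 (H1 y) [::]).
  - apply: sp_ext => x y _ _; rewrite wdeg_cons mulrDr ksgnD -scalerA.
    by congr (_ *: (_ *: _)); rewrite mulrC.
  - apply: sp_ext => x y _ _; rewrite scalerA -ksgnD wdeg_cons; congr (_ *: _).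
    by apply: (@ksgn_cong _ (- (ldeg a * ldeg b))); ring.
  - apply: sp_ext => x y _ _; rewrite (proj2 (H2 x) [::]) !scalerA; congr (_ *: _).
    by rewrite -!ksgnD; congr ksgn; ring.
rewrite !IH; first by rewrite !scalerDr.
- move=> y; split=> [u' v' c' a' b' d' ea' eb' eab'|u' v' a' b'].
    rewrite (proj1 (H1 _) _ _ _ _ _ _ ea' eb' eab') !wdeg_cat !wdeg_cons ea' eb'.
    by rewrite scalerDr !scalerA [c' * _]mulrC.
  rewrite (proj2 (H1 _)) !wdeg_cat !wdeg_cons !scalerA.
  by rewrite [ksgn k (ldeg e * _) * _]mulrC [ldeg a' + _]addrCA.
- move=> x; split=> [u' v' c' a' b' d' ea' eb' eab'|u' v' a' b'].
    rewrite (proj1 (H2 _) (e :: u') _ _ _ _ _ ea' eb' eab').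
    by rewrite scalerDr !scalerA [c' * _]mulrC.
  by rewrite (proj2 (H2 _) (e :: u')) !scalerA [ksgn k (ldeg e * _) * _]mulrC.
- by move=> y; apply: (catl_rel [:: e] (H1 y)).
- by [].
Qed.

End Splittings.

(** * Sums over permutations and shuffles *)

Section Permutations.
Variables (k : fieldType) (U : gvect k).
Implicit Types (W : lmodType k) (w u v : word U) (a b : letter U).

(** A permutation of a nonempty word amounts to the place [i] of its first letter and a permutation
    of the other letters. *)
Lemma sum_lift_perm (W : nmodType) n (P : pred 'S_n.+1) (F : 'S_n.+1 -> W) :
  \sum_(s | P s) F s =
  \sum_(i < n.+1) \sum_(s | P (lift_perm i ord0 s)) F (lift_perm i ord0 s).
Proof.
(* As place [j] of the permuted word holds the letter with index [s j], the first letter stands at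
   the preimage of 0. *)
rewrite (partition_big (fun s : 'S_n.+1 => (s^-1)%g ord0) predT) //=.
apply: eq_bigr => i _; rewrite (reindex (lift_perm i ord0)) /=.
  apply: eq_bigl => s; rewrite lift_permV lift_perm_id eqxx andbT //.
pose ulsf i (s : 'S_n.+1) k := odflt k (unlift (s i) (s (lift i k))).
have ulsfK j (s : 'S_n.+1) x: lift (s j) (ulsf j s x) = s (lift j x).
  rewrite /ulsf; have:= neq_lift j x.
  by rewrite -(can_eq (permK s)) => /unlift_some[] ? ? ->.
have inj_ulsf: injective (ulsf i _).
  move=> s; apply: can_inj (ulsf (s i) s^-1%g) _ => k'.
  by rewrite {1}/ulsf ulsfK !permK liftK.
exists (fun s => perm (inj_ulsf s)) => [s _ | s].
  by apply/permP=> k'; rewrite permE /ulsf lift_perm_lift lift_perm_id liftK.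
rewrite inE => /andP[_ /eqP si]; have si0 : s i = ord0 by rewrite -si permKV.
apply/permP=> x; case: (unliftP i x) => [k'|] ->; rewrite ?lift_perm_id //.
by rewrite lift_perm_lift -si0 permE ulsfK.
Qed.

Lemma size_wperm w (s : 'S_(size w)) : size (wperm s) = size w.
Proof. by rewrite size_map size_enum_ord. Qed.

Lemma nth_wperm w (s : 'S_(size w)) x0 (j : 'I_(size w)) :
  nth x0 (wperm s) j = nth x0 w (s j).
Proof.
rewrite (nth_map j) ?size_enum_ord // nth_ord_enum.
by rewrite (tnth_nth x0).
Qed.

Lemma wperm_lift a w (i : 'I_(size w).+1) (s : 'S_(size w)) :
  @wperm k U (a :: w) (lift_perm i ord0 s) =
  take i (wperm s) ++ a :: drop i (wperm s).
Proof.
have si : (i <= size w)%N by rewrite -ltnS.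
have st : size (take i (wperm s)) = i by rewrite size_takel // size_wperm.
apply: (@eq_from_nth _ a); first by rewrite size_wperm size_cat /= st size_drop size_wperm addnS subnKC.
rewrite size_wperm => j jw; rewrite -[j]/(val (Ordinal jw)) nth_wperm nth_cat st.
case: (unliftP i (Ordinal jw)) => [j'|] ej; rewrite ej.
  rewrite lift_perm_lift lift0 /= /bump; case: (leqP i j') => ij.
    rewrite add1n ltnNge leqW //= subSn //=.
    by rewrite nth_drop subnKC // nth_wperm.
  by rewrite add0n ij nth_take // nth_wperm.
by rewrite lift_perm_id ltnn subnn.
Qed.

(** The inversions that involve [a] pair it with the letters placed before it; all others are
    inversions of [s]. *)
Lemma wsgn_lift a w (i : 'I_(size w).+1) (s : 'S_(size w)) :
  @wsgn k U (a :: w) (lift_perm i ord0 s) =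
  ksgn k (ldeg a * wdeg (take i (wperm s))) * wsgn s.
Proof.
rewrite /wsgn [LHS](bigD1_ord i) //= big1 ?mul1r => [|j]; last first.
  by rewrite lift_perm_id ltn0 andbF.
have -> : ksgn k (ldeg a * wdeg (take i (wperm s))) =
    \prod_(j < size w | (j < i)%N) ksgn k (ldeg (tnth (in_tuple w) (s j)) * ldeg a).
  have -> : ldeg a * wdeg (take i (wperm s)) =
     \sum_(j < size w | (j < i)%N) (ldeg (tnth (in_tuple w) (s j)) * ldeg a).
    rewrite mulrC -mulr_suml; congr (_ * _); rewrite /wdeg.
    have si : (i <= size w)%N by rewrite -ltnS.
    rewrite (big_nth a) size_takel ?size_wperm // big_mkord.
    rewrite (big_ord_widen _ (fun j => ldeg (nth a (take i (wperm s)) j)) si).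
    apply: eq_bigr => j ji; rewrite nth_take // nth_wperm.
    by rewrite (tnth_nth a).
  by apply: (big_morph _ (ksgnD k)).
rewrite [in RHS]big_mkcond -big_split /=; apply: eq_bigr => j _.
rewrite [LHS]big_mkcond (bigD1_ord i) //=.
rewrite lift_perm_id lift_perm_lift lift0 ltn0Sn andbT.
congr (_ * _).
  rewrite /bump; case: (leqP i j) => ij.
    by rewrite add1n ltnNge leqW.
  by rewrite add0n ij /= !(tnth_nth a).
rewrite [RHS]big_mkcond; apply: eq_bigr => j' _.
rewrite lift_perm_lift lift0 ltnS ltnNge leq_bump2 -ltnNge.
by rewrite !(tnth_nth a).
Qed.

Lemma size_ins a u i : (i <= size u)%N -> size (take i u ++ a :: drop i u) = (size u).+1.
Proof. by move=> ?; rewrite size_cat /= size_takel // size_drop addnS subnKC. Qed.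

(* [pm w G] is the sum of the values of [G] at the permutations of [w], with
   Koszul signs, the letters being inserted one by one. *)
Fixpoint pm W w (G : word U -> W) : W :=
  if w is a :: w' then
    pm w' (fun u => \sum_(i < (size u).+1)
      ksgn k (ldeg a * wdeg (take i u)) *: G (take i u ++ a :: drop i u))
  else G [::].

Lemma sum_perm W w (G : word U -> W) :
  \sum_(s : 'S_(size w)) wsgn s *: G (wperm s) = pm w G.
Proof.
elim: w G => [|a w IH] G.
  rewrite (big_pred1 (1%g : 'S_0)) => [|s]; last by apply/esym/eqP; apply: permS0.
  rewrite /wsgn big_ord0 scale1r /=; congr G.
  by apply: size0nil; rewrite size_wperm.
rewrite sum_lift_perm exchange_big /= -IH; apply: eq_bigr => s _.
rewrite size_wperm scaler_sumr; apply: eq_bigr => i _.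
by rewrite wsgn_lift wperm_lift scalerA mulrC.
Qed.

Lemma pm_ext W w (G G' : word U -> W) :
  (forall u, size u = size w -> wdeg u = wdeg w -> G u = G' u) -> pm w G = pm w G'.
Proof.
elim: w G G' => [|a w IH] G G' E /=; first exact: E.
apply: IH => u su du; apply: eq_bigr => i _; rewrite E //.
  by rewrite size_ins ?su // -ltnS.
by rewrite wdeg_cat !wdeg_cons addrCA -wdeg_cat cat_take_drop du.
Qed.

Lemma pmD W w (G G' : word U -> W) : pm w (fun u => G u + G' u) = pm w G + pm w G'.
Proof.
elim: w G G' => [|a w IH] G G' //=; rewrite -IH; apply: pm_ext => u _ _.
by rewrite -big_split /=; apply: eq_bigr => i _; rewrite scalerDr.
Qed.

Lemma pmZ W w c (G : word U -> W) : pm w (fun u => c *: G u) = c *: pm w G.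
Proof.
elim: w G => [|a w IH] G //=; rewrite -IH; apply: pm_ext => u _ _.
by rewrite scaler_sumr; apply: eq_bigr => i _; rewrite !scalerA mulrC.
Qed.

Lemma pm0 W w : pm w (fun _ => 0 : W) = 0.
Proof.
by rewrite -[RHS](scale0r (pm w (fun _ => 0 : W))) -pmZ; apply: pm_ext => *; rewrite scale0r.
Qed.

Lemma pm_sum W w (I : Type) (r : seq I) (P : pred I) (G : I -> word U -> W) :
  pm w (fun u => \sum_(i <- r | P i) G i u) = \sum_(i <- r | P i) pm w (G i).
Proof.
elim: r => [|i r IH].
  by rewrite big_nil -[RHS](pm0 W w); apply: pm_ext => *; rewrite big_nil.
rewrite big_cons -IH; case: ifP => Pi; last first.
  by apply: pm_ext => *; rewrite big_cons Pi.
by rewrite -pmD; apply: pm_ext => *; rewrite big_cons Pi.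
Qed.

Lemma pm_map W W' (g : W -> W') w (G : word U -> W) :
  linear g -> g (pm w G) = pm w (fun u => g (G u)).
Proof.
move=> lg; elim: w G => [|a w IH] G //=; rewrite IH.
by apply: pm_ext => u _ _; rewrite lin_sum_scale.
Qed.

Lemma sym_rel_move W (f : word U -> W) u v a : sym_rel f ->
  ksgn k (ldeg a * wdeg u) *: f (u ++ a :: v) = f (a :: u ++ v).
Proof.
move=> rf; elim: u f rf => [|b u IH] f rf /=; first by rewrite wdeg_nil mulr0 scale1r.
rewrite wdeg_cons mulrDr ksgnD -scalerA (IH _ (catl_rel [:: b] rf)) /=.
by rewrite (proj2 rf [::]) /= scalerA [ldeg b * _]mulrC ksgn_sq scale1r.
Qed.

(** All permutations contribute equally once the signs are taken into account. The resulting
    factorial is what cancels the denominators of the exponential in [compositions_cpow]. *)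
Lemma pm_sym W w (f : word U -> W) : sym_rel f -> pm w f = (size w)`!%:R *: f w.
Proof.
elim: w f => [|a w IH] f rf /=; first by rewrite scale1r.
transitivity (pm w (fun u => (size w).+1%:R *: f (a :: u))).
  apply: pm_ext => u su _; rewrite -su scaler_nat -[in RHS](card_ord (size u).+1) -sumr_const.
  by apply: eq_bigr => i _; rewrite sym_rel_move // cat_take_drop.
by rewrite pmZ (IH _ (catl_rel [:: a] rf)) factS natrM scalerA.
Qed.

Lemma sum_ins_split W a x n (H : word U -> word U -> W) : (n <= (size x).+1)%N ->
  \sum_(i < (size x).+1) ksgn k (ldeg a * wdeg (take i x)) *:
     H (take n (take i x ++ a :: drop i x)) (drop n (take i x ++ a :: drop i x)) =
  (if n is n'.+1 then
     \sum_(i < (size (take n' x)).+1) ksgn k (ldeg a * wdeg (take i (take n' x))) *: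
        H (take i (take n' x) ++ a :: drop i (take n' x)) (drop n' x) else 0) +
  (if (n <= size x)%N then
     \sum_(i < (size (drop n x)).+1)
        ksgn k (ldeg a * (wdeg (take n x) + wdeg (take i (drop n x)))) *:
        H (take n x) (take i (drop n x) ++ a :: drop i (drop n x)) else 0).
Proof.
move=> nx; rewrite -[LHS](big_mkord predT (fun i => ksgn k (ldeg a * wdeg (take i x)) *:
  H (take n (take i x ++ a :: drop i x)) (drop n (take i x ++ a :: drop i x)))).
rewrite (big_cat_nat (n := n)) //=; congr (_ + _).
  case: n nx => [|n]; first by rewrite big_geq.
  rewrite ltnS => nx; rewrite size_takel // -[RHS](big_mkord predT (fun i =>
    ksgn k (ldeg a * wdeg (take i (take n x))) *:
    H (take i (take n x) ++ a :: drop i (take n x)) (drop n x))).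
  apply: eq_big_nat => i /andP[_]; rewrite ltnS => i_n.
  have ix : size (take i x) = i by rewrite size_takel // (leq_trans i_n).
  rewrite take_cat drop_cat ix ltnNge leqW //= subSn //= take_takel //.
  by rewrite drop_drop subnK // take_drop subnK.
case: ifP => [nx'|/negbT]; last first.
  by rewrite -ltnNge => xn; rewrite big_geq.
rewrite -{1}[n]add0n big_addn big_mkord subSn // size_drop.
apply: eq_bigr => i _.
have sp : size (take n x) = n by rewrite size_takel.
have e1 : take (i + n) x = take n x ++ take i (drop n x).
  by rewrite addnC takeD.
have e2 : drop (i + n) x = drop i (drop n x) by rewrite drop_drop.
by rewrite e1 e2 -catA take_size_cat // drop_size_cat // wdeg_cat.
Qed.

(** A permutation cut after [n] letters is a splitting followed by a permutation of each part. In
    the induction the new letter is inserted before or after the cut, as separated by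
    [sum_ins_split]. *)
Lemma pm_split W w n (H : word U -> word U -> W) : (n <= size w)%N ->
  pm w (fun x => H (take n x) (drop n x)) =
  sp w (fun u v => if size u == n then pm u (fun u' => pm v (H u')) else 0).
Proof.
elim: w n H => [|a w IH] n H /=; first by rewrite leqn0 => /eqP ->.
move=> nw.
under pm_ext => x sx _ do rewrite sum_ins_split ?sx //.
rewrite pmD; congr (_ + _).
  case: n nw => [|n] nw; first by rewrite pm0 sp_eq0 // => u v _ _; rewrite eqxx.
  rewrite (IH n (fun p q => \sum_(i < (size p).+1)
     ksgn k (ldeg a * wdeg (take i p)) *: H (take i p ++ a :: drop i p) q)) //.
  apply: sp_ext => u v _ _; rewrite eqSS; case: ifP => // _.
  apply: pm_ext => u' _ _; rewrite pm_sum; apply: eq_bigr => i _.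
  by rewrite pmZ.
case: (leqP n (size w)) => [nw'|nw']; last first.
  rewrite sp_eq0 => [|u v su _]; first exact: pm0.
  have : (size u < n)%N by rewrite (leq_ltn_trans _ nw') // -su leq_addr.
  by rewrite ltn_neqAle => /andP[/negbTE -> _]; rewrite scaler0.
rewrite (IH n (fun p q => \sum_(i < (size q).+1)
     ksgn k (ldeg a * (wdeg p + wdeg (take i q))) *:
     H p (take i q ++ a :: drop i q))) //.
apply: sp_ext => u v _ _; case: ifP => _; last by rewrite scaler0.
rewrite -pmZ; apply: pm_ext => u' _ du; rewrite -pmZ; apply: pm_ext => v' _ _.
rewrite scaler_sumr; apply: eq_bigr => i _.
by rewrite du mulrDr ksgnD scalerA.
Qed.

Lemma shuffle_lift0 m n (s : 'S_m) :
  shuffle n.+1 (lift_perm ord0 ord0 s) = shuffle n s.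
Proof.
apply/'forall_forallP/'forall_forallP => H i j.
  have := H (lift ord0 i) (lift ord0 j).
  by rewrite !lift_perm_lift !lift0 !ltnS.
case: (unliftP ord0 i) => [i'|] ->; case: (unliftP ord0 j) => [j'|] ->;
  rewrite ?lift_perm_lift ?lift_perm_id ?lift0 ?ltnS ?ltnn ?ltn0 //=.
by rewrite implybT.
Qed.

Lemma bump_ltn i y : (bump i y < i)%N = (y < i)%N.
Proof.
rewrite /bump; case: (leqP i y) => iy; last by rewrite add0n iy.
by rewrite add1n ltnNge leqW.
Qed.

Lemma leq_bumpr i y : (i <= bump i y)%N = (i <= y)%N.
Proof. by rewrite leqNgt bump_ltn -leqNgt. Qed.

Lemma shuffle_lift m n (s : 'S_m) (i : 'I_m.+1) : i = n :> nat ->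
  shuffle n (lift_perm i ord0 s) = shuffle n s.
Proof.
move=> <-; apply/'forall_forallP/'forall_forallP => H x y.
  have := H (lift i x) (lift i y).
  rewrite !lift_perm_lift !lift0 ltnS /= bump_ltn leq_bumpr.
  by rewrite [(bump i x < _)%N]ltnNge leq_bump2 -ltnNge.
case: (unliftP i x) => [x'|] ->; case: (unliftP i y) => [y'|] ->;
  rewrite ?lift_perm_lift ?lift_perm_id ?lift0 ?ltnS ?ltnn ?ltn0 //=.
- rewrite bump_ltn leq_bumpr [(bump i _ < _)%N]ltnNge leq_bump2 -ltnNge.
  exact: H.
- by rewrite bump_ltn leq_bumpr /= ltnNge andNb.
- by rewrite implybT.
Qed.

(** The first letter has the smallest index, so it must head one of the two increasing blocks. *)
Lemma shuffle_liftF m n (s : 'S_m) (i : 'I_m.+1) :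
  i != n :> nat -> (n == 0)%N || (i != 0 :> nat) -> (n <= m)%N ->
  shuffle n (lift_perm i ord0 s) = false.
Proof.
move=> i_n n0 nm; apply/negbTE/negP => /'forall_forallP H.
have [ni|ni] := ltnP n i.
  have nm' : (n < m.+1)%N by [].
  by have /implyP := H (Ordinal nm') i; rewrite /= lift_perm_id ltn0 ni leqnn orbT => /(_ isT).
have {ni}i_n' : (i < n)%N by rewrite ltn_neqAle i_n.
have i0 : (0 < i)%N.
  by move: n0; rewrite -lt0n; case: (posnP n) i_n' => [->|//].
by have /implyP := H ord0 i; rewrite /= lift_perm_id ltn0 i0 i_n' => /(_ isT).
Qed.

(** Since the first letter heads one of the two blocks, shuffles obey the recursion that defines
    [sp]. *)
Lemma sum_shuffle W w n (H : word U -> word U -> W) : (n <= size w)%N ->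
  \sum_(s : 'S_(size w) | shuffle n s)
     wsgn s *: H (take n (wperm s)) (drop n (wperm s)) =
  sp w (fun u v => if size u == n then H u v else 0).
Proof.
elim: w n H => [|a w IH] n H /=.
  rewrite leqn0 => /eqP ->; rewrite (big_pred1 (1%g : 'S_0)) => [|s]; last first.
    have -> : s = 1%g by apply: permS0.
    by rewrite /= eqxx; apply/'forall_forallP => -[].
  rewrite /wsgn big_ord0 scale1r /=.
  by have -> : wperm (w := [::] : word U) 1%g = [::] by apply: size0nil; rewrite size_wperm.
move=> nw.
have E i (s : 'S_(size w)) :
   wsgn (w := a :: w) (lift_perm i ord0 s) *:
      H (take n (wperm (w := a :: w) (lift_perm i ord0 s)))
        (drop n (wperm (w := a :: w) (lift_perm i ord0 s))) =
   (ksgn k (ldeg a * wdeg (take i (wperm s))) * wsgn s) *: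
      H (take n (take i (wperm s) ++ a :: drop i (wperm s)))
        (drop n (take i (wperm s) ++ a :: drop i (wperm s))).
  by rewrite wsgn_lift wperm_lift.
rewrite sum_lift_perm.
under eq_bigr => i _ do under eq_bigr => s _ do rewrite E.
(* For [n = (size w).+1] the second block is empty and place 0 is the only possible one. *)
have [nw'|nw'] := leqP n (size w); last first.
  have En : n = (size w).+1 by apply/eqP; rewrite eqn_leq nw.
  rewrite big_ord_recl [X in _ + X]big1 ?addr0 => [|i _]; last first.
    apply: big1 => s; rewrite En => /'forall_forallP /(_ ord0 (lift ord0 i)) /implyP.
    by rewrite lift_perm_id ltn0 lift0 /= ltnS ltn_ord => /(_ isT).
  rewrite [X in _ = _ + X]sp_eq0 => [|u v su _]; last first.
    have : (size u < n)%N by rewrite (leq_ltn_trans _ nw') // -su leq_addr.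
    by rewrite ltn_neqAle => /andP[/negbTE -> _]; rewrite scaler0.
  rewrite addr0 En; under eq_bigl => s do rewrite shuffle_lift0.
  under eq_bigr => s _ do rewrite /= take0 drop0 wdeg_nil mulr0 mul1r /=.
  by rewrite (IH _ (fun u v => H (a :: u) v)).
pose F (i : 'I_(size w).+1) := \sum_(s | shuffle n (lift_perm i ord0 s))
   (ksgn k (ldeg a * wdeg (take i (wperm s))) * wsgn s) *:
      H (take n (take i (wperm s) ++ a :: drop i (wperm s)))
        (drop n (take i (wperm s) ++ a :: drop i (wperm s))).
have nw1 : (n < (size w).+1)%N by [].
rewrite -/F.
(* Only the places 0 and [n] survive, and they coincide for [n = 0]. *)
have -> : \sum_i F i = (if n is n'.+1 then F ord0 else 0) + F (Ordinal nw1).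
  rewrite (bigD1 (Ordinal nw1)) //= addrC; congr (_ + _).
  rewrite {}/F; case: n nw nw' nw1 {E} => [|n] nw nw' nw1.
    apply: big1 => i ni; apply: big1 => s; rewrite shuffle_liftF //.
  rewrite (bigD1 ord0) //= [X in _ + X]big1 ?addr0 // => i /andP[ni i0].
  by apply: big1 => s; rewrite shuffle_liftF.
congr (_ + _).
  rewrite {}/F {E}; case: n nw nw' nw1 => [|n] nw nw' nw1.
    by rewrite sp_eq0.
  rewrite /=; under eq_bigl => s do rewrite shuffle_lift0.
  under eq_bigr => s _ do rewrite /= take0 drop0 wdeg_nil mulr0 mul1r /=.
  by rewrite (IH _ (fun u v => H (a :: u) v)) // ltnW.
rewrite {}/F; under eq_bigl => s do rewrite shuffle_lift //.
transitivity (\sum_(s : 'S_(size w) | shuffle n s) wsgn s *: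
   (fun u v => ksgn k (ldeg a * wdeg u) *: H u (a :: v))
      (take n (wperm s)) (drop n (wperm s))).
  apply: eq_bigr => s _; have st : size (take n (wperm s)) = n by rewrite size_takel // size_wperm.
  by rewrite take_size_cat // drop_size_cat // scalerA mulrC.
rewrite (IH n (fun u v => ksgn k (ldeg a * wdeg u) *: H u (a :: v))) //.
by apply: sp_ext => u v _ _; case: ifP; rewrite ?scaler0.
Qed.

End Permutations.

(** * Power series *)

(* [cs n T] is the sum of [T i j] over [i + j = n].  The operations on power
   series are of this form, and [cs] is associative and commutative. *)
Definition cs (W : nmodType) (n : nat) (T : nat -> nat -> W) : W :=
  \sum_(i < n.+1) T i (n - i)%N.

Section CauchySums.
Variable W : nmodType.
Implicit Types (T : nat -> nat -> W).

Lemma cs_ext n T T' : (forall i j, (i + j = n)%N -> T i j = T' i j) -> cs n T = cs n T'.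
Proof. by move=> E; apply: eq_bigr => i _; apply: E; rewrite subnKC // -ltnS. Qed.

Lemma csC n T : cs n T = cs n (fun i j => T j i).
Proof.
rewrite /cs (reindex_inj rev_ord_inj) /=; apply: eq_bigr => i _.
by rewrite subSS subKn // -ltnS.
Qed.

Lemma csD n T T' : cs n (fun i j => T i j + T' i j) = cs n T + cs n T'.
Proof. exact: big_split. Qed.

Lemma cs_0 n : cs n (fun _ _ => 0 : W) = 0.
Proof. exact: big1. Qed.

Lemma cs_eq0 n T : (forall i j, (i + j = n)%N -> T i j = 0) -> cs n T = 0.
Proof. by move=> E; rewrite (cs_ext E) cs_0. Qed.

Lemma csA n (T : nat -> nat -> nat -> W) :
  cs n (fun l j => cs l (fun a b => T a b j)) = cs n (fun a l => cs l (fun b j => T a b j)).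
Proof.
rewrite /cs -(big_mkord predT (fun l => \sum_(i < l.+1) T i (l - i)%N (n - l)%N)).
rewrite -(big_mkord predT (fun a => \sum_(i < (n - a).+1) T a i (n - a - i)%N)).
under eq_big_nat => l _ do rewrite -(big_mkord predT (fun i => T i (l - i)%N (n - l)%N)).
under [RHS]eq_big_nat => l _ do rewrite -(big_mkord predT (fun i => T l i (n - l - i)%N)).
transitivity (\sum_(0 <= l < n.+1) \sum_(0 <= i < n.+1)
    if (i <= l)%N then T i (l - i)%N (n - l)%N else 0).
  apply: eq_big_nat => l /andP[_ ln]; rewrite -big_mkcond.
  by rewrite (big_nat_widen _ _ n.+1).
rewrite exchange_big_nat /=; apply: eq_big_nat => a /andP[_ an].
rewrite (big_cat_nat (n := a)) //=; last exact: ltnW.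
rewrite big_nat_cond big1 ?add0r => [|i /andP[/andP[_ ia] _]]; last first.
  by rewrite leqNgt ia.
rewrite -{1}[a]add0n big_addn subSn //; apply: eq_big_nat => i _.
by rewrite leq_addl addnK addnC subnDA.
Qed.

Lemma csCA n (T : nat -> nat -> nat -> W) :
  cs n (fun a l => cs l (fun b c => T a b c)) = cs n (fun b l => cs l (fun a c => T a b c)).
Proof. by rewrite -!csA; apply: cs_ext => l c _; rewrite csC. Qed.

Lemma cs_const n T :
  (forall i j, (0 < i)%N -> T i j = 0) -> cs n T = T 0%N n.
Proof.
by move=> T0; rewrite /cs big_ord_recl subn0 big1 ?addr0 // => i _; apply: T0.
Qed.

End CauchySums.

Lemma cs_map (W W' : nmodType) (g : W -> W') n (T : nat -> nat -> W) :
  g 0 = 0 -> {morph g : x y / x + y} -> g (cs n T) = cs n (fun i j => g (T i j)).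
Proof. by move=> g0 gD; apply: big_morph. Qed.

Lemma cs_lin (k : fieldType) (W W' : lmodType k) (g : W -> W') n (T : nat -> nat -> W) :
  linear g -> g (cs n T) = cs n (fun i j => g (T i j)).
Proof. by move=> lg; apply: cs_map; [apply: lin_0|apply: lin_D]. Qed.

Lemma csZ (k : fieldType) (W : lmodType k) n c (T : nat -> nat -> W) :
  c *: cs n T = cs n (fun i j => c *: T i j).
Proof. exact: scaler_sumr. Qed.

Section Convolution.
Variables (k : fieldType) (A B C : lmodType k) (m : A -> B -> C).

Definition hconv (s : nat -> A) (t : nat -> B) : nat -> C :=
  fun n => cs n (fun i j => m (s i) (t j)).

Lemma hconv_linear_l t : (forall b, linear (m^~ b)) -> linear (fun s => hconv s t).
Proof.
move=> lm c s s'; apply: funext => n.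
rewrite -[RHS]/(c *: cs n (fun i j => m (s i) (t j)) + cs n (fun i j => m (s' i) (t j))).
by rewrite csZ -csD; apply: cs_ext => i j _; rewrite -lm.
Qed.

Lemma hconv_linear_r s : (forall a, linear (m a)) -> linear (hconv s).
Proof.
move=> lm c t t'; apply: funext => n.
rewrite -[RHS]/(c *: cs n (fun i j => m (s i) (t j)) + cs n (fun i j => m (s i) (t' j))).
by rewrite csZ -csD; apply: cs_ext => i j _; rewrite -lm.
Qed.

End Convolution.

Section GradedAlgebra.
Variables (k : fieldType) (A : gcalg k).
Implicit Types (x y z : A) (s t r : nat -> A).

Lemma gmul_linear_l y : linear (fun x => gmul x y).
Proof. by move=> c x x'; apply: gmul_linl. Qed.

Lemma gmul_linear_r x : linear (gmul x).
Proof. by move=> c y y'; apply: gmul_linr. Qed.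

Lemma gmulr1 x : gmul x (gone A) = x.
Proof.
have [[s c] /= [_ hc ->]] := ghom_span x.
rewrite (lin_sum (gmul_linear_l _)); apply: eq_bigr => p _.
by rewrite (gmulC (hc p) (gone_hom A)) mulr0 scale1r gmul1.
Qed.

Definition hhom (V : gvect k) p (s : nat -> V) := forall j, ghom (p - 2 * j%:Z) (s j).

Lemma ghom_eq (V : gvect k) p q (x : V) : ghom p x -> p = q -> ghom q x.
Proof. by move=> ? <-. Qed.

Lemma ghom_sum (V : gvect k) p (I : Type) (l : seq I) (P : pred I) (F : I -> V) :
  (forall i, P i -> ghom p (F i)) -> ghom p (\sum_(i <- l | P i) F i).
Proof.
move=> H; elim/big_rec: _ => [|i x Pi hx]; first exact: ghom0.
by rewrite -[F i]scale1r; apply: ghom_lin => //; apply: H.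
Qed.

Lemma ghomZ (V : gvect k) p c (x : V) : ghom p x -> ghom p (c *: x).
Proof. by move=> h; rewrite -[_ *: _]addr0; apply: ghom_lin => //; apply: ghom0. Qed.

Lemma ghomD (V : gvect k) p (x y : V) : ghom p x -> ghom p y -> ghom p (x + y).
Proof. by move=> h h'; rewrite -[x]scale1r; apply: ghom_lin. Qed.

Lemma ghom_sp (V : gvect k) (U : gvect k) p w (H : word U -> word U -> V) :
  (forall u v, wdeg u + wdeg v = wdeg w -> (size u + size v = size w)%N -> ghom p (H u v)) -> ghom p (sp w H).
Proof.
elim: w H => [|a w IH] H E /=; first by apply: E; rewrite ?wdeg_nil.
apply: ghomD; apply: IH => u v e es.
  by apply: E; rewrite ?wdeg_cons -?e ?addrA //= addSn es.
by apply: ghomZ; apply: E; rewrite ?wdeg_cons -?e 1?addrCA //= addnS es.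
Qed.

Lemma hmulE s t n : hmul s t n = cs n (fun i j => gmul (s i) (t j)).
Proof. by []. Qed.

Lemma hmul_linear_l t : linear (fun s => hmul s t).
Proof. exact: (hconv_linear_l t gmul_linear_l). Qed.

Lemma hmul_linear_r s : linear (hmul s).
Proof. exact: (hconv_linear_r s gmul_linear_r). Qed.

Lemma hmulA s t r : hmul s (hmul t r) = hmul (hmul s t) r.
Proof.
apply: funext => n; rewrite !hmulE.
under [LHS]cs_ext => i l _ do rewrite hmulE (cs_lin _ _ (gmul_linear_r _)).
under [RHS]cs_ext => l i _ do rewrite hmulE (cs_lin _ _ (gmul_linear_l _)).
rewrite (csA n (fun i j l => gmul (gmul (s i) (t j)) (r l))).
by apply: cs_ext => i l _; apply: cs_ext => j m _; rewrite gmulA.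
Qed.

Lemma hmul1l s : hmul (hconst (gone A)) s = s.
Proof.
apply: funext => n; rewrite hmulE cs_const //; first by rewrite gmul1.
by move=> i j; rewrite lt0n => /negbTE i0; rewrite /hconst i0 (lin_0 (gmul_linear_l _)).
Qed.

Lemma hmul1r s : hmul s (hconst (gone A)) = s.
Proof.
apply: funext => n; rewrite hmulE csC cs_const //; first by rewrite gmulr1.
by move=> i j; rewrite lt0n => /negbTE i0; rewrite /hconst i0 (lin_0 (gmul_linear_r _)).
Qed.

Lemma hmul0l s : hmul (0 : nat -> A) s = 0.
Proof. exact: (lin_0 (hmul_linear_l s)). Qed.

Lemma hmul0r s : hmul s (0 : nat -> A) = 0.
Proof. exact: (lin_0 (hmul_linear_r s)). Qed.

Lemma hmulZl c s t : hmul (c *: s) t = c *: hmul s t.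
Proof. exact: (lin_Z (hmul_linear_l t)). Qed.

Lemma hmulZr c s t : hmul s (c *: t) = c *: hmul s t.
Proof. exact: (lin_Z (hmul_linear_r s)). Qed.

(** As [hbar] has even degree, all coefficients of the two series commute with the same sign. *)
Lemma hmulC p q s t : hhom p s -> hhom q t -> hmul s t = ksgn k (p * q) *: hmul t s.
Proof.
move=> hs ht; apply: funext => n; rewrite hmulE csC.
rewrite -[RHS]/(ksgn k (p * q) *: cs n (fun i j => gmul (t i) (s j))).
rewrite csZ; apply: cs_ext => i j _; rewrite (gmulC (hs j) (ht i)); congr (_ *: _).
by apply: (@ksgn_cong _ (- (p * i%:Z) - j%:Z * q + 2 * i%:Z * j%:Z)); ring.
Qed.

Lemma hmul_hom p q s t : hhom p s -> hhom q t -> hhom (p + q) (hmul s t).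
Proof.
move=> hs ht n; rewrite hmulE /cs; apply: ghom_sum => i _.
apply: (ghom_eq (gmul_hom (hs i) (ht (n - i)%N))).
have /subnK e : (i <= n)%N by rewrite -ltnS.
by have := congr1 Posz e; rewrite PoszD => <-; ring.
Qed.

Lemma hconst_hom (V : gvect k) p (x : V) : ghom p x -> hhom p (hconst x).
Proof.
by move=> hx [|j]; rewrite /hconst /= ?mulr0 ?subr0 //; apply: ghom0.
Qed.

End GradedAlgebra.

(** * The symmetric coalgebra *)

Section SymRel.
Variables (k : fieldType) (U : gvect k).
Implicit Types (W : lmodType k) (w u v : word U).

Lemma rel_lin W W' (g : W -> W') (f : word U -> W) :
  linear g -> sym_rel f -> sym_rel (fun w => g (f w)).
Proof.
move=> lg [H1 H2]; split=> [u v c a b d ea eb eab|u v a b].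
  by rewrite (H1 _ _ _ _ _ _ ea eb eab) lg.
by rewrite H2 lin_Z.
Qed.

Lemma rel_mono W (g : Sym U -> W) : linear g -> sym_rel (fun w => g (mono w)).
Proof. by move=> lg; apply: rel_lin (@mono_rel k U). Qed.

Lemma rel_if W (P : pred nat) (f : word U -> W) :
  sym_rel f -> sym_rel (fun w => if P (size w) then f w else 0).
Proof.
move=> [H1 H2]; split=> [u v c a b d ea eb eab|u v a b]; rewrite !size_cat /=.
  by case: ifP => _; rewrite ?scaler0 ?addr0 //; apply: H1.
by case: ifP => _; rewrite ?scaler0 //; apply: H2.
Qed.

Lemma rel_size W (f : nat -> word U -> W) :
  (forall n, sym_rel (f n)) -> sym_rel (fun w => f (size w) w).
Proof.
move=> H; split=> [u v c a b d ea eb eab|u v a b]; rewrite !size_cat /=.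
  exact: (proj1 (H _)).
exact: (proj2 (H _)).
Qed.

Lemma rel_nil W (f : word U -> W) x :
  sym_rel f -> sym_rel (fun w => if w is [::] then x else f w).
Proof.
move=> [H1 H2]; split=> [u v c a b d ea eb eab|u v a b].
  by case: u => [|e u] /=; [apply: (H1 [::])|apply: (H1 (e :: u))].
by case: u => [|e u] /=; [apply: (H2 [::])|apply: (H2 (e :: u))].
Qed.

Lemma rel_deg W (f : word U -> W) :
  sym_rel f -> sym_rel (fun w => ksgn k (wdeg w) *: f w).
Proof.
move=> [H1 H2]; split=> [u v c a b d ea eb eab|u v a b]; rewrite !wdeg_cat !wdeg_cons.
  by rewrite (H1 _ _ _ _ _ _ ea eb eab) ea eb scalerDr !scalerA [c * _]mulrC.
by rewrite H2 !scalerA [ldeg a + (_ + _)]addrCA [_ * ksgn k (ldeg a * _)]mulrC.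
Qed.

Lemma rel_add W (f g : word U -> W) :
  sym_rel f -> sym_rel g -> sym_rel (fun w => f w + g w).
Proof.
move=> [H1 H2] [H3 H4]; split=> [u v c a b d ea eb eab|u v a b].
  by rewrite (H1 _ _ _ _ _ _ ea eb eab) (H3 _ _ _ _ _ _ ea eb eab) scalerDr addrACA.
by rewrite H2 H4 scalerDr.
Qed.

Lemma rel0 W : sym_rel (fun _ : word U => 0 : W).
Proof. by split=> *; rewrite ?scaler0 ?addr0. Qed.

Lemma rel_sum W (I : Type) (r : seq I) (f : I -> word U -> W) :
  (forall i, sym_rel (f i)) -> sym_rel (fun w => \sum_(i <- r) f i w).
Proof.
move=> H; elim: r => [|i r IH].
  by rewrite (_ : (fun _ => _) = fun _ => 0); [apply: rel0|apply: funext => w; rewrite big_nil].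
rewrite (_ : (fun _ => _) = fun w => f i w + \sum_(j <- r) f j w); first exact: rel_add.
by apply: funext => w; rewrite big_cons.
Qed.

Lemma rel_coef W (f : word U -> nat -> W) j :
  sym_rel f -> sym_rel (fun w => f w j).
Proof. by apply: (@rel_lin _ _ (fun s : nat -> W => s j)) => c x y. Qed.

Lemma lin_ext W (F G : Sym U -> W) :
  linear F -> linear G -> (forall w, F (mono w) = G (mono w)) -> forall x, F x = G x.
Proof.
move=> lF lG E; apply: sym_ind => [|c w x IH]; first by rewrite !lin_0.
by rewrite lF lG E IH.
Qed.

Lemma sym_mul_linear_l (y : Sym U) : linear (fun x => sym_mul x y).
Proof. by move=> c x x'; apply: sym_mulDl. Qed.

Lemma sym_mul_linear_r (x : Sym U) : linear (sym_mul x).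
Proof. by move=> c y y'; apply: sym_mulDr. Qed.

Lemma hlinearP (V W : lmodType k) (F : V -> nat -> W) : hlinear F <-> linear F.
Proof.
split=> [lF c x y|lF j c x y]; last by rewrite lF.
by apply: funext => j; apply: lF.
Qed.

End SymRel.

Section Tensors.
Variables (k : fieldType).
Implicit Types A B W : lmodType k.

Lemma tens_lift_linear A B W (f : A -> B -> W) :
  (forall b, linear (f^~ b)) -> (forall a, linear (f a)) -> linear (tens_lift f).
Proof.
by move=> H1 H2; apply: (@pres_lift_linear k (A * B) (@tens_rel k A B)); split.
Qed.

Lemma tens_lift_pure A B W (f : A -> B -> W) a b :
  (forall b, linear (f^~ b)) -> (forall a, linear (f a)) ->
  tens_lift f (tpure a b) = f a b.
Proof.
move=> H1 H2; rewrite /tens_lift /tpure.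
by rewrite (@pres_lift_gen k (A * B) (@tens_rel k A B)) //; split.
Qed.

Lemma tpure_linear_l A B (b : B) : linear (fun a : A => tpure a b).
Proof.
move=> c x y; apply: (@pres_ext k (A * B) (@tens_rel k A B)) => W f [H1 H2].
rewrite pres_lift_linear //.
by rewrite /tpure !(@pres_lift_gen k (A * B) (@tens_rel k A B)) //=; apply: H1.
Qed.

Lemma tpure_linear_r A B (a : A) : linear (tpure a : B -> _).
Proof.
move=> c x y; apply: (@pres_ext k (A * B) (@tens_rel k A B)) => W f [H1 H2].
rewrite pres_lift_linear //.
by rewrite /tpure !(@pres_lift_gen k (A * B) (@tens_rel k A B)) //=; apply: H2.
Qed.

End Tensors.

Section Coproduct.
Variables (k : fieldType) (U : gvect k).
Implicit Types (W : lmodType k) (w u v : word U).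

Lemma sum_shuffle_all W w (H : word U -> word U -> W) :
  \sum_(n < (size w).+1) \sum_(s : 'S_(size w) | shuffle n s)
     wsgn s *: H (take n (wperm s)) (drop n (wperm s)) = sp w H.
Proof.
under eq_bigr => n _ do rewrite sum_shuffle -1?ltnS //.
rewrite -sp_sum; apply: sp_ext => u v su _.
have us : (size u < (size w).+1)%N by rewrite ltnS -su leq_addr.
rewrite (bigD1 (Ordinal us)) //= eqxx big1 ?addr0 // => i.
by rewrite -val_eqE /= eq_sym => /negbTE ->.
Qed.

Lemma comul_wordE :
  (fun w : word U => \sum_(n < (size w).+1) \sum_(s : 'S_(size w) | shuffle n s)
    wsgn s *: tpure (mono (take n (wperm s))) (mono (drop n (wperm s)))) =
  (fun w => sp w (fun u v => tpure (mono u) (mono v))).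
Proof. by apply: funext => w; rewrite -sum_shuffle_all. Qed.

Lemma comul_word_rel : sym_rel (fun w : word U => sp w (fun u v => tpure (mono u) (mono v))).
Proof.
apply: sp_rel => [v|u].
  exact: (rel_lin (tpure_linear_l _) (@mono_rel k U)).
exact: (rel_lin (tpure_linear_r _) (@mono_rel k U)).
Qed.

Lemma comul_linear : linear (@comul k U).
Proof. by apply: sym_lift_linear; rewrite comul_wordE; apply: comul_word_rel. Qed.

Lemma comul_mono w : comul (mono w) = sp w (fun u v => tpure (mono u) (mono v)).
Proof.
by rewrite /comul comul_wordE sym_lift_mono //; apply: comul_word_rel.
Qed.

Lemma comul_lift W (f : Sym U -> Sym U -> W) w :
  (forall b, linear (f^~ b)) -> (forall a, linear (f a)) ->
  tens_lift f (comul (mono w)) = sp w (fun u v => f (mono u) (mono v)).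
Proof.
move=> H1 H2; rewrite comul_mono (sp_map _ _ (tens_lift_linear H1 H2)).
by apply: sp_ext => u v _ _; rewrite tens_lift_pure.
Qed.

Lemma parity_rel : sym_rel (fun w : word U => ksgn k (wdeg w) *: mono w).
Proof. exact: (rel_deg (@mono_rel k U)). Qed.

Lemma parity_linear : linear (@parity k U).
Proof. exact: (sym_lift_linear parity_rel). Qed.

Lemma parity_mono w : parity (mono w) = ksgn k (wdeg w) *: mono w.
Proof. exact: (sym_lift_mono w parity_rel). Qed.

Lemma counit_rel : sym_rel (fun w : word U => if w is [::] then 1 else 0 : k^o).
Proof. exact: (rel_nil _ (rel0 _ _)). Qed.

Lemma counit_linear : linear (@counit k U : Sym U -> k^o).
Proof. exact: (sym_lift_linear counit_rel). Qed.

Lemma counit_mono w : counit (mono w) = if w is [::] then 1 else 0.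
Proof. by rewrite /counit (sym_lift_mono w counit_rel). Qed.

Lemma pr_cogen_rel : sym_rel (fun w : word U => if w is [:: a] then lval a else 0).
Proof.
split=> [u v c a b d ea eb eab|u v a b].
  by case: u v => [|e [|e' u]] [|e'' v] //=; rewrite scaler0 addr0.
by case: u => [|e [|e' u]] //=; rewrite scaler0.
Qed.

Lemma pr_cogen_linear : linear (@pr_cogen k U).
Proof. exact: (sym_lift_linear pr_cogen_rel). Qed.

Lemma pr_cogen_mono w : pr_cogen (mono w) = if w is [:: a] then lval a else 0.
Proof. exact: (sym_lift_mono w pr_cogen_rel). Qed.

Lemma mono1_lin (a b d : letter U) c : ldeg a = ldeg d -> ldeg b = ldeg d ->
  lval d = c *: lval a + lval b -> mono [:: d] = c *: mono [:: a] + mono [:: b].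
Proof. exact: (proj1 (@mono_rel k U) [::] [::]). Qed.

Lemma mono1_0 (a : letter U) : lval a = 0 -> mono [:: a] = 0.
Proof.
move=> a0; have := @mono1_lin a a a (-1) erefl erefl.
by rewrite scaleN1r a0 oppr0 addr0 => -> //; rewrite scaleN1r addNr.
Qed.

Lemma sum_subset_if (I : eqType) (W : zmodType) (r t : seq I) (d : I -> W) :
  uniq t -> uniq r -> {subset r <= t} ->
  \sum_(p <- r) d p = \sum_(p <- t) if p \in r then d p else 0.
Proof.
move=> ut ur rt; rewrite -big_mkcond /= -[RHS]big_filter; apply: perm_big.
apply: uniq_perm => //; first exact: filter_uniq.
by move=> p; rewrite mem_filter; case: (boolP (p \in r)) => //= /rt ->.
Qed.

(** The definition of [inj1] chooses a homogeneous decomposition. Any other one has the same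
    components by [ghom_free], once both are extended by zero to a common set of degrees. *)
Lemma inj1_decomp (s : seq int) (c : int -> U) : uniq s ->
  (forall p, ghom p (c p)) ->
  inj1 (\sum_(p <- s) c p) = \sum_(p <- s) mono [:: to_letter p (c p)].
Proof.
move=> us hc; set x := \sum_(p <- s) _; rewrite /inj1.
case: cid => -[s' c'] /= [us' hc' xE].
pose t := undup (s ++ s').
have ut : uniq t by apply: undup_uniq.
have st : {subset s <= t} by move=> p ps; rewrite mem_undup mem_cat ps.
have st' : {subset s' <= t} by move=> p ps; rewrite mem_undup mem_cat ps orbT.
rewrite (sum_subset_if _ ut us' st') (sum_subset_if _ ut us st).
have hif (r : seq int) d (dh : forall p, ghom p (d p)) p : ghom p (if p \in r then d p else 0 : U).
  by case: ifP => _ //; apply: ghom0.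
have E : forall p, p \in t -> (if p \in s' then c' p else 0) = (if p \in s then c p else 0).
  move=> p pt; apply/eqP; rewrite -subr_eq0; apply/eqP.
  apply: (@ghom_free k U t (fun p => (if p \in s' then c' p else 0) -
     (if p \in s then c p else 0)) ut) => // [q|].
    rewrite addrC -scaleN1r; apply: ghom_lin; exact: hif.
  by rewrite sumrB -!(sum_subset_if _ ut) // -xE subrr.
apply: eq_big_seq => p pt; have := E p pt.
have Z q : mono [:: to_letter q (0 : U)] = 0.
  by apply: mono1_0; rewrite lval_to_letter //; apply: ghom0.
by do 2!case: ifP => _; [move->|move->; rewrite Z|move<-; rewrite Z|].
Qed.

Lemma inj1_letter (a : letter U) : inj1 (lval a) = mono [:: a].
Proof.
have := @inj1_decomp [:: ldeg a] (fun p => if p == ldeg a then lval a else 0) isT _.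
rewrite !big_seq1 eqxx => ->; last first.
  by move=> p; case: eqP => [->|_]; [apply: lvalP|apply: ghom0].
congr (mono [:: _]); apply: letter_eq; rewrite ?ldeg_to_letter //.
by rewrite lval_to_letter //; apply: lvalP.
Qed.

Lemma inj1_hom p (x : U) (hx : ghom p x) : inj1 x = mono [:: Letter p x hx].
Proof. by rewrite -inj1_letter. Qed.

Lemma inj1_linear : linear (@inj1 k U).
Proof.
move=> c x y; have [[s d] /= [us hd ->]] := ghom_span x.
have [[s' d'] /= [us' hd' ->]] := ghom_span y.
pose t := undup (s ++ s').
have ut : uniq t by apply: undup_uniq.
have st : {subset s <= t} by move=> p ps; rewrite mem_undup mem_cat ps.
have st' : {subset s' <= t} by move=> p ps; rewrite mem_undup mem_cat ps orbT.
have hif (r : seq int) f (dh : forall p, ghom p (f p)) p : ghom p (if p \in r then f p else 0 : U).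
  by case: ifP => _ //; apply: ghom0.
rewrite (sum_subset_if _ ut us st) (sum_subset_if _ ut us' st') scaler_sumr -big_split /=.
have hl p := ghom_lin c (hif s d hd p) (hif s' d' hd' p).
rewrite (inj1_decomp ut hl) (inj1_decomp ut (hif s d hd)) (inj1_decomp ut (hif s' d' hd')).
rewrite scaler_sumr -big_split; apply: eq_bigr => p _ /=.
apply: mono1_lin; rewrite ?ldeg_to_letter // (lval_to_letter (hl p)).
by rewrite (lval_to_letter (hif s d hd p)) (lval_to_letter (hif s' d' hd' p)).
Qed.

Lemma inj1_sym_hom p (x : U) : ghom p x -> sym_hom p (inj1 x).
Proof.
move=> hx; rewrite (inj1_hom hx).
by have := sym_hom_mono [:: Letter p x hx]; rewrite wdeg_cons wdeg_nil addr0.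
Qed.

Lemma coder_word_sp (l : Sym U -> U) n w :
  coder_word n l w = sp w (fun u v =>
    if size u == n then sym_mul (inj1 (l (mono u))) (mono v) else 0).
Proof.
rewrite /coder_word; case: ifP => nw.
  by rewrite -(sum_shuffle (fun u v => sym_mul (inj1 (l (mono u))) (mono v))).
rewrite sp_eq0 // => u v su _; case: eqP => // un.
by move: nw; rewrite -un -su leq_addr.
Qed.

Lemma coder_term_rel (l : Sym U -> U) (P : pred nat) : linear l ->
  sym_rel (fun w => sp w (fun u v =>
    if P (size u) then sym_mul (inj1 (l (mono u))) (mono v) else 0)).
Proof.
move=> ll; apply: sp_rel => [v|u].
  apply: rel_if; apply: (rel_mono (g := fun x => sym_mul (inj1 (l x)) (mono v))).
  by apply: (linear_comp (sym_mul_linear_l _)); apply: (linear_comp inj1_linear).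
case: (P _); last exact: rel0.
exact: (rel_mono (sym_mul_linear_r _)).
Qed.

Lemma coder_word_rel (l : Sym U -> U) n : linear l -> sym_rel (coder_word n l).
Proof.
move=> ll; have := coder_term_rel (pred1 n) ll.
by congr sym_rel; apply: funext => w; rewrite coder_word_sp.
Qed.

Lemma coder_linear (l : Sym U -> U) n : linear l -> linear (coder n l).
Proof. by move=> ll; apply/sym_lift_linear/coder_word_rel. Qed.

Lemma coder_mono (l : Sym U -> U) n w : linear l ->
  coder n l (mono w) = sp w (fun u v =>
    if size u == n then sym_mul (inj1 (l (mono u))) (mono v) else 0).
Proof.
by move=> ll; rewrite /coder sym_lift_mono ?coder_word_sp //; apply: coder_word_rel.
Qed.

Lemma coder_sum_sp (l : Sym U -> U) w :
  \sum_(1 <= n < (size w).+1) coder_word n l w = sp w (fun u v =>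
    if (0 < size u)%N then sym_mul (inj1 (l (mono u))) (mono v) else 0).
Proof.
under eq_bigr => n _ do rewrite coder_word_sp.
rewrite -sp_sum; apply: sp_ext => u v su _; case: posnP => [->|u0].
  by rewrite big_nat big1 // => -[|i].
have us : size u \in index_iota 1 (size w).+1.
  by rewrite mem_index_iota u0 ltnS -su leq_addr.
rewrite (bigD1_seq _ us (iota_uniq _ _)) /= eqxx big1 ?addr0 // => i.
by rewrite eq_sym => /negbTE ->.
Qed.

Lemma coder_sum_rel (l : Sym U -> U) : linear l ->
  sym_rel (fun w => \sum_(1 <= n < (size w).+1) coder_word n l w).
Proof.
move=> ll; have := coder_term_rel (fun n => 0 < n)%N ll.
by congr sym_rel; apply: funext => w; rewrite coder_sum_sp.
Qed.

Lemma coder_sum_linear (l : Sym U -> U) : linear l -> linear (coder_sum l).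
Proof. by move=> ll; apply/sym_lift_linear/coder_sum_rel. Qed.

Lemma coder_sum_mono (l : Sym U -> U) w : linear l ->
  coder_sum l (mono w) = sp w (fun u v =>
    if (0 < size u)%N then sym_mul (inj1 (l (mono u))) (mono v) else 0).
Proof.
by move=> ll; rewrite /coder_sum sym_lift_mono ?coder_sum_sp //; apply: coder_sum_rel.
Qed.

End Coproduct.

(** * Exponential and logarithm *)

Definition ffun_cons (T : finType) n (x : T) (f : {ffun 'I_n -> T}) : {ffun 'I_n.+1 -> T} :=
  [ffun t => oapp f x (unlift ord0 t)].

Lemma big_ffun_recl (W : nmodType) (T : finType) n (P : pred {ffun 'I_n.+1 -> T})
    (F : {ffun 'I_n.+1 -> T} -> W) :
  \sum_(f | P f) F f = \sum_x \sum_(f | P (ffun_cons x f)) F (ffun_cons x f).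
Proof.
rewrite pair_big_dep /= (reindex (fun p => ffun_cons p.1 p.2)) //=.
exists (fun f : {ffun 'I_n.+1 -> T} => (f ord0, [ffun t => f (lift ord0 t)])).
  move=> [x f] _; congr (_, _); first by rewrite ffunE unlift_none.
  by apply/ffunP => t; rewrite !ffunE liftK.
move=> f _; apply/ffunP => t; rewrite ffunE /=.
by case: unliftP => [t'|] -> //=; rewrite ffunE.
Qed.

Section ConvolutionPowers.
Variables (k : fieldType) (U : gvect k) (A : gcalg k).
Hypothesis char0 : [pchar k] =i pred0.
Implicit Types (w u v : word U) (f : word U -> nat -> A).

Lemma natk_neq0 n : (n.+1%:R : k) != 0.
Proof. by rewrite ((pcharf0P _).1 char0). Qed.

Lemma factk_neq0 n : (n`!%:R : k) != 0.
Proof. by rewrite ((pcharf0P _).1 char0) -lt0n fact_gt0. Qed.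

(* The [r]-th convolution power of the restriction of [f] to nonempty words. *)
Fixpoint cpow (r : nat) f w : nat -> A :=
  if r is r'.+1 then
    sp w (fun u v => if u is [::] then 0 else hmul (f u) (cpow r' f v))
  else if w is [::] then hconst (gone A) else 0.

Lemma cpow_rel r f : sym_rel f -> sym_rel (cpow r f).
Proof.
move=> rf; elim: r => [|r IH] /=; first exact: (rel_nil _ (rel0 _ _)).
apply: sp_rel => [v|[|a u]]; last exact: (rel_lin (hmul_linear_r _)).
  by apply: rel_nil; apply: (rel_lin (hmul_linear_l _)).
exact: rel0.
Qed.

Lemma cpow_size r f w : (size w < r)%N -> cpow r f w = 0.
Proof.
elim: r w => [//|r IH] w wr /=; apply: sp_eq0 => -[//|a u] v su _.
rewrite IH ?hmul0r //; move: wr; rewrite -su /= addSn ltnS.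
exact/leq_trans/leq_addl.
Qed.

Lemma compositions_cpow M r f w : sym_rel f -> (size w < M)%N ->
  \sum_(i : {ffun 'I_r -> 'I_M} | [forall t, (0 < i t)%N] && ((\sum_t i t)%N == size w))
     (\prod_t (i t)`!%:R)^-1 *:
       pm w (fun x => hprod [seq f b | b <- reshape [seq (i t : nat) | t : 'I_r] x]) =
  cpow r f w.
Proof.
move=> rf; elim: r w => [|r IH] w wM.
  pose e : {ffun 'I_0 -> 'I_M} := [ffun=> Ordinal wM].
  have ee i : i = e by apply/ffunP => -[].
  have enum0 (i : {ffun 'I_0 -> 'I_M}) : [seq (i t : nat) | t : 'I_0] = [::].
    by apply: size0nil; rewrite size_map size_enum_ord.
  case: w wM e ee => [|a w] wM e ee; last first.
    by rewrite big_pred0 // => i; rewrite big_ord0 andbF.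
  rewrite (big_pred1 e) => [|i]; last first.
    by rewrite (ee i) /= eqxx big_ord0 eqxx andbT; apply/forallP => -[].
  by rewrite big_ord0 invr1 scale1r /= enum0.
rewrite big_ffun_recl; set fc := @ffun_cons _ r.
have fc0 x i : fc x i ord0 = x by rewrite ffunE unlift_none.
have fcS x i t : fc x i (lift ord0 t) = i t by rewrite ffunE liftK.
have sumfc x i : (\sum_(t < r) fc x i (lift ord0 t))%N = (\sum_t i t)%N.
  by apply: eq_bigr => t _; rewrite fcS.
have prodfc x i : \prod_(t < r) ((fc x i (lift ord0 t))`!%:R : k) = \prod_t (i t)`!%:R.
  by apply: eq_bigr => t _; rewrite fcS.
have fcP x (i : {ffun 'I_r -> 'I_M}) :
    [forall t, (0 < fc x i t)%N] = (0 < x)%N && [forall t, (0 < i t)%N].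
  apply/forallP/andP => [H|[H1 /forallP H2] t].
    by split; [have := H ord0; rewrite fc0|apply/forallP => t; have := H (lift ord0 t); rewrite fcS].
  by case: (unliftP ord0 t) => [t'|] ->; rewrite ?fc0 ?fcS.
have fcs x (i : {ffun 'I_r -> 'I_M}) :
    [seq (fc x i t : nat) | t : 'I_r.+1] = (x : nat) :: [seq (i t : nat) | t : 'I_r].
  rewrite /image_mem enum_ordSl /= fc0 -map_comp; congr (_ :: _).
  by apply: eq_map => t /=; rewrite fcS.
transitivity (\sum_(x < M) sp w (fun u v => if (size u == x) && (0 < x)%N then
    hmul (f u) (\sum_(i : {ffun 'I_r -> 'I_M} | [forall t, (0 < i t)%N] && ((\sum_t i t)%N == size v))
     (\prod_t (i t)`!%:R)^-1 *:
       pm v (fun x => hprod [seq f b | b <- reshape [seq (i t : nat) | t : 'I_r] x])) else 0)).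
  apply: eq_bigr => x _.
  have [x0|x0] := posnP x.
    rewrite big_pred0 => [|i]; last by rewrite fcP x0.
    by rewrite sp_eq0 // => u v _ _; rewrite andbF.
  have [xw|xw] := leqP x (size w); last first.
    rewrite big_pred0 => [|i]; last first.
      rewrite big_ord_recl fc0; apply/negbTE; rewrite negb_and; apply/orP; right.
      by rewrite neq_ltn orbC (leq_trans xw) // leq_addr.
    rewrite sp_eq0 // => u v su _; case: eqP => // ux; move: xw.
    by rewrite -su ux ltnNge leq_addr.
  transitivity (\sum_(i : {ffun 'I_r -> 'I_M} | [forall t, (0 < i t)%N] && ((x + \sum_t i t)%N == size w))
      sp w (fun u v => if size u == x then hmul (f u) ((\prod_t (i t)`!%:R)^-1 *:
       pm v (fun x => hprod [seq f b | b <- reshape [seq (i t : nat) | t : 'I_r] x])) else 0)).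
    apply: eq_big => [i|i _].
      by rewrite fcP x0 big_ord_recl fc0 sumfc.
    rewrite fcs big_ord_recl fc0 prodfc.
    rewrite /= (pm_split (fun u v => hmul (f u) (hprod
      [seq f b | b <- reshape [seq (i t : nat) | t : 'I_r] v])) xw) -spZ.
    apply: sp_ext => u v _ _; case: eqP => ux; last by rewrite scaler0.
    under pm_ext => u' _ _ do rewrite -(pm_map _ _ (hmul_linear_r (f u'))).
    rewrite -(pm_map _ _ (hmul_linear_l _)) pm_sym // ux hmulZl hmulZr !scalerA.
    congr (_ *: _); rewrite invfM mulrAC mulVf ?mul1r //; exact: factk_neq0.
  rewrite -sp_sum; apply: sp_ext => u v su _.
  rewrite andbT; case: eqP => ux; last by rewrite big1.
  rewrite (lin_sum (hmul_linear_r _)); apply: eq_bigl => i.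
  by rewrite -su ux eqn_add2l.
rewrite -sp_sum; apply: sp_ext => u v su _.
have uM : (size u < M)%N by rewrite (leq_ltn_trans _ wM) // -su leq_addr.
rewrite (bigD1 (Ordinal uM)) //= eqxx [X in _ + X]big1 => [|i]; last first.
  by rewrite -val_eqE /= eq_sym => /negbTE ->.
rewrite addr0; case: u su {uM} => [//|a u] su /=; rewrite IH //.
by rewrite (leq_ltn_trans _ wM) // -su leq_addl.
Qed.

Lemma cumul_wordE (c : nat -> k) (phi : Sym U -> nat -> A) w j : linear phi ->
  cumul_word c phi w j =
  (\sum_(1 <= r < (size w).+1) c r *: cpow r (fun u => phi (mono u)) w) j.
Proof.
move=> lphi; rewrite fct_sumE; apply: eq_bigr => r _.
rewrite -[RHS]/(c r *: cpow r (fun u => phi (mono u)) w j); congr (_ *: _).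
rewrite -(@compositions_cpow (size w).+1) //; last exact: rel_mono.
rewrite fct_sumE; apply: eq_bigr => i _.
rewrite -[RHS]/((_)^-1 *: pm _ _ j); congr (_ *: _).
by rewrite -sum_perm fct_sumE.
Qed.

End ConvolutionPowers.

Section ExpLogWords.
Variables (k : fieldType) (U : gvect k) (A : gcalg k).
Hypothesis char0 : [pchar k] =i pred0.
Implicit Types (w u v : word U) (f : word U -> nat -> A).

(** The exponential for convolution. Powers beyond [size w] vanish by [cpow_size], so the sum can be
    cut there, or at any larger bound ([wexp_bound]). *)
Definition wexp f w : nat -> A := \sum_(r < (size w).+1) (r`!%:R)^-1 *: cpow r f w.

Lemma wexp_rel f : sym_rel f -> sym_rel (wexp f).
Proof.
move=> rf; apply: (rel_size (f := fun n w => \sum_(r < n.+1) (r`!%:R)^-1 *: cpow r f w)).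
move=> n; apply: rel_sum => r; apply: (@rel_lin _ _ _ _ (fun x => r`!%:R^-1 *: x)).
  by move=> c x y; rewrite scalerDr !scalerA mulrC.
exact: cpow_rel.
Qed.

Lemma wexp_nil f : wexp f [::] = hconst (gone A).
Proof. by rewrite /wexp big_ord_recl big_ord0 addr0 invr1 scale1r. Qed.

Lemma wexp_bound N f w : (size w <= N)%N ->
  wexp f w = \sum_(r < N.+1) (r`!%:R)^-1 *: cpow r f w.
Proof.
move=> wN; rewrite /wexp -!(big_mkord predT (fun r => (r`!%:R)^-1 *: cpow r f w)).
rewrite [RHS](big_cat_nat (n := (size w).+1)) //= [X in _ = _ + X]big_nat_cond.
rewrite [X in _ = _ + X]big1 ?addr0 // => r /andP[/andP[wr _] _].
by rewrite cpow_size ?scaler0.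
Qed.

Lemma bv_exp_wordE (phi : Sym U -> nat -> A) : linear phi -> forall j,
  (fun w : word U => if w is [::] then hconst (gone A) j
          else cumul_word (fun r => r`!%:R^-1) phi w j) =
  (fun w => wexp (fun u => phi (mono u)) w j).
Proof.
move=> lphi j; apply: funext => -[|a w]; first by rewrite wexp_nil.
rewrite (cumul_wordE char0) // /wexp; set w' := a :: w.
rewrite -(big_mkord predT (fun r => (r`!%:R)^-1 *: cpow r (fun u => phi (mono u)) w')).
by rewrite [in RHS]big_nat_recl // scaler0 add0r big_add1.
Qed.

Lemma bv_exp_mono (phi : Sym U -> nat -> A) w : linear phi ->
  bv_exp phi (mono w) = wexp (fun u => phi (mono u)) w.
Proof.
move=> lphi; apply: funext => j; rewrite /bv_exp bv_exp_wordE //.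
rewrite sym_lift_mono //; apply: (rel_coef j (wexp_rel (rel_mono lphi))).
Qed.

Lemma bv_exp_linear (phi : Sym U -> nat -> A) : linear phi -> linear (bv_exp phi).
Proof.
move=> lphi; apply/hlinearP => j; rewrite /bv_exp bv_exp_wordE //.
apply: sym_lift_linear; apply: (rel_coef j (wexp_rel (rel_mono lphi))).
Qed.

Lemma bv_log_wordE (Phi : Sym U -> nat -> A) : linear Phi -> forall j,
  (fun w : word U => cumul_word (fun r => (-1) ^+ r.-1 / r%:R) Phi w j) =
  (fun w => (\sum_(1 <= r < (size w).+1) ((-1) ^+ r.-1 / r%:R) *:
                cpow r (fun u => Phi (mono u)) w) j).
Proof. by move=> lphi j; apply: funext => w; rewrite (cumul_wordE char0). Qed.

Lemma wlog_rel f : sym_rel f -> sym_rel (fun w =>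
  (\sum_(1 <= r < (size w).+1) ((-1) ^+ r.-1 / r%:R) *: cpow r f w)).
Proof.
move=> rf; apply: (rel_size (f := fun n w => \sum_(1 <= r < n.+1) ((-1) ^+ r.-1 / r%:R) *: cpow r f w)).
move=> n; apply: rel_sum => r; apply: (@rel_lin _ _ _ _ (fun x => ((-1) ^+ r.-1 / r%:R) *: x)).
  by move=> c x y; rewrite scalerDr !scalerA mulrC.
exact: cpow_rel.
Qed.

Lemma bv_log_mono (Phi : Sym U -> nat -> A) w : linear Phi ->
  bv_log Phi (mono w) = \sum_(1 <= r < (size w).+1) ((-1) ^+ r.-1 / r%:R) *:
                cpow r (fun u => Phi (mono u)) w.
Proof.
move=> lphi; apply: funext => j; rewrite /bv_log bv_log_wordE //.
rewrite sym_lift_mono //; apply: (rel_coef j (wlog_rel (rel_mono lphi))).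
Qed.

Lemma bv_log_linear (Phi : Sym U -> nat -> A) : linear Phi -> linear (bv_log Phi).
Proof.
move=> lphi; apply/hlinearP => j; rewrite /bv_log bv_log_wordE //.
apply: sym_lift_linear; apply: (rel_coef j (wlog_rel (rel_mono lphi))).
Qed.

Section Even.
Variable f : word U -> nat -> A.
Hypothesis hf : forall w, hhom (wdeg w) (f w).

Lemma hhom0 (V : gvect k) p : hhom p (0 : nat -> V).
Proof. by move=> j; apply: ghom0. Qed.

Lemma hhomZ (V : gvect k) p c (s : nat -> V) : hhom p s -> hhom p (c *: s).
Proof. by move=> hs j; apply: ghomZ. Qed.

Lemma hhom_sum (V : gvect k) p (I : Type) (l : seq I) (P : pred I) (F : I -> nat -> V) :
  (forall i, P i -> hhom p (F i)) -> hhom p (\sum_(i <- l | P i) F i).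
Proof. by move=> H j; rewrite fct_sumE; apply: ghom_sum => i Pi; apply: H. Qed.

Lemma hhom_sp (V : gvect k) p w (H : word U -> word U -> nat -> V) :
  (forall u v, wdeg u + wdeg v = wdeg w -> (size u + size v = size w)%N -> hhom p (H u v)) -> hhom p (sp w H).
Proof.
move=> E j; have -> : sp w H j = sp w (fun u v => H u v j).
  by rewrite (sp_map _ _ (g := fun s : nat -> V => s j)).
by apply: ghom_sp => u v d s; apply: E.
Qed.

Lemma cpow_hom r w : hhom (wdeg w) (cpow r f w).
Proof.
elim: r w => [|r IH] w /=.
  case: w => [|a w]; last exact: hhom0.
  by rewrite wdeg_nil; apply: hconst_hom; apply: gone_hom.
apply: hhom_sp => -[|a u] v d _; first exact: hhom0.
by rewrite -d; apply: hmul_hom.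
Qed.

Lemma wexp_hom w : hhom (wdeg w) (wexp f w).
Proof. by apply: hhom_sum => r _; apply: hhomZ; apply: cpow_hom. Qed.

Lemma cpow_consE r a w : cpow r.+1 f (a :: w) =
  sp w (fun u v => hmul (f (a :: u)) (cpow r f v)) +
  sp w (fun u v => ksgn k (ldeg a * wdeg u) *:
    (if u is [::] then 0 else hmul (f u) (cpow r f (a :: v)))).
Proof. by []. Qed.

(* The power rule for the derivation [w |-> a :: w] of the convolution algebra. *)
Lemma cpow_cons r a w : cpow r.+1 f (a :: w) =
  r.+1%:R *: sp w (fun u v => hmul (f (a :: u)) (cpow r f v)).
Proof.
elim: r w => [|r IH] w.
  rewrite scale1r [LHS]/= [X in _ + X]sp_eq0 ?addr0 // => -[|b u] v _ _; rewrite ?scaler0 //.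
  by rewrite hmul0r scaler0.
rewrite cpow_consE -[r.+2]addn1 natrD scalerDl scale1r addrC; congr (_ + _).
(* The induction hypothesis isolates the factor containing [a], which is then moved to the front;
   [sp_exchange] absorbs the sign of this move. *)
transitivity (sp w (fun u x => sp x (fun v1 v2 =>
   r.+1%:R *: (ksgn k (wdeg u * wdeg v1) *:
     hmul (f (a :: v1)) (if u is [::] then 0 else hmul (f u) (cpow r f v2)))))).
  apply: sp_ext => -[|b u] v _ _.
    by rewrite scaler0 sp_eq0 // => x y _ _; rewrite hmul0r !scaler0.
  rewrite IH hmulZr (sp_map _ _ (hmul_linear_r _)) scalerA mulrC -scalerA -spZ -spZ.
  apply: sp_ext => x y _ _; congr (_ *: _).
  rewrite !hmulA (hmulC (hf (b :: u)) (hf (a :: x))) hmulZl scalerA -ksgnD; congr (_ *: _).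
  rewrite [wdeg (a :: x)]wdeg_cons.
  by apply: (@ksgn_cong _ (ldeg a * wdeg (b :: u))); ring.
under sp_ext => u x _ _ do rewrite spZ.
rewrite spZ; congr (_ *: _); rewrite sp_exchange; apply: sp_ext => v x _ _.
rewrite (sp_map _ _ (hmul_linear_r _)); apply: sp_ext => u y _ _.
by rewrite scalerA mulrC [wdeg u * _]mulrC ksgn_sq scale1r.
Qed.

(** The derivative of exp(f) is f' exp(f): the factor [r.+1] of the power rule turns [1/(r+1)!] into
    [1/r!]. Together with the value on the empty word this characterizes the exponential
    ([wexp_unique]). *)
Lemma wexp_cons a w :
  wexp f (a :: w) = sp w (fun u v => hmul (f (a :: u)) (wexp f v)).
Proof.
rewrite /wexp big_ord_recl scaler0 add0r.
transitivity (\sum_(r < (size w).+1) sp w (fun u v =>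
    hmul (f (a :: u)) ((r`!%:R)^-1 *: cpow r f v))).
  apply: eq_bigr => r _; rewrite lift0 cpow_cons scalerA factS natrM invfM.
  rewrite mulrAC mulVf ?(natk_neq0 char0) // mul1r -spZ; apply: sp_ext => u v _ _.
  by rewrite hmulZr.
rewrite -sp_sum; apply: sp_ext => u v su _; rewrite -(lin_sum (hmul_linear_r _)).
by rewrite -(wexp_bound (N := size w) f) // -su leq_addl.
Qed.

End Even.

Lemma hmul_wexp_cpow f r w :
  sp w (fun u v => hmul (f u) (cpow r f v)) = hmul (f [::]) (cpow r f w) + cpow r.+1 f w.
Proof.
rewrite -[X in X + _](sp_left0 w (fun u v => hmul (f u) (cpow r f v))) -spD.
by apply: sp_ext => -[|a u] v _ _; rewrite ?addr0 ?add0r.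
Qed.

(* With [Phi = exp f] and [P = Phi - 1], this is the identity
   [Phi * (1 - P + P^2 - ...) = 1], applied to the logarithmic derivative of [Phi]. *)
Lemma wlog_wexp f w : (forall w, hhom (wdeg w) (f w)) -> f [::] = 0 ->
  \sum_(1 <= r < (size w).+1) ((-1) ^+ r.-1 / r%:R) *: cpow r (wexp f) w = f w.
Proof.
move=> hf f0; have hP := wexp_hom hf.
case: w => [|a w]; first by rewrite big_geq // f0.
rewrite big_add1 -[(size (a :: w)).+1.-1]/(size w).+1 big_mkord.
transitivity (\sum_(r < (size w).+1) sp w (fun u v =>
    (-1) ^+ r *: hmul (wexp f (a :: u)) (cpow r (wexp f) v))).
  apply: eq_bigr => r _; rewrite (cpow_cons hP) scalerA mulfVK ?(natk_neq0 char0) //.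
  by rewrite -spZ.
transitivity (sp w (fun x v => \sum_(r < (size w).+1) sp x (fun u y =>
   (-1) ^+ r *: hmul (f (a :: u)) (hmul (wexp f y) (cpow r (wexp f) v))))).
  rewrite -sp_sum; apply: sp_ext => u v _ _; apply: eq_bigr => r _.
  rewrite (wexp_cons hf) (sp_map _ _ (hmul_linear_l _)) -spZ; apply: sp_ext => x y _ _.
  by rewrite hmulA.
under sp_ext => x v _ _ do rewrite -sp_sum.
rewrite (sp_coassoc w (fun u y v => \sum_(r < (size w).+1) (-1) ^+ r *:
   hmul (f (a :: u)) (hmul (wexp f y) (cpow r (wexp f) v)))).
rewrite -[RHS]hmul1r -(sp_right0 w (fun u v => hmul (f (a :: u)) (hconst (gone A)))).
apply: sp_ext => u x su _; rewrite sp_sum.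
transitivity (\sum_(r < (size w).+1) hmul (f (a :: u)) ((-1) ^+ r *:
   (cpow r (wexp f) x + cpow r.+1 (wexp f) x))).
  apply: eq_bigr => r _; rewrite -{1}[cpow r _ x]hmul1l -(wexp_nil f) -hmul_wexp_cpow.
  rewrite spZ hmulZr; congr (_ *: _); rewrite (sp_map _ _ (hmul_linear_r _)).
  by apply: sp_ext.
rewrite -(lin_sum (hmul_linear_r _)).
have -> : \sum_(r < (size w).+1) (-1) ^+ r *: (cpow r (wexp f) x + cpow r.+1 (wexp f) x)
    = cpow 0 (wexp f) x.
  (* The alternating sum telescopes, and the last power vanishes because [x] has at most [size w]
     letters. *)
  have tel n : \sum_(r < n) (-1) ^+ r *: (cpow r (wexp f) x + cpow r.+1 (wexp f) x)
      = cpow 0 (wexp f) x - (-1) ^+ n *: cpow n (wexp f) x.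
    elim: n => [|n IH]; first by rewrite big_ord0 scale1r subrr.
    rewrite big_ord_recr /= IH -/(cpow n.+1 (wexp f) x) scalerDr addrA subrK.
    by rewrite exprS mulN1r scaleNr opprK.
  rewrite tel (cpow_size (r := (size w).+1)) ?scaler0 ?subr0 //.
  by rewrite ltnS -su leq_addl.
by case: x {su} => [|b x] //=; rewrite hmul0r.
Qed.

Lemma bv_log_exp (phi : Sym U -> nat -> A) : linear phi -> hdegree (A := symG U) 0 phi ->
  phi (sym_one U) = 0 -> bv_log (bv_exp phi) = phi.
Proof.
move=> lphi hphi phi1; have lexp := bv_exp_linear lphi.
apply: funext; apply: lin_ext => // [|w]; first exact: bv_log_linear.
rewrite bv_log_mono // -[RHS](wlog_wexp (f := fun u => phi (mono u))) //.
  by apply: eq_bigr => r _; congr (_ *: cpow _ _ _); apply: funext => u; rewrite bv_exp_mono.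
move=> u j; have := hphi _ _ j (sym_hom_mono u).
by rewrite addr0.
Qed.

End ExpLogWords.

(** * Primitive elements and coderivations *)

Section Primitives.
Variables (k : fieldType) (U : gvect k).
Hypothesis char0 : [pchar k] =i pred0.
Implicit Types (W : lmodType k) (w u v : word U) (x y : Sym U).

Definition weight_pr (n : nat) : Sym U -> Sym U :=
  sym_lift (fun w => if size w == n then mono w else 0).

Lemma weight_pr_rel n : sym_rel (fun w : word U => if size w == n then mono w else 0).
Proof. exact: (rel_if (pred1 n) (@mono_rel k U)). Qed.

Lemma weight_pr_linear n : linear (weight_pr n).
Proof. exact: (sym_lift_linear (weight_pr_rel n)). Qed.

Lemma weight_pr_mono n w : weight_pr n (mono w) = if size w == n then mono w else 0.
Proof. exact: (sym_lift_mono w (weight_pr_rel n)). Qed.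

Lemma weight_pr_sum x : exists N, forall M, (N <= M)%N -> x = \sum_(n < M) weight_pr n x.
Proof.
elim/sym_ind: x => [|c w x [N IH]].
  by exists 0%N => M _; rewrite big1 // => i _; rewrite (lin_0 (weight_pr_linear i)).
exists (maxn N (size w).+1) => M; rewrite geq_max => /andP[NM wM].
under eq_bigr => i _ do rewrite (weight_pr_linear i) weight_pr_mono.
rewrite big_split /= -IH //; congr (_ + _).
rewrite (bigD1 (Ordinal wM)) //= eqxx big1 ?addr0 // => i.
by rewrite -val_eqE /= eq_sym => /negbTE ->; rewrite scaler0.
Qed.

(** Each letter can go to either side, and graded symmetry undoes the rearrangement together with
    its sign. *)
Lemma sp_cat W (f : word U -> W) w : sym_rel f ->
  sp w (fun u v => f (u ++ v)) = (2 ^ size w)%:R *: f w.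
Proof.
elim: w f => [|a w IH] f rf /=; first by rewrite scale1r.
under [X in _ + X]sp_ext => u v _ _ do rewrite sym_rel_move //.
rewrite (IH _ (catl_rel [:: a] rf)) /= expnS mul2n -addnn natrD scalerDl.
by [].
Qed.

Lemma mul_comul n x : weight_pr n (tens_lift (@sym_mul k U) (comul x)) = (2 ^ n)%:R *: weight_pr n x.
Proof.
have lm : linear (tens_lift (@sym_mul k U)).
  by apply: tens_lift_linear => [b|a]; [apply: sym_mul_linear_l|apply: sym_mul_linear_r].
apply: (lin_ext (F := fun x => weight_pr n (tens_lift (@sym_mul k U) (comul x)))
                (G := fun x => (2 ^ n)%:R *: weight_pr n x)) => [c y z|c y z|w].
- by rewrite comul_linear lm weight_pr_linear.
- by rewrite weight_pr_linear scalerDr !scalerA mulrC.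
rewrite comul_lift; [|exact: sym_mul_linear_l|exact: sym_mul_linear_r].
under sp_ext => u v _ _ do rewrite sym_mul_mono.
rewrite (sp_cat w (@mono_rel k U)) (lin_Z (weight_pr_linear n)) weight_pr_mono.
by case: eqP => [->|_]; rewrite ?scaler0.
Qed.

Lemma weight1_inj1 x : weight_pr 1 x = inj1 (pr_cogen x).
Proof.
apply: (lin_ext (G := fun x => inj1 (pr_cogen x))); first exact: weight_pr_linear.
  by apply: linear_comp; [apply: inj1_linear|apply: pr_cogen_linear].
move=> w; rewrite weight_pr_mono pr_cogen_mono.
by case: w => [|a [|b w]] /=; rewrite ?(lin_0 (@inj1_linear k U)) ?inj1_letter.
Qed.

Lemma sym_mul1r x : sym_mul x (sym_one U) = x.
Proof. exact: (@gmulr1 k (symA U)). Qed.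

(* The product composed with the coproduct is [2^n] on [S^n]. *)
Lemma primitive_inj1 x : comul x = tpure x (sym_one U) + tpure (sym_one U) x ->
  x = inj1 (pr_cogen x).
Proof.
move=> px.
have H n : (2 ^ n)%:R *: weight_pr n x = 2%:R *: weight_pr n x.
  rewrite -mul_comul px.
  have lm : linear (tens_lift (@sym_mul k U)).
    by apply: tens_lift_linear => [b|a]; [apply: sym_mul_linear_l|apply: sym_mul_linear_r].
  rewrite (lin_D lm) !tens_lift_pure ?sym_mul1r ?sym_mul1l; try exact: sym_mul_linear_l;
    try exact: sym_mul_linear_r.
  by rewrite (lin_D (weight_pr_linear n)) -mulr2n scaler_nat.
(* The number [2^n - 2] is -1 for [n = 0] and positive for [n > 1], hence invertible in
   characteristic zero unless [n = 1]. *)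
have H0 n : n != 1%N -> weight_pr n x = 0.
  move=> n1; have /eqP := H n; rewrite -subr_eq0 -scalerBl scaler_eq0 => /orP[|/eqP//].
  case: n n1 {H} => [_|[//|n] _].
    by rewrite expn0 -opprB oppr_eq0 -natrB // (negbTE (natk_neq0 char0 0)).
  have e : (2 <= 2 ^ n.+2)%N by rewrite -{1}(expn1 2) leq_exp2l.
  rewrite -natrB //.
  have : (2 ^ n.+2 - 2)%N = (2 ^ n.+2 - 2).-1.+1.
    by rewrite prednK // subn_gt0 -{1}(expn1 2) ltn_exp2l.
  by move=> ->; rewrite (negbTE (natk_neq0 char0 _)).
rewrite -weight1_inj1; have [N HN] := weight_pr_sum x.
rewrite [LHS](HN _ (leq_addl 2 N)) (bigD1 (lift ord0 ord0)) //= big1 ?addr0 // => i.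
by rewrite -val_eqE /= => /H0.
Qed.

End Primitives.

Section Series.
Variables (k : fieldType).

Definition hten (A B : lmodType k) (s : nat -> A) (t : nat -> B) : nat -> tens A B :=
  fun n => cs n (fun i j => tpure (s i) (t j)).

Lemma hten_linear_l (A B : lmodType k) (t : nat -> B) : linear (fun s : nat -> A => hten s t).
Proof. exact: (hconv_linear_l t (@tpure_linear_l k A B)). Qed.

Lemma hten_linear_r (A B : lmodType k) (s : nat -> A) : linear (fun t : nat -> B => hten s t).
Proof. exact: (hconv_linear_r s (@tpure_linear_r k A B)). Qed.

Lemma hten1l (A B : lmodType k) (a : A) (t : nat -> B) n : hten (hconst a) t n = tpure a (t n).
Proof.
rewrite /hten cs_const // => i j i0.
by rewrite /hconst -[i == 0%N]negbK -lt0n i0 (lin_0 (tpure_linear_l _)).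
Qed.

Lemma hten1r (A B : lmodType k) (s : nat -> A) (b : B) n : hten s (hconst b) n = tpure (s n) b.
Proof.
rewrite /hten csC cs_const // => i j i0.
by rewrite /hconst -[i == 0%N]negbK -lt0n i0 (lin_0 (tpure_linear_r _)).
Qed.

Lemma hten0l (A B : lmodType k) (t : nat -> B) : hten (0 : nat -> A) t = 0.
Proof. exact: (lin_0 (hten_linear_l t)). Qed.

Lemma hten0r (A B : lmodType k) (s : nat -> A) : hten s (0 : nat -> B) = 0.
Proof. exact: (lin_0 (hten_linear_r s)). Qed.

Definition hcomul (U : gvect k) (s : nat -> Sym U) : nat -> tens (Sym U) (Sym U) :=
  fun n => comul (s n).

Lemma hcomul_linear (U : gvect k) : linear (@hcomul U).
Proof. by move=> c s t; apply: funext => n; apply: comul_linear. Qed.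

End Series.

(* Differences of coalgebra morphisms, and coderivations along a morphism, satisfy
   the hypothesis on [G]; by induction on the length they take primitive values. *)
Lemma coalg_unique (k : fieldType) (char0 : [pchar k] =i pred0) (U W : gvect k)
    (G P Q : word U -> nat -> Sym W) :
  P [::] = hconst (sym_one W) -> Q [::] = hconst (sym_one W) ->
  (forall w, hcomul (G w) = sp w (fun u v => hten (G u) (P v) + hten (Q u) (G v))) ->
  (forall w, (forall n, G w n = inj1 (pr_cogen (G w n))) -> G w = 0) ->
  forall w, G w = 0.
Proof.
move=> P1 Q1 GC Gprim w; have [N] := ubnP (size w); elim: N w => // N IH w wN.
apply: Gprim => n; apply: (primitive_inj1 char0).
rewrite -[comul _]/(hcomul (G w) n) GC.
rewrite -hten1r -[X in _ + X]hten1l.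
case: w wN => [|a w] wN; first by rewrite /= P1 Q1.
rewrite ltnS in wN; have G0 : G [::] = 0 by apply: IH; apply: leq_trans wN.
pose T u v := hten (G u) (P v) + hten (Q u) (G v).
pose w' := a :: w.
(* Splittings with two nonempty parts contribute zero by induction, so only the two terms of a
   primitive coproduct remain. *)
have -> : sp w' T = sp w' (fun u v => if v is [::] then T u v else 0) +
                    sp w' (fun u v => if u is [::] then T u v else 0).
  rewrite -spD; apply: sp_ext => u v su _.
  case: u v su => [|b u] [|c v] //= su; rewrite ?add0r ?addr0 //.
  rewrite /T (IH (b :: u)) ?(IH (c :: v)) ?hten0l ?hten0r ?addr0 //.
    by apply: leq_trans wN; rewrite /= -su addSn addnS !ltnS ?leq_addl ?leq_addr.
  by apply: leq_trans wN; rewrite /= -su addSn addnS !ltnS ?leq_addl ?leq_addr.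
rewrite sp_right0 sp_left0 /T G0 hten0l hten0r addr0 add0r P1 Q1.
by [].
Qed.

(** * Compatibility of the coproduct with the product *)

Section CoproductProduct.
Variables (k : fieldType) (U : gvect k).
Implicit Types (w u v : word U) (x y : Sym U).

(** The Koszul sign of moving something of degree [p] past the argument; [parity] is the case of odd
    [p]. *)
Definition pparity (p : int) : Sym U -> Sym U :=
  sym_lift (fun w => ksgn k (p * wdeg w) *: mono w).

Lemma pparity_rel p : sym_rel (fun w : word U => ksgn k (p * wdeg w) *: mono w).
Proof.
have [H1 H2] := @mono_rel k U.
split=> [u v c a b d ea eb eab|u v a b]; rewrite !wdeg_cat !wdeg_cons.
  by rewrite (H1 _ _ _ _ _ _ ea eb eab) ea eb scalerDr !scalerA [c * _]mulrC.
by rewrite H2 !scalerA [ldeg a + (_ + _)]addrCA [_ * ksgn k (ldeg a * _)]mulrC.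
Qed.

Lemma pparity_linear p : linear (pparity p).
Proof. exact: (sym_lift_linear (pparity_rel p)). Qed.

Lemma pparity_mono p w : pparity p (mono w) = ksgn k (p * wdeg w) *: mono w.
Proof. exact: (sym_lift_mono w (pparity_rel p)). Qed.

Lemma pparity_hom p q x : sym_hom q x -> pparity p x = ksgn k (p * q) *: x.
Proof.
move=> [n [c [w [hw ->]]]]; rewrite (lin_sum_scale (pparity_linear p)) scaler_sumr.
by apply: eq_bigr => i _; rewrite pparity_mono hw !scalerA mulrC.
Qed.

(** [tmul_l a] and [tmul_r p a] are the left multiplications by [a (x) 1] and [1 (x) a] on the
    tensor square, with [p] the degree of [a]. *)
Definition tmul_l (a : Sym U) : tens (Sym U) (Sym U) -> tens (Sym U) (Sym U) :=
  tens_lift (fun x y => tpure (sym_mul a x) y).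
Definition tmul_r p (a : Sym U) : tens (Sym U) (Sym U) -> tens (Sym U) (Sym U) :=
  tens_lift (fun x y => tpure (pparity p x) (sym_mul a y)).

Lemma tmul_l_linear a : linear (tmul_l a).
Proof.
apply: tens_lift_linear => [y|x]; last exact: tpure_linear_r.
exact: (linear_comp (tpure_linear_l y) (sym_mul_linear_r a)).
Qed.

Lemma tmul_r_linear p a : linear (tmul_r p a).
Proof.
apply: tens_lift_linear => [y|x].
  exact: (linear_comp (tpure_linear_l (sym_mul a y)) (pparity_linear p)).
exact: (linear_comp (tpure_linear_r (pparity p x)) (sym_mul_linear_r a)).
Qed.

Lemma tmul_l_pure a x y : tmul_l a (tpure x y) = tpure (sym_mul a x) y.
Proof.
rewrite /tmul_l tens_lift_pure // => [y'|x']; last exact: tpure_linear_r.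
exact: (linear_comp (tpure_linear_l y') (sym_mul_linear_r a)).
Qed.

Lemma tmul_r_pure p a x y : tmul_r p a (tpure x y) = tpure (pparity p x) (sym_mul a y).
Proof.
rewrite /tmul_r tens_lift_pure // => [y'|x'].
  exact: (linear_comp (tpure_linear_l (sym_mul a y')) (pparity_linear p)).
exact: (linear_comp (tpure_linear_r (pparity p x')) (sym_mul_linear_r a)).
Qed.

(** A generator is primitive and the coproduct is multiplicative; on monomials this is the recursion
    of [sp] itself. *)
Lemma comul_mul1 p (x : U) y : ghom p x ->
  comul (sym_mul (inj1 x) y) = tmul_l (inj1 x) (comul y) + tmul_r p (inj1 x) (comul y).
Proof.
move=> hx; rewrite (inj1_hom hx); set a := Letter p x hx.
apply: (lin_ext (F := fun y => comul (sym_mul (mono [:: a]) y))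
  (G := fun y => tmul_l (mono [:: a]) (comul y) + tmul_r p (mono [:: a]) (comul y))) => [||w].
- by apply: linear_comp; [apply: comul_linear|apply: sym_mul_linear_r].
- move=> c z z'; rewrite comul_linear tmul_l_linear tmul_r_linear.
  by rewrite scalerDr addrACA.
rewrite sym_mul_mono !comul_mono /= (sp_map _ _ (tmul_l_linear _)) (sp_map _ _ (tmul_r_linear _ _)).
congr (_ + _); apply: sp_ext => u v _ _; rewrite ?tmul_l_pure ?tmul_r_pure !sym_mul_mono //.
by rewrite pparity_mono (lin_Z (tpure_linear_l _)).
Qed.

Definition htmul_l (s : nat -> Sym U) (T : nat -> tens (Sym U) (Sym U)) :=
  fun n => cs n (fun i j => tmul_l (s i) (T j)).
Definition htmul_r p (s : nat -> Sym U) (T : nat -> tens (Sym U) (Sym U)) :=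
  fun n => cs n (fun i j => tmul_r p (s i) (T j)).

Lemma htmul_l_linear s : linear (htmul_l s).
Proof. exact: (hconv_linear_r s tmul_l_linear). Qed.

Lemma htmul_r_linear p s : linear (htmul_r p s).
Proof. exact: (hconv_linear_r s (tmul_r_linear p)). Qed.

Lemma htmul_l_ten s t r :
  htmul_l s (hten t r) = hten (hmul (A := symA U) s t) r.
Proof.
apply: funext => n; rewrite /htmul_l /hten.
under cs_ext => i j _ do rewrite (cs_lin _ _ (tmul_l_linear _)).
under [RHS]cs_ext => i j _ do rewrite hmulE (cs_lin _ _ (tpure_linear_l _)).
rewrite csA; apply: cs_ext => i l _; apply: cs_ext => j m _.
exact: tmul_l_pure.
Qed.

Lemma htmul_r_ten p q s t r : hhom (V := symG U) q t ->
  htmul_r p s (hten t r) = ksgn k (p * q) *: hten t (hmul (A := symA U) s r).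
Proof.
move=> ht; apply: funext => n.
rewrite -[RHS]/(ksgn k (p * q) *: cs n (fun i j => tpure (t i) (hmul (A := symA U) s r j))).
rewrite csZ /htmul_r /hten.
under cs_ext => i j _ do rewrite (cs_lin _ _ (tmul_r_linear _ _)).
under [RHS]cs_ext => i j _ do rewrite hmulE (cs_lin _ _ (tpure_linear_r _)) csZ.
rewrite csCA; apply: cs_ext => i l _; apply: cs_ext => j m _.
rewrite tmul_r_pure (pparity_hom p (ht i)) (lin_Z (tpure_linear_l _)); congr (_ *: _).
by apply: (@ksgn_cong _ (- (p * i%:Z))); ring.
Qed.

Lemma hcomul_mul1 p (s : nat -> U) (T : nat -> Sym U) : hhom p s ->
  hcomul (hmul (A := symA U) (fun i => inj1 (s i)) T) =
  htmul_l (fun i => inj1 (s i)) (hcomul T) + htmul_r p (fun i => inj1 (s i)) (hcomul T).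
Proof.
move=> hs; apply: funext => n; rewrite /hcomul hmulE (cs_lin _ _ (@comul_linear k U)).
rewrite -[RHS]/(cs n (fun i j => tmul_l (inj1 (s i)) (comul (T j))) +
                cs n (fun i j => tmul_r p (inj1 (s i)) (comul (T j)))).
rewrite -csD; apply: cs_ext => i j _; rewrite /= (comul_mul1 _ (hs i)); congr (_ + _).
rewrite /tmul_r; congr tens_lift; apply: funext => x; apply: funext => y; congr tpure.
rewrite /pparity; congr sym_lift; apply: funext => w; congr (_ *: _).
by apply: (@ksgn_cong _ (- (i%:Z * wdeg w))); ring.
Qed.

End CoproductProduct.

Section CoalgebraExp.
Variables (k : fieldType) (U W : gvect k).
Hypothesis char0 : [pchar k] =i pred0.
Variable f : word U -> nat -> W.
Hypothesis hf : forall w, hhom (wdeg w) (f w).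

Let g : word U -> nat -> symA W := fun w i => inj1 (f w i).

Lemma wexp_inj1_hom w : hhom (wdeg w) (g w).
Proof. by move=> j; apply: inj1_sym_hom; apply: hf. Qed.

Let hg := wexp_inj1_hom.

(** The exponential of a map into the primitive elements is a coalgebra map. The term [x (x) 1] of
    the coproduct of the leading factor reproduces [wexp_cons] on the left side; the term [1 (x) x]
    does so on the right, after [sp_exchange]. *)
Lemma wexp_comul w :
  hcomul (wexp g w) = sp w (fun u v => hten (wexp g u : nat -> Sym W) (wexp g v)).
Proof.
have [N] := ubnP (size w); elim: N w => // N IH [_|a w /ltnSE wN].
  rewrite /= wexp_nil; apply: funext => n; rewrite hten1l /hcomul /hconst.
  case: eqP => _; last by rewrite (lin_0 (@comul_linear k W)) (lin_0 (tpure_linear_r _)).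
  exact: (comul_mono [::]).
rewrite (wexp_cons char0 hg) (sp_map _ _ (@hcomul_linear k W)) /=.
transitivity (sp w (fun u v => sp v (fun x y =>
    hten (hmul (g (a :: u)) (wexp g x) : nat -> Sym W) (wexp g y))) +
  sp w (fun u v => sp v (fun x y =>
    ksgn k (wdeg (a :: u) * wdeg x) *:
    hten (wexp g x : nat -> Sym W) (hmul (g (a :: u)) (wexp g y))))).
  rewrite -spD; apply: sp_ext => u v su _; rewrite (hcomul_mul1 _ (hf (a :: u))).
  rewrite IH; last by apply: leq_trans wN; rewrite /= ltnS -su leq_addl.
  congr (_ + _).
    rewrite (sp_map _ _ (htmul_l_linear _)); apply: sp_ext => x y _ _.
    exact: htmul_l_ten.
  rewrite (sp_map _ _ (htmul_r_linear _ _)); apply: sp_ext => x y _ _.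
  by apply: htmul_r_ten; apply: (wexp_hom hg).
congr (_ + _).
  rewrite -sp_coassoc; apply: sp_ext => x v _ _.
  rewrite (wexp_cons char0 hg) (sp_map _ _ (hten_linear_l _)).
  by apply: sp_ext.
rewrite sp_exchange; apply: sp_ext => x v _ _.
rewrite (wexp_cons char0 hg) (sp_map _ _ (hten_linear_r _)) -spZ.
apply: sp_ext => u y _ _; rewrite scalerA -ksgnD wdeg_cons; congr (_ *: _).
by apply: (@ksgn_cong _ (wdeg u * wdeg x)); ring.
Qed.

End CoalgebraExp.

Section Coderivations.
Variables (k : fieldType) (U : gvect k).
Implicit Types (w u v : word U).

Lemma tens_der_bil_l (D : Sym U -> Sym U) b : linear D ->
  linear (fun a => tpure (D a) b + tpure (parity a) (D b)).
Proof.
move=> lD c x y; rewrite lD parity_linear !tpure_linear_l.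
by rewrite scalerDr addrACA.
Qed.

Lemma tens_der_bil_r (D : Sym U -> Sym U) a : linear D ->
  linear (fun b => tpure (D a) b + tpure (parity a) (D b)).
Proof. by move=> lD c x y; rewrite lD !tpure_linear_r scalerDr addrACA. Qed.

Lemma tens_der_linear (D : Sym U -> Sym U) : linear D -> linear (tens_der D).
Proof.
by move=> lD; apply: tens_lift_linear => ?; [apply: tens_der_bil_l|apply: tens_der_bil_r].
Qed.

Lemma tens_der_pure (D : Sym U -> Sym U) a b : linear D ->
  tens_der D (tpure a b) = tpure (D a) b + tpure (parity a) (D b).
Proof.
move=> lD; rewrite /tens_der tens_lift_pure // => ?.
  exact: tens_der_bil_l.
exact: tens_der_bil_r.
Qed.

Lemma tens_der_comul (D : Sym U -> Sym U) w : linear D ->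
  tens_der D (comul (mono w)) = sp w (fun u v =>
    tpure (D (mono u)) (mono v) + tpure (parity (mono u)) (D (mono v))).
Proof.
move=> lD; rewrite /tens_der comul_lift // => ?.
  exact: tens_der_bil_l.
exact: tens_der_bil_r.
Qed.

(** The bracket of a splitting lands on one side of the coproduct of the remaining letters, which
    gives the two terms of the derivation rule. The degree [1 - 2 d] is that of the coefficient of
    hbar^d in a series of degree one; being odd, it gives the sign of [parity]. *)
Lemma coder_sum_coder (l : Sym U -> U) (d : nat) : linear l ->
  (forall p x, sym_hom p x -> ghom (p + 1 - 2 * d%:Z) (l x)) ->
  is_coderivation (coder_sum l).
Proof.
move=> ll hl; split; first exact: coder_sum_linear.
have lD := coder_sum_linear ll.
apply: (lin_ext (F := fun x => comul (coder_sum l x))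
                (G := fun x => tens_der (coder_sum l) (comul x))) => [||w].
- exact: (linear_comp (@comul_linear k U)).
- exact: (linear_comp (tens_der_linear lD) (@comul_linear k U)).
rewrite tens_der_comul //.
(* Extending [l] by zero from the nonempty words removes the condition on the sizes, so that the
   lemmas on [sp] apply. *)
pose h u := if (0 < size u)%N then l (mono u) else 0.
have hh u : ghom (wdeg u + 1 - 2 * d%:Z) (h u).
  by rewrite /h; case: ifP => _; [apply/hl/sym_hom_mono|apply: ghom0].
have DE w' : coder_sum l (mono w') = sp w' (fun u v => sym_mul (inj1 (h u)) (mono v)).
  rewrite coder_sum_mono //; apply: sp_ext => u v _ _; rewrite /h; case: ifP => // _.
  by rewrite (lin_0 (@inj1_linear k U)) sym_mul0l.
rewrite DE (sp_map _ _ (@comul_linear k U)).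
transitivity (sp w (fun u v => sp v (fun x y =>
    tpure (sym_mul (inj1 (h u)) (mono x)) (mono y))) +
  sp w (fun u v => sp v (fun x y =>
    ksgn k ((wdeg u + 1 - 2 * d%:Z) * wdeg x) *:
    tpure (mono x) (sym_mul (inj1 (h u)) (mono y))))).
  rewrite -spD; apply: sp_ext => u v _ _; rewrite (comul_mul1 _ (hh u)) comul_mono.
  rewrite (sp_map _ _ (tmul_l_linear _)) (sp_map _ _ (tmul_r_linear _ _)).
  congr (_ + _); apply: sp_ext => x y _ _; rewrite ?tmul_l_pure ?tmul_r_pure //.
  by rewrite pparity_mono (lin_Z (tpure_linear_l _)).
rewrite spD; congr (_ + _).
  rewrite -sp_coassoc; apply: sp_ext => x y _ _; rewrite DE.
  by rewrite (sp_map _ _ (tpure_linear_l _)).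
rewrite sp_exchange; apply: sp_ext => x v _ _.
rewrite DE (sp_map _ _ (tpure_linear_r _)); apply: sp_ext => u y _ _.
rewrite parity_mono (lin_Z (tpure_linear_l _)) scalerA -ksgnD; congr (_ *: _).
by apply: (@ksgn_cong _ (wdeg u * wdeg x - d%:Z * wdeg x)); ring.
Qed.

End Coderivations.

(** * Multiplication of power series by powers of hbar *)

Section HbarShift.
Variables (k : fieldType).
Implicit Types (V W : lmodType k).

Lemma hbarX0 V (s : nat -> V) : hbarX 0 s = s.
Proof. by apply: funext => j; rewrite /hbarX leq0n subn0. Qed.

Lemma hbarXD V m n (s : nat -> V) : hbarX m (hbarX n s) = hbarX (m + n) s.
Proof.
apply: funext => j; rewrite /hbarX -subnDA.
have [mj|mj] := leqP m j; first by rewrite leq_subRL.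
by rewrite leqNgt (leq_trans mj) ?leq_addr.
Qed.

Lemma hbarX_linear V n : linear (@hbarX k V n).
Proof.
move=> c s t; apply: funext => j; rewrite /hbarX.
rewrite -[RHS]/(c *: (if (n <= j)%N then s (j - n)%N else 0) + if (n <= j)%N then t (j - n)%N else 0).
by case: ifP => _; rewrite ?scaler0 ?addr0.
Qed.

Lemma hbarX_inj V n : injective (@hbarX k V n).
Proof.
move=> s t st; apply: funext => j; have := congr1 (fun s => s (n + j)%N) st.
by rewrite /hbarX leq_addr addKn.
Qed.

Lemma hbarX_low V n (s : nat -> V) : (forall j, (j < n)%N -> s j = 0) ->
  hbarX n (fun j => s (j + n)%N) = s.
Proof.
move=> s0; apply: funext => j; rewrite /hbarX; case: leqP => [nj|/s0 -> //].
by rewrite subnK.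
Qed.

Lemma cs_shift (W : nmodType) a n (T : nat -> nat -> W) :
  cs n (fun i j => if (a <= i)%N then T (i - a)%N j else 0) =
  if (a <= n)%N then cs (n - a) T else 0.
Proof.
elim: a n T => [|a IH] n T.
  by rewrite leq0n subn0; apply: cs_ext => i j _; rewrite subn0.
case: n => [|n]; first by rewrite /cs big_ord_recl big_ord0 addr0.
rewrite /cs big_ord_recl /= add0r ltnS subSS -IH /cs.
by apply: eq_bigr => i _; rewrite /= /bump leq0n add1n ltnS !subSS.
Qed.

Lemma hext_hbarX V W (F : V -> nat -> W) n s : linear F ->
  hext F (hbarX n s) = hbarX n (hext F s).
Proof.
move=> lF; apply: funext => j; rewrite -[LHS]/(cs j (fun i l => F (hbarX n s i) l)).
rewrite /hbarX -(cs_shift n j (fun i l => F (s i) l)); apply: cs_ext => i l _.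
by case: ifP => _ //; rewrite (lin_0 lF).
Qed.

Lemma hext_hbarX_out V W (F G : V -> nat -> W) n s :
  (forall i, F (s i) = hbarX n (G (s i))) -> hext F s = hbarX n (hext G s).
Proof.
move=> FG; apply: funext => j; rewrite -[LHS]/(cs j (fun i l => F (s i) l)) csC.
rewrite /hbarX -[hext G s _]/(cs (j - n) (fun i l => G (s i) l)) [cs (j - n) _]csC.
rewrite -(cs_shift n j (fun i l => G (s l) i)); apply: cs_ext => i l _.
by rewrite FG.
Qed.

Lemma hext_linear V W (F : V -> nat -> W) : linear F -> linear (hext F).
Proof.
move=> lF c s t; apply: funext => n.
rewrite -[RHS]/(c *: cs n (fun i j => F (s i) j) + cs n (fun i j => F (t i) j)).
rewrite -[LHS]/(cs n (fun i j => F (c *: s i + t i) j)) csZ -csD.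
by apply: cs_ext => i j _; rewrite lF.
Qed.

Lemma hext_hconst V W (F : V -> nat -> W) x : linear F -> hext F (hconst x) = F x.
Proof.
move=> lF; apply: funext => n; rewrite -[LHS]/(cs n (fun i j => F (hconst x i) j)).
rewrite cs_const // => i j; rewrite lt0n => /negbTE i0.
by rewrite /hconst i0 (lin_0 lF).
Qed.

Lemma hext_comp V V' W (F : V' -> nat -> W) (G : V -> nat -> V') s : linear F ->
  hext F (hext G s) = hext (fun x => hext F (G x)) s.
Proof.
move=> lF; apply: funext => n.
rewrite -[LHS]/(cs n (fun l j => F (cs l (fun a b => G (s a) b)) j)).
rewrite -[RHS]/(cs n (fun a l => cs l (fun b j => F (G (s a) b) j))).
rewrite -csA; apply: cs_ext => l j _.
by rewrite (cs_lin _ _ (g := fun x => F x j)) // => c x y; rewrite lF.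
Qed.

Lemma hext_ext V W (F G : V -> nat -> W) s : (forall i, F (s i) = G (s i)) -> hext F s = hext G s.
Proof. by move=> FG; apply: funext => n; apply: eq_bigr => i _; rewrite FG. Qed.

Lemma hext_of_hconst V W (G : V -> W) s : hext (fun x => hconst (G x)) s = fun n => G (s n).
Proof.
apply: funext => n; rewrite -[LHS]/(cs n (fun i j => hconst (G (s i)) j)) csC cs_const //.
by move=> i j; rewrite lt0n => /negbTE i0; rewrite /hconst i0.
Qed.

Lemma hbarX_hmull (A : gcalg k) n (s t : nat -> A) : hmul (hbarX n s) t = hbarX n (hmul s t).
Proof.
apply: funext => j; rewrite hmulE /hbarX -(cs_shift n j (fun i l => gmul (s i) (t l))).
by apply: cs_ext => i l _; case: ifP => _ //; rewrite (lin_0 (gmul_linear_l _)).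
Qed.

Lemma hbarX_hmulr (A : gcalg k) n (s t : nat -> A) : hmul s (hbarX n t) = hbarX n (hmul s t).
Proof.
apply: funext => j; rewrite hmulE csC /hbarX.
rewrite [hmul s t _]/hmul -[\sum_(i < _) _]/(cs _ (fun i j => gmul (s i) (t j))) [cs (j - n) _]csC.
rewrite -(cs_shift n j (fun i l => gmul (s l) (t i))).
by apply: cs_ext => i l _; case: ifP => _ //; rewrite (lin_0 (gmul_linear_r _)).
Qed.

Lemma hmul_hconst (A : gcalg k) (x y : A) : hmul (hconst x) (hconst y) = hconst (gmul x y).
Proof.
apply: funext => n; rewrite hmulE cs_const.
  by rewrite /hconst /=; case: eqP => // _; rewrite (lin_0 (gmul_linear_r _)).
by move=> i j; rewrite lt0n => /negbTE i0; rewrite /hconst i0 (lin_0 (gmul_linear_l _)).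
Qed.

Lemma hconst_linear V : linear (@hconst k V).
Proof.
move=> c x y; apply: funext => -[|j] //.
by rewrite -[RHS]/(c *: 0 + 0) scaler0 addr0.
Qed.

(** Multiplicativity passes from coefficients to series, both sides being the same fourfold Cauchy
    sum. The cases used are the product of the symmetric algebra and several maps on tensor
    squares. *)
Lemma hext_hconv (V1 V2 V3 W1 W2 W3 : lmodType k) (m : V1 -> V2 -> V3) (m' : W1 -> W2 -> W3)
    (h1 : V1 -> nat -> W1) (h2 : V2 -> nat -> W2) (h : V3 -> nat -> W3) s t :
  linear h -> (forall b, linear (m'^~ b)) -> (forall a, linear (m' a)) ->
  (forall i j, h (m (s i) (t j)) = hconv m' (h1 (s i)) (h2 (t j))) ->
  hext h (hconv m s t) = hconv m' (hext h1 s) (hext h2 t).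
Proof.
move=> lh lm1 lm2 hm; apply: funext => N.
transitivity (cs N (fun i l => cs l (fun j l' => cs l' (fun a b =>
    m' (h1 (s i) a) (h2 (t j) b))))).
  rewrite -[LHS]/(cs N (fun l l' => h (cs l (fun i j => m (s i) (t j))) l')).
  rewrite -(csA N (fun i j l' => cs l' (fun a b => m' (h1 (s i) a) (h2 (t j) b)))).
  apply: cs_ext => l l' _.
  rewrite (cs_lin _ _ (g := fun x => h x l')); last by move=> c x y; rewrite lh.
  by apply: cs_ext => i j _; rewrite hm.
rewrite -[RHS]/(cs N (fun p q => m' (cs p (fun i a => h1 (s i) a)) (cs q (fun i a => h2 (t i) a)))).
transitivity (cs N (fun p q => cs p (fun i a => cs q (fun j b =>
    m' (h1 (s i) a) (h2 (t j) b))))); last first.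
  apply: cs_ext => p q _; rewrite (cs_lin _ _ (lm1 _)).
  by apply: cs_ext => i a _; rewrite (cs_lin _ _ (lm2 _)).
rewrite (csA N (fun i a q => cs q (fun j b => m' (h1 (s i) a) (h2 (t j) b)))).
by apply: cs_ext => i l _; rewrite csCA.
Qed.

End HbarShift.

Section LetterMaps.
Variables (k : fieldType) (U U' : gvect k).

Variables (n : int) (f : U -> U').
Hypotheses (lf : linear f) (hf : forall p x, ghom p x -> ghom (p + (n + n)) (f x)).

(** The shift is written [n + n] to keep its evenness visible: Koszul signs, and with them [sp] and
    all that is built from it, are unchanged by relabelling the letters. *)
Definition lmap (a : letter U) : letter U' := to_letter (ldeg a + (n + n)) (f (lval a)).

Lemma ldeg_lmap a : ldeg (lmap a) = ldeg a + (n + n).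
Proof. exact: ldeg_to_letter. Qed.

Lemma lval_lmap a : lval (lmap a) = f (lval a).
Proof. by rewrite lval_to_letter //; apply/hf/lvalP. Qed.

Lemma wdeg_lmap w : wdeg (map lmap w) = wdeg w + (n + n) * (size w)%:Z.
Proof.
elim: w => [|a w IH]; first by rewrite /= !wdeg_nil mulr0 addr0.
by rewrite /= !wdeg_cons IH ldeg_lmap -add1n PoszD mulrDr mulr1; ring.
Qed.

Lemma sp_lmap (W : lmodType k) w (H : word U' -> word U' -> W) :
  sp (map lmap w) H = sp w (fun u v => H (map lmap u) (map lmap v)).
Proof.
elim: w H => [//|a w IH] H /=; rewrite !IH; congr (_ + _).
apply: sp_ext => u v _ _; rewrite wdeg_lmap ldeg_lmap; congr (_ *: _).
apply: (@ksgn_cong _ (ldeg a * n * (size u)%:Z + n * wdeg u + n * (n + n) * (size u)%:Z)).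
by ring.
Qed.

Lemma lmap_rel (W : lmodType k) (g : word U' -> W) :
  sym_rel g -> sym_rel (fun w => g (map lmap w)).
Proof.
move=> [H1 H2]; split=> [u v c a b d ea eb eab|u v a b]; rewrite !map_cat /=.
  by apply: H1; rewrite ?ldeg_lmap ?ea ?eb // !lval_lmap eab lf.
rewrite H2 !ldeg_lmap; congr (_ *: _).
by apply: (@ksgn_cong _ (ldeg a * n + n * ldeg b + n * (n + n))); ring.
Qed.

Lemma sym_map_linear m : m = n + n -> linear (sym_map m f).
Proof.
by move=> ->; apply: (sym_lift_linear (lmap_rel (@mono_rel k U'))).
Qed.

Lemma sym_map_mono m w : m = n + n -> sym_map m f (mono w) = mono (map lmap w).
Proof.
by move=> ->; apply: (sym_lift_mono w (lmap_rel (@mono_rel k U'))).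
Qed.

Lemma cpow_lmap (A : gcalg k) r (g : word U' -> nat -> A) w :
  cpow r g (map lmap w) = cpow r (fun w => g (map lmap w)) w.
Proof.
elim: r w => [|r IH] w /=; first by case: w.
by rewrite sp_lmap; apply: sp_ext => -[|a u] v _ _ //=; rewrite IH.
Qed.

Lemma wexp_lmap (A : gcalg k) (g : word U' -> nat -> A) w :
  wexp g (map lmap w) = wexp (fun w => g (map lmap w)) w.
Proof. by rewrite /wexp size_map; apply: eq_bigr => r _; rewrite cpow_lmap. Qed.

End LetterMaps.

(* The sum of the [S^i(U)], [i <= m]. *)
Inductive wle (k : fieldType) (U : gvect k) (m : nat) : Sym U -> Prop :=
| wle_nil : wle m 0
| wle_term c w x : (size w <= m)%N -> wle m x -> wle m (c *: mono w + x).

Section Filtration.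
Variables (k : fieldType) (U : gvect k).
Implicit Types (w u v : word U) (x y : Sym U).

Lemma wleD m x y : wle m x -> wle m y -> wle m (x + y).
Proof.
move=> hx hy; elim: hx => [|c w z wm _ IH]; first by rewrite add0r.
by rewrite -addrA; apply: wle_term.
Qed.

Lemma wleZ m c x : wle m x -> wle m (c *: x).
Proof.
elim=> [|d w z wm _ IH]; first by rewrite scaler0; apply: wle_nil.
by rewrite scalerDr scalerA; apply: wle_term.
Qed.

Lemma wle_mono m w : (size w <= m)%N -> wle m (mono w).
Proof.
by move=> wm; rewrite -[mono w]scale1r -[_ *: _]addr0; apply: wle_term => //; apply: wle_nil.
Qed.

Lemma wle_sum m (I : Type) (r : seq I) (P : pred I) (F : I -> Sym U) :
  (forall i, P i -> wle m (F i)) -> wle m (\sum_(i <- r | P i) F i).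
Proof. by move=> H; elim/big_ind: _ => //; [apply: wle_nil|apply: wleD]. Qed.

Lemma wle_leq m n x : (m <= n)%N -> wle m x -> wle n x.
Proof.
move=> mn; elim=> [|c w z wm _ IH]; first exact: wle_nil.
by apply: wle_term => //; apply: leq_trans mn.
Qed.

Lemma wle_mul m n x y : wle m x -> wle n y -> wle (m + n) (sym_mul x y).
Proof.
move=> hx hy; elim: hx => [|c u z um _ IH]; first by rewrite sym_mul0l; apply: wle_nil.
rewrite sym_mulDl; apply: wleD => //; apply: wleZ => {IH}.
elim: hy => [|d v t vn _ IH]; first by rewrite sym_mul0r; apply: wle_nil.
rewrite sym_mulDr sym_mul_mono; apply: wleD => //; apply: wleZ; apply: wle_mono.
by rewrite size_cat leq_add.
Qed.

Lemma wle_inj1 (x : U) : wle 1 (inj1 x).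
Proof. by rewrite /inj1; apply: wle_sum => p _; apply: wle_mono. Qed.

Lemma wle_sp (U' : gvect k) m (w : word U') (H : word U' -> word U' -> Sym U) :
  (forall u v : word U', (size u + size v = size w)%N -> wle m (H u v)) -> wle m (sp w H).
Proof.
elim: w H => [|a w IH] H E /=; first exact: E.
apply: wleD; apply: IH => u v s; first by apply: E; rewrite /= addSn s.
by apply: wleZ; apply: E; rewrite /= addnS s.
Qed.

Lemma wle_hmul m n (s t : nat -> Sym U) : (forall i, wle m (s i)) -> (forall i, wle n (t i)) ->
  forall i, wle (m + n) (hmul (A := symA U) s t i).
Proof. by move=> hs ht i; apply: wle_sum => j _; apply: wle_mul. Qed.

Lemma sp_coef (U' : gvect k) (W : lmodType k) (w : word U') (H : word U' -> word U' -> nat -> W) j :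
  sp w H j = sp w (fun u v : word U' => H u v j).
Proof. by rewrite (sp_map _ _ (g := fun s : nat -> W => s j)). Qed.

(** In a convolution power each factor has weight at most one and consumes at least one letter. *)
Lemma wle_wexp (U' : gvect k) (g : word U' -> nat -> symA U) (w : word U') :
  (forall (u : word U') i, wle 1 (g u i)) -> forall i, wle (size w) (wexp g w i).
Proof.
move=> hg i; rewrite /wexp fct_sumE; apply: wle_sum => r _; apply: wleZ.
have H s : forall (u : word U') j, wle (size u) (cpow s g u j).
  elim: s => [|s IH] u j /=.
    case: u => [|a u]; last exact: wle_nil.
    by rewrite /hconst; case: eqP => _; [apply: wle_mono|apply: wle_nil].
  rewrite sp_coef; apply: wle_sp => -[|a x] y <-; first exact: wle_nil.
  apply: (@wle_leq (1 + size y)); first by rewrite leq_add2r.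
  by apply: (wle_hmul (hg _)) => l; apply: IH.
exact: H.
Qed.

End Filtration.

(* [mexp th m] maps the monomial [w] to [hbar^(m - |w|)] times the product of the
   [th a], for [a] in [w]; it is only used on the sum of the [S^i], [i <= m]. *)
Section Multiplication.
Variables (k : fieldType) (U : gvect k) (A : gcalg k) (th : U -> A) (e : int).
Hypotheses (lth : linear th) (hth : forall p x, ghom p x -> ghom (p + (e + e)) (th x)).
Implicit Types (w u v : word U) (x y : Sym U).

Definition wprod w : A := foldr (fun a (z : A) => gmul (th (lval a)) z) (gone A) w.

Lemma wprod_cat u v : wprod (u ++ v) = gmul (wprod u) (wprod v).
Proof. by elim: u => [|a u IH] /=; rewrite ?gmul1 // IH gmulA. Qed.

Lemma wprod_rel : sym_rel wprod.
Proof.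
split=> [u v c a b d ea eb eab|u v a b]; rewrite !wprod_cat /=.
  by rewrite eab lth gmul_linl gmul_linr.
rewrite !gmulA -!(gmulA (wprod u)) (gmulC (hth (lvalP a)) (hth (lvalP b))).
rewrite (lin_Z (gmul_linear_l _)) (lin_Z (gmul_linear_r _)); congr (_ *: _).
by apply: (@ksgn_cong _ (ldeg a * e + e * ldeg b + e * (e + e))); ring.
Qed.

Lemma wprod_hom w : ghom (wdeg w + (e + e) * (size w)%:Z) (wprod w).
Proof.
elim: w => [|a w IH] /=; first by rewrite wdeg_nil mulr0 addr0; apply: gone_hom.
apply: (ghom_eq (gmul_hom (hth (lvalP a)) IH)).
by rewrite wdeg_cons -add1n PoszD; ring.
Qed.

Definition mexp (m : nat) : Sym U -> nat -> A :=
  sym_lift (fun w => hbarX (m - size w) (hconst (wprod w))).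

Lemma mexp_rel m : sym_rel (fun w => hbarX (m - size w) (hconst (wprod w))).
Proof.
apply: (rel_size (f := fun n w => hbarX (m - n) (hconst (wprod w)))) => n.
exact: (rel_lin (hbarX_linear _) (rel_lin (@hconst_linear k A) wprod_rel)).
Qed.

Lemma mexp_linear m : linear (mexp m).
Proof. exact: (sym_lift_linear (mexp_rel m)). Qed.

Lemma mexp_mono m w : mexp m (mono w) = hbarX (m - size w) (hconst (wprod w)).
Proof. exact: (sym_lift_mono w (mexp_rel m)). Qed.

(** The bound on [x] ensures that the truncated subtraction [m - size w] is a true one. *)
Lemma mexp_up m n x : wle m x -> mexp (n + m) x = hbarX n (mexp m x).
Proof.
elim=> [|c w z wm _ IH].
  by rewrite !(lin_0 (mexp_linear _)) (lin_0 (@hbarX_linear _ _ _)).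
rewrite !(mexp_linear _) (@hbarX_linear _ _ _) IH; congr (_ *: _ + _).
by rewrite !mexp_mono hbarXD addnBA.
Qed.

Lemma mexp_mul m n x y : wle m x -> wle n y ->
  mexp (m + n) (sym_mul x y) = hmul (mexp m x) (mexp n y).
Proof.
move=> hx hy; elim: hx => [|c u z um _ IH].
  by rewrite sym_mul0l !(lin_0 (mexp_linear _)) hmul0l.
rewrite sym_mulDl !(mexp_linear _) (@hmul_linear_l _ A) IH; congr (_ *: _ + _) => {IH}.
elim: hy => [|d v t vn _ IH].
  by rewrite sym_mul0r !(lin_0 (mexp_linear _)) hmul0r.
rewrite sym_mulDr !(mexp_linear _) (@hmul_linear_r _ A) IH; congr (_ *: _ + _).
rewrite sym_mul_mono !mexp_mono hbarX_hmull hbarX_hmulr hbarXD hmul_hconst wprod_cat.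
by rewrite size_cat subnDA addnBAC // addnBA // subnAC.
Qed.

Lemma mexp_inj1 m (x : U) : mexp m.+1 (inj1 x) = hbarX m (hconst (th x)).
Proof.
have [[s c] /= [_ hc ->]] := ghom_span x.
rewrite (lin_sum (@inj1_linear k U)) (lin_sum (mexp_linear _)) (lin_sum lth).
rewrite (lin_sum (@hconst_linear k A)) (lin_sum (@hbarX_linear _ _ _)).
apply: eq_bigr => p _; rewrite (inj1_hom (hc p)) mexp_mono /= gmulr1.
by rewrite subn1.
Qed.

Lemma hext_mexp_up m n (s : nat -> Sym U) : (forall i, wle m (s i)) ->
  hext (mexp (n + m)) s = hbarX n (hext (mexp m) s).
Proof. by move=> hs; apply: hext_hbarX_out => i; apply: mexp_up. Qed.

Lemma hext_mexp_mul m n (s t : nat -> Sym U) :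
  (forall i, wle m (s i)) -> (forall i, wle n (t i)) ->
  hext (mexp (m + n)) (hmul (A := symA U) s t) = hmul (hext (mexp m) s) (hext (mexp n) t).
Proof.
move=> hs ht; apply: (hext_hconv (mexp_linear _) (@gmul_linear_l k A) (@gmul_linear_r k A)).
by move=> i j; apply: mexp_mul.
Qed.

Lemma hext_mexp_inj1 m (s : nat -> U) :
  hext (mexp m.+1) (fun i => inj1 (s i)) = hbarX m (fun i => th (s i)).
Proof.
rewrite -[X in hbarX m X](hext_of_hconst th).
rewrite -[X in hext _ X](hext_of_hconst (@inj1 k U)) hext_comp; last exact: mexp_linear.
apply: (@hext_hbarX_out k U A _ (fun z => hconst (th z))) => i.
by rewrite hext_hconst ?mexp_inj1 //; apply: mexp_linear.
Qed.

End Multiplication.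

(* The exponential of [phi] is the exponential into the symmetric algebra followed
   by the multiplication. *)
Lemma wexp_mexp (k : fieldType) (char0 : [pchar k] =i pred0) (U1 U2 U : gvect k)
    (A : gcalg k) (th : U -> A) (e : int)
    (n : int) (t : U1 -> U2) (f : word U1 -> nat -> U) (phi : word U2 -> nat -> A) :
  linear th -> (forall p x, ghom p x -> ghom (p + (e + e)) (th x)) ->
  (forall w, hhom (wdeg w) (f w)) -> (forall w, hhom (wdeg w) (phi w)) ->
  (forall a w, phi (map (lmap n t) (a :: w)) = hbarX (size w) (fun i => th (f (a :: w) i))) ->
  forall w, wexp phi (map (lmap n t) w) =
    hext (mexp th (size w)) (wexp (fun w i => inj1 (f w i) : symA U) w).
Proof.
move=> lth hth hf hphi phiE w; have lM := mexp_linear lth hth.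
have hg := wexp_inj1_hom hf; have wg := @wle_inj1 k U.
have [N] := ubnP (size w); elim: N w => // N IH [_|a w /ltnSE wN].
  rewrite /= !wexp_nil hext_hconst // (mexp_mono lth hth) //= hbarX0.
  by [].
rewrite /= (wexp_cons char0 hphi) (wexp_cons char0 hg) sp_lmap.
rewrite (sp_map _ _ (hext_linear (lM _))); apply: sp_ext => u v su _.
(* The leading factor comes from [(size u).+1] letters but has weight one, so [mexp] gives it the
   power [size u] of hbar, by which [phi] and [th f] differ on [a :: u]. *)
have -> : (size w).+1 = ((size u).+1 + size v)%N by rewrite addSn su.
rewrite (hext_mexp_mul lth hth); last first.
- by apply: wle_wexp => *; apply: wle_inj1.
- by move=> i; apply: (@wle_leq _ _ 1) => //; apply: wle_inj1.
rewrite (hext_mexp_inj1 lth hth) -(phiE a u) IH //.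
by apply: leq_trans wN; rewrite /= ltnS -su leq_addl.
Qed.

(** * Derived brackets *)

Lemma sub_comb (k : fieldType) (V : lmodType k) (c s : k) (p q p' q' : V) :
  (c *: p + p') - s *: (c *: q + q') = c *: (p - s *: q) + (p' - s *: q').
Proof. by rewrite scalerDr opprD scalerBr !scalerA mulrC addrACA. Qed.

(** The scalar form of the graded symmetry of [[[T, a], b]] for graded commuting [a] and [b]: the
    vectors [P], [Q], [R], [S] stand for [T(b a x)], [a T(b x)], [b T(a x)] and [b a T(x)]. *)
Lemma commutator_exchange (k : fieldType) (V : lmodType k) (s sa sb : k) (P Q R S : V) :
  s * s = 1 ->
  (s *: P - sa *: Q) - (sb * s) *: (R - sa *: S) =
  s *: ((P - sb *: R) - (sa * s) *: (Q - sb *: (s *: S))).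
Proof.
move=> ss; rewrite !scalerBr !scalerA.
have -> : s * (sa * s) = sa by rewrite mulrCA ss mulr1.
rewrite !opprD !opprK addrACA; congr (_ + _ + (_ + _)).
  by rewrite [sb * s]mulrC.
by rewrite [sb * s * sa]mulrC.
Qed.

Section Commutators.
Variables (k : fieldType) (A : gcalg k).
Implicit Types (T : A -> A) (w u v : word A).

Lemma ncomm_linear d T w : linear T -> linear (ncomm d T w).
Proof.
elim: w d T => [//|a w IH] d T lT /=; apply: IH => c x y.
by rewrite gmul_linr !lT gmul_linr sub_comb.
Qed.

Lemma ncomm_linT d c T T' w x :
  ncomm d (fun z => c *: T z + T' z) w x = c *: ncomm d T w x + ncomm d T' w x.
Proof.
elim: w d T T' => [//|a w IH] d T T' /=; rewrite -IH; congr (ncomm _ _ w x).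
by apply: funext => z; rewrite gmul_linr sub_comb.
Qed.

Lemma ncommZ d c T w x : ncomm d (fun z => c *: T z) w x = c *: ncomm d T w x.
Proof.
rewrite -[RHS]addr0 -(ncomm0 d w x) -ncomm_linT; congr (ncomm _ _ w x).
by apply: funext => z; rewrite addr0.
Qed.

(** The commutators with the letters of [u] are absorbed into the operator, which reduces both
    relations to an empty prefix. *)
Lemma ncomm_rel d T x : linear T -> sym_rel (fun w => ncomm d T w x).
Proof.
move=> lT; split=> [u v c a b d' ea eb eab|u v a b]; rewrite !ncomm_cat;
  have lu := @ncomm_linear d T u lT; move: (ncomm d T u) lu => {lT}T lT;
  move: (d + wdeg u) => {}d /=.
  rewrite ea eb -ncomm_linT; congr (ncomm _ _ v x); apply: funext => z.
  by rewrite eab !gmul_linl lT sub_comb.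
rewrite addrAC -ncommZ; congr (ncomm _ _ v x); apply: funext => z.
set s := ksgn k (ldeg a * ldeg b).
have ab y : gmul (lval a) (gmul (lval b) y) = s *: gmul (lval b) (gmul (lval a) y).
  by rewrite !gmulA (gmulC (lvalP a) (lvalP b)) (lin_Z (gmul_linear_l _)).
have ss : s * s = 1 by apply: ksgn_sq.
rewrite !mulrDl !ksgnD -/s [ldeg b * ldeg a]mulrC -/s ab (lin_Z lT).
rewrite !(lin_B (gmul_linear_r _)) !(lin_Z (gmul_linear_r _)) ab.
exact: commutator_exchange.
Qed.

Lemma ncomm_hom d p T w x : (forall q y, ghom q y -> ghom (q + d) (T y)) ->
  ghom p x -> ghom (p + d + wdeg w) (ncomm d T w x).
Proof.
elim: w d T => [|a w IH] d T hT hx /=; first by rewrite wdeg_nil addr0; apply: hT.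
apply: (@ghom_eq _ A (p + (d + ldeg a) + wdeg w)); last by rewrite wdeg_cons; ring.
apply: IH => // q y hy.
rewrite -scaleNr [X in ghom _ X]addrC; apply: ghom_lin.
  by apply: (ghom_eq (gmul_hom (lvalP a) (hT _ _ hy))); ring.
by apply: (ghom_eq (hT _ _ (gmul_hom (lvalP a) hy))); ring.
Qed.

(** Since [T a = [T, a]] plus or minus [a T], each letter either enters the commutator or moves out
    to the left. The letters that enter form [u], the others [v], and the sign is that of moving [v]
    past [T] and [u]. *)
Lemma ncomm_prod d T w x : linear T ->
  T (gmul (wprod (fun y : A => y) w) x) = sp w (fun u v =>
    ksgn k ((d + wdeg u) * wdeg v) *:
    gmul (wprod (fun y : A => y) v) (ncomm d T u x)).
Proof.
elim: w d T => [|a w IH] d T lT; first by rewrite /= !gmul1 wdeg_nil mulr0 scale1r.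
have -> : gmul (wprod (fun y : A => y) (a :: w)) x =
    gmul (lval a) (gmul (wprod (fun y : A => y) w) x) by rewrite gmulA.
rewrite [sp _ _]/=; set y := gmul (wprod _ w) x.
have -> : T (gmul (lval a) y) =
   ncomm d T [:: a] y + ksgn k (d * ldeg a) *: gmul (lval a) (T y) by rewrite /= subrK.
congr (_ + _).
  rewrite (IH (d + ldeg a) (ncomm d T [:: a])); last exact: (@ncomm_linear d T [:: a] lT).
  by apply: sp_ext => u v _ _; rewrite wdeg_cons addrA.
rewrite (IH d) // (sp_map _ _ (gmul_linear_r _)) -spZ; apply: sp_ext => u v _ _.
rewrite (lin_Z (gmul_linear_r _)) gmulA !scalerA -!ksgnD wdeg_cons; congr (_ *: _).
by apply: (@ksgn_cong _ (- (ldeg a * wdeg u))); ring.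
Qed.

End Commutators.

Section DerivedBrackets.
Variables (k : fieldType) (A : gcalg k) (B : bvinf A).
Implicit Types (w u v : word (shift A 2)).

Lemma bv_linear : linear B.
Proof. by apply/hlinearP => j; case: (bv_order B j). Qed.

Lemma derived_rel j : sym_rel (fun w : word A => derived B w j).
Proof. by apply: ncomm_rel; case: (bv_order B j). Qed.

Lemma derived_hom (w : word A) j : ghom (wdeg w + 1 - 2 * j%:Z) (derived B w j).
Proof.
apply: (@ghom_eq _ A (0 + (1 - 2 * j%:Z) + wdeg w)); last by ring.
apply: ncomm_hom => [q y hy|]; last exact: gone_hom.
by apply: (ghom_eq (bv_deg B j hy)); ring.
Qed.

Lemma derived_nil j : derived B [::] j = 0.
Proof. by rewrite /derived /= bv_one. Qed.

Lemma hbracket_word_rel j : sym_rel (fun w : word A =>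
  if w is [::] then 0 else derived B w (j + (size w).-1)%N).
Proof.
apply: rel_nil; apply: (rel_size (f := fun n (x : word A) => derived B x (j + n.-1))) => n.
exact: derived_rel.
Qed.

Lemma hbracket_linear j : linear (hbracket B ^~ j).
Proof. exact: (sym_lift_linear (hbracket_word_rel j)). Qed.

Lemma hbracket_mono j (w : word A) : hbracket B (mono w) j =
  if w is [::] then 0 else derived B w (j + (size w).-1)%N.
Proof. exact: (sym_lift_mono w (hbracket_word_rel j)). Qed.

Definition ulet : letter (shift A 2) -> letter A := @lmap k (shift A 2) A 1 (fun x => x).

Lemma unshift2_hom p (x : shift A 2) : ghom p x -> @ghom k A (p + (1 + 1)) x.
Proof. by move=> hx; apply: (ghom_eq (hx : @ghom k A (2 + p) x)); rewrite addrC. Qed.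

Lemma unshift2_linear : linear (@unshift2 k A).
Proof. by apply: (@sym_map_linear _ _ _ 1) => //; apply: unshift2_hom. Qed.

Lemma unshift2_mono w : unshift2 (mono w) = mono (map ulet w).
Proof. by apply: (@sym_map_mono _ _ _ 1) => //; apply: unshift2_hom. Qed.

Definition bv_l (j : nat) (y : Sym (shift A 2)) : shift A 2 := hbracket B (unshift2 y) j.

Lemma bv_l_linear j : linear (bv_l j).
Proof. exact: (linear_comp (hbracket_linear j) unshift2_linear). Qed.

Lemma bv_l_hom j p x : sym_hom p x -> ghom (p + 1 - 2 * j%:Z) (bv_l j x).
Proof.
move=> [n [c [w [hw ->]]]]; rewrite (lin_sum_scale (bv_l_linear j)).
apply: ghom_sum => i _; apply: ghomZ; rewrite /bv_l unshift2_mono hbracket_mono.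
have := wdeg_lmap 1 (fun x : shift A 2 => x : A) (w i); rewrite -/ulet hw.
case: (w i) => [|a u] /=; first by move=> _; apply: ghom0.
move=> hd; suff : @ghom k A (2 + (p + 1 - 2 * j%:Z))
  (derived B (ulet a :: map ulet u) (j + size (map ulet u))%N) by [].
apply: (ghom_eq (derived_hom (ulet a :: map ulet u) _)).
by rewrite hd size_map PoszD -[(size u).+1]add1n PoszD; ring.
Qed.

Lemma bv_codiff_linear : linear (bv_codiff B).
Proof. by apply/hlinearP => j; apply: coder_sum_linear; apply: bv_l_linear. Qed.

Lemma bv_codiff_coder j : is_coderivation (bv_codiff B ^~ j).
Proof. by apply: (@coder_sum_coder _ _ _ j); [apply: bv_l_linear|apply: bv_l_hom]. Qed.

Lemma bv_codiff_mono w : bv_codiff B (mono w) = sp w (fun u v =>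
  if (0 < size u)%N then hmul (A := symA (shift A 2)) (fun j => inj1 (bv_l j (mono u))) (hconst (mono v)) else 0).
Proof.
apply: funext => j; rewrite sp_coef [LHS](coder_sum_mono _ (bv_l_linear j)).
apply: sp_ext => u v _ _; case: ifP => // _; rewrite hmulE csC cs_const //.
by move=> i l; rewrite lt0n => /negbTE i0; rewrite /hconst i0 (lin_0 (gmul_linear_r _)).
Qed.

Lemma wle_bv_codiff m x : wle m x -> forall j, wle m (bv_codiff B x j).
Proof.
move=> hx j; elim: hx => [|c w y wm _ IH].
  by rewrite (lin_0 bv_codiff_linear); apply: wle_nil.
rewrite bv_codiff_linear; apply: wleD => //; apply: wleZ.
rewrite [bv_codiff _ _ _](coder_sum_mono _ (bv_l_linear j)); apply: wle_sp => u v su.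
case: ifP => [u0|_]; last exact: wle_nil.
apply: (@wle_leq _ _ (1 + size v)).
  by apply: leq_trans wm; rewrite -su leq_add2r.
by apply: wle_mul; [apply: wle_inj1|apply: wle_mono].
Qed.

Lemma idA_linear : linear (fun x : shift A 2 => x : A).
Proof. by []. Qed.

Definition vmexp (m : nat) : Sym (shift A 2) -> nat -> A :=
  @mexp k (shift A 2) A (fun x => x) m.

Lemma vmexp_linear m : linear (vmexp m).
Proof. exact: (mexp_linear idA_linear unshift2_hom). Qed.

Lemma wprod_ulet w : wprod (fun x : shift A 2 => x : A) w = wprod (fun x : A => x) (map ulet w).
Proof. by elim: w => [//|a w /= ->]; rewrite lval_lmap //; apply: unshift2_hom. Qed.

Lemma bv_prod w : B (wprod (fun x : shift A 2 => x : A) w) = sp w (fun u v =>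
  hmul (derived B (map ulet u)) (hconst (wprod (fun x : shift A 2 => x : A) v))).
Proof.
apply: funext => j; rewrite wprod_ulet -[X in B X j]gmulr1.
rewrite (@ncomm_prod k A (1 - 2 * j%:Z) (B^~ j)); last by case: (bv_order B j).
rewrite sp_lmap sp_coef.
apply: sp_ext => u v _ _; rewrite hmulE csC cs_const; last first.
  by move=> i l; rewrite lt0n => /negbTE i0; rewrite /hconst i0 (lin_0 (gmul_linear_r _)).
rewrite /hconst /= wprod_ulet -/(derived B (map ulet u) j).
rewrite (gmulC (derived_hom (map ulet u) j) (wprod_hom (e := 0) _ (map ulet v))); last first.
  by move=> p x; rewrite !addr0.
rewrite add0r mul0r addr0; congr (ksgn k _ *: _).
by rewrite addrC addrA.
Qed.

(** This is where the power of hbar in the brackets comes from: replacing the letters of a subword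
    of length n by their bracket lowers the weight by n - 1, for which [vmexp m] compensates by
    hbar^(n-1), exactly the divisor in [L_n]. *)
Lemma vmexp_codiff m x : wle m x ->
  hext (vmexp m) (bv_codiff B x) = hext B (vmexp m x).
Proof.
elim=> [|c w y wm _ IH].
  by rewrite (lin_0 bv_codiff_linear) (lin_0 (vmexp_linear m)) !lin_0 //;
     apply: hext_linear; [apply: bv_linear|apply: vmexp_linear].
rewrite bv_codiff_linear vmexp_linear (hext_linear (vmexp_linear m)) (hext_linear bv_linear) IH.
congr (_ *: _ + _) => {IH}.
rewrite {2}/vmexp (mexp_mono idA_linear unshift2_hom) (hext_hbarX _ _ bv_linear).
rewrite (hext_hconst _ bv_linear) bv_prod bv_codiff_mono.
rewrite (sp_map _ _ (hext_linear (vmexp_linear m))) (sp_map _ _ (@hbarX_linear k A _)).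
apply: sp_ext => -[|a u] v su _.
  rewrite /= (lin_0 (hext_linear (vmexp_linear m))).
  have -> : derived B [::] = 0 by apply: funext => j; rewrite derived_nil.
  by rewrite hmul0l (lin_0 (@hbarX_linear _ _ _)).
rewrite [(0 < _)%N]/=.
(* The bracket of [a :: u] receives the slack [m - size w] and the lost weight [size u]; the factor
   [v] has its exact weight and receives no power of hbar. *)
have em : m = ((m - size w + size u).+1 + size v)%N.
  by rewrite -[LHS](subnK wm) -[X in (_ + X)%N]su /= !addSn addnS addnA.
rewrite {1}em /vmexp (hext_mexp_mul idA_linear unshift2_hom); last first.
- move=> i; rewrite /hconst; case: eqP => _; last exact: wle_nil.
  exact: wle_mono.
- by move=> i; apply: (@wle_leq _ _ 1) => //; apply: wle_inj1.
rewrite (hext_mexp_inj1 idA_linear unshift2_hom) (hext_hconst _ (vmexp_linear _)) /vmexp.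
rewrite (mexp_mono idA_linear unshift2_hom) subnn hbarX0 -hbarXD hbarX_hmull.
congr (hbarX _ (hmul _ _)).
(* The division by hbar in the bracket is undone; it is exact by [derived_div]. *)
rewrite -[RHS](@hbarX_low k A (size u)) => [|j ju]; last first.
  by apply: derived_div; rewrite size_map.
congr (hbarX _ _); apply: funext => j; rewrite /bv_l unshift2_mono hbracket_mono /=.
by rewrite size_map.
Qed.

End DerivedBrackets.

(** * Morphisms of coalgebras over power series *)

Section LogSurjective.
Variables (k : fieldType) (U : gvect k) (A : gcalg k).
Hypothesis char0 : [pchar k] =i pred0.
Implicit Types (w u v : word U) (f : word U -> nat -> A).

Definition wlog f w : nat -> A :=
  \sum_(1 <= r < (size w).+1) ((-1) ^+ r.-1 / r%:R) *: cpow r f w.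

Lemma cpow_wexp_r f r w : f [::] = hconst (gone A) ->
  sp w (fun u v => hmul (cpow r f u) (f v)) = cpow r f w + cpow r.+1 f w.
Proof.
move=> f1; elim: r w => [|r IH] w.
  rewrite [X in _ = _ + X]/=.
  transitivity (sp w (fun u v => if u is [::] then f v else 0)).
    by apply: sp_ext => -[|a u] v _ _ /=; rewrite ?hmul1l ?hmul0l.
  rewrite sp_left0 -[LHS](hmul1r) -(sp_right0 w (fun u v => hmul (f u) (hconst (gone A)))).
  case: w => [|a w]; first by rewrite /= f1 hmul1l addr0.
  rewrite /= add0r; congr (_ + _).
    by apply: sp_ext => u [|b v] _ _ /=; rewrite ?hmul0r.
  by apply: sp_ext => -[|b u] v _ _; rewrite /= ?scaler0 // hmul0r scaler0.
pose g u := if u is [::] then 0 else f u.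
have E s x : cpow s.+1 f x = sp x (fun u v => hmul (g u) (cpow s f v)).
  by apply: sp_ext => -[|a u] v _ _; rewrite ?hmul0l.
rewrite !E -spD.
under sp_ext => u v _ _ do rewrite E (sp_map _ _ (hmul_linear_l _)).
rewrite (sp_coassoc w (fun x y v => hmul (hmul (g x) (cpow r f y)) (f v))).
apply: sp_ext => x z _ _; rewrite -(lin_D (hmul_linear_r _)) -IH (sp_map _ _ (hmul_linear_r _)).
by apply: sp_ext => u v _ _; rewrite hmulA.
Qed.

(** Here [f = 1 + P] with [P] supported on nonempty words, and [cpow r f] is [P^r]. The product of
    [1 - P + P^2 - ...] with [f] telescopes, as [P^N] vanishes on words shorter than [N]. *)
Lemma cpow_alternating f N w : f [::] = hconst (gone A) -> (size w < N)%N ->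
  \sum_(r < N) (-1) ^+ r *: sp w (fun u v => hmul (cpow r f u) (f v)) = cpow 0 f w.
Proof.
move=> f1 wN; under eq_bigr => r _ do rewrite cpow_wexp_r //.
have tel n : \sum_(r < n) (-1) ^+ r *: (cpow r f w + cpow r.+1 f w)
    = cpow 0 f w - (-1) ^+ n *: cpow n f w.
  elim: n => [|n IH]; first by rewrite big_ord0 scale1r subrr.
  rewrite big_ord_recr /= IH -/(cpow n.+1 f w) scalerDr addrA subrK.
  by rewrite exprS mulN1r scaleNr opprK.
by rewrite tel (cpow_size (r := N)) ?scaler0 ?subr0.
Qed.

(** The power rule cancels the denominators of the logarithm and leaves the logarithmic derivative,
    f' times the inverse of [f]. *)
Lemma wlog_cons f a w : (forall w, hhom (wdeg w) (f w)) ->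
  wlog f (a :: w) =
  sp w (fun u v => hmul (f (a :: u)) (\sum_(r < (size w).+1) (-1) ^+ r *: cpow r f v)).
Proof.
move=> hf; rewrite /wlog big_add1 -[(size (a :: w)).+1.-1]/(size w).+1 big_mkord.
transitivity (\sum_(r < (size w).+1) sp w (fun u v => hmul (f (a :: u)) ((-1) ^+ r *: cpow r f v))).
  apply: eq_bigr => r _; rewrite (cpow_cons hf) scalerA mulfVK ?(natk_neq0 char0) // -spZ.
  by apply: sp_ext => u v _ _; rewrite hmulZr.
by rewrite -sp_sum; apply: sp_ext => u v _ _; rewrite -(lin_sum (hmul_linear_r _)).
Qed.

Lemma wlog_hom f : (forall w, hhom (wdeg w) (f w)) -> forall w, hhom (wdeg w) (wlog f w).
Proof. by move=> hf w; apply: hhom_sum => r _; apply: hhomZ; apply: cpow_hom. Qed.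

Lemma wexp_unique f (Phi : word U -> nat -> A) : (forall w, hhom (wdeg w) (f w)) ->
  Phi [::] = hconst (gone A) ->
  (forall a w, Phi (a :: w) = sp w (fun u v => hmul (f (a :: u)) (Phi v))) ->
  forall w, wexp f w = Phi w.
Proof.
move=> hf P1 PE w; have [N] := ubnP (size w); elim: N w => // N IH [_|a w /ltnSE wN].
  by rewrite wexp_nil.
rewrite (wexp_cons char0 hf) PE; apply: sp_ext => u v su _; rewrite IH //.
by apply: leq_trans wN; rewrite /= ltnS -su leq_addl.
Qed.

(** The derivative of [wlog f] is f' times the inverse of [f]; multiplied by [f] it gives back f',
    so [f] satisfies the recursion that characterizes the exponential of [wlog f]. *)
Lemma wexp_wlog f : (forall w, hhom (wdeg w) (f w)) -> f [::] = hconst (gone A) ->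
  forall w, wexp (wlog f) w = f w.
Proof.
move=> hf f1; apply: wexp_unique => // [|a w]; first exact: wlog_hom.
transitivity (sp w (fun u v => if v is [::] then f (a :: u) else 0)).
  by rewrite (sp_right0 w (fun u v => f (a :: u))).
transitivity (sp w (fun x z => hmul (f (a :: x)) (cpow 0 f z))).
  by apply: sp_ext => x [|b z] _ _ /=; rewrite ?hmul1r ?hmul0r.
transitivity (sp w (fun x z => sp z (fun y v => hmul (f (a :: x))
     (hmul (\sum_(r < (size w).+1) (-1) ^+ r *: cpow r f y) (f v))))).
  apply: sp_ext => x z sz _; rewrite -(@cpow_alternating f (size w).+1) //; last first.
    by rewrite ltnS -sz leq_addl.
  rewrite -(sp_map _ _ (hmul_linear_r _)); congr hmul.
  under eq_bigr => r _ do rewrite -spZ.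
  rewrite -sp_sum; apply: sp_ext => y v _ _.
  by rewrite (lin_sum (hmul_linear_l _)); apply: eq_bigr => r _; rewrite hmulZl.
rewrite -(sp_coassoc w (fun x y v => hmul (f (a :: x))
     (hmul (\sum_(r < (size w).+1) (-1) ^+ r *: cpow r f y) (f v)))).
apply: sp_ext => u v su _; rewrite (wlog_cons _ _ hf) (sp_map _ _ (hmul_linear_l _)).
apply: sp_ext => x y sxy _; rewrite hmulA; congr (hmul (hmul _ _) _).
(* The geometric series is cut at [size w] on one side and at [size u] on the other; the extra
   powers vanish on [y], which is no longer than [u]. *)
rewrite -!(big_mkord predT (fun r => (-1) ^+ r *: cpow r f y)).
rewrite (big_cat_nat (n := (size u).+1)) //=; last by rewrite ltnS -su leq_addr.
rewrite [X in _ + X]big_nat_cond [X in _ + X]big1 ?addr0 // => r /andP[/andP[ur _] _].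
by rewrite cpow_size ?scaler0 // (leq_trans _ ur) // ltnS -sxy leq_addl.
Qed.

End LogSurjective.

(** * Cofreeness of the symmetric coalgebra over power series *)

Section SeriesCoalgebra.
Variables (k : fieldType).
Hypothesis char0 : [pchar k] =i pred0.

Lemma pr_cogen_hom (U : gvect k) p (x : Sym U) : sym_hom p x -> ghom p (pr_cogen x).
Proof.
move=> [n [c [w [hw ->]]]]; rewrite (lin_sum_scale (@pr_cogen_linear k U)).
apply: ghom_sum => i _; apply: ghomZ; rewrite pr_cogen_mono -(hw i).
case: (w i) => [|a [|b v]]; rewrite ?wdeg_cons ?wdeg_nil ?addr0; try exact: ghom0.
exact: lvalP.
Qed.

Lemma pr_cogen_mul1 (U : gvect k) (x : U) (y : Sym U) :
  pr_cogen (sym_mul (inj1 x) y) = counit y *: x.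
Proof.
have [[s c] /= [_ hc ->]] := ghom_span x.
rewrite (lin_sum (@inj1_linear k U)) (lin_sum (@sym_mul_linear_l k U y)).
rewrite (lin_sum (@pr_cogen_linear k U)) scaler_sumr; apply: eq_bigr => p _.
rewrite (inj1_hom (hc p)); apply: (lin_ext (F := fun y => pr_cogen (sym_mul (mono [:: _]) y))
  (G := fun y => counit y *: c p)) => [||w].
- exact: (linear_comp (@pr_cogen_linear k U) (@sym_mul_linear_r k U _)).
- by move=> d z z'; rewrite (counit_linear d z z') scalerDl -scalerA.
rewrite sym_mul_mono pr_cogen_mono counit_mono; case: w => [|b w] /=.
  by rewrite scale1r.
by rewrite scale0r.
Qed.

Lemma counit_mul1 (U : gvect k) (x : U) (y : Sym U) : counit (sym_mul (inj1 x) y) = 0.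
Proof.
have [[s c] /= [_ hc ->]] := ghom_span x.
rewrite (lin_sum (@inj1_linear k U)) (lin_sum (@sym_mul_linear_l k U y)).
rewrite (lin_sum (@counit_linear k U)) big1 // => p _.
rewrite (inj1_hom (hc p)); apply: (lin_ext (W := k^o)
  (F := fun y => counit (sym_mul (mono [:: _]) y))
  (G := fun y => 0)) => [||w].
- exact: (linear_comp (@counit_linear k U) (@sym_mul_linear_r k U _)).
- by move=> d z z'; rewrite scaler0 addr0.
by rewrite sym_mul_mono counit_mono.
Qed.

Section CogenExp.
Variables (U W : gvect k) (f : word U -> nat -> W).
Hypotheses (hf : forall w, hhom (wdeg w) (f w)) (f0 : f [::] = 0).
Let g : word U -> nat -> symA W := fun w i => inj1 (f w i).
Let hg := wexp_inj1_hom hf.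

Lemma counit_wexp w n : counit (wexp g w n) = if (w, n) is ([::], 0%N) then 1 else 0.
Proof.
case: w => [|a w].
  rewrite wexp_nil; case: n => [|n]; first exact: (counit_mono [::]).
  exact: (lin_0 (@counit_linear k W)).
rewrite (wexp_cons char0 hg) sp_coef (sp_map _ _ (@counit_linear k W)).
apply: (@sp_eq0 k U k^o) => u v _ _; rewrite hmulE (cs_lin _ _ (@counit_linear k W)).
by apply: (@cs_eq0 k^o) => i j _; apply: counit_mul1.
Qed.

Lemma pr_cogen_wexp w n : pr_cogen (wexp g w n) = f w n.
Proof.
case: w => [|a w].
  rewrite wexp_nil f0; case: n => [|n]; first exact: (pr_cogen_mono [::]).
  exact: (lin_0 (@pr_cogen_linear k W)).
rewrite (wexp_cons char0 hg) sp_coef (sp_map _ _ (@pr_cogen_linear k W)).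
rewrite -[RHS](sp_right0 w (fun u v => f (a :: u) n)); apply: sp_ext => u v _ _.
rewrite hmulE (cs_lin _ _ (@pr_cogen_linear k W)).
under cs_ext => i j _ do rewrite pr_cogen_mul1 counit_wexp.
case: v => [|b v]; last by apply: cs_eq0 => i j _; rewrite scale0r.
rewrite csC cs_const ?scale1r // => -[|i] j // _.
by rewrite scale0r.
Qed.

End CogenExp.

Definition coalg_mor (U W : gvect k) (F : Sym U -> nat -> Sym W) : Prop :=
  [/\ linear F, forall w, hhom (V := symG W) (wdeg w) (F (mono w)),
      forall w, hcomul (F (mono w)) = sp w (fun u v => hten (F (mono u)) (F (mono v))) &
      F (sym_one U) = hconst (sym_one W)].

(** Uniqueness in the cofreeness of the symmetric coalgebra: the exponential on the right is a
    coalgebra map with the same projection as [F], and a primitive difference with zero projection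
    is zero. *)
Lemma coalg_mor_wexp (U W : gvect k) (F : Sym U -> nat -> Sym W) : coalg_mor F ->
  forall w, F (mono w) = wexp (fun u i => inj1 (pr_cogen (F (mono u) i)) : symA W) w.
Proof.
move=> [lF hF FC F1] w; pose f u i := pr_cogen (F (mono u) i).
have hf u : hhom (wdeg u) (f u) by move=> i; apply: pr_cogen_hom; apply: hF.
have f0 : f [::] = 0.
  apply: funext => i; rewrite /f -/(sym_one U) F1 /hconst.
  by case: eqP => _; [apply: (pr_cogen_mono [::])|apply: (lin_0 (@pr_cogen_linear k W))].
pose X u : nat -> Sym W := wexp (fun u i => inj1 (f u i) : symA W) u.
apply/eqP; rewrite -subr_eq0 -/(X w); apply/eqP.
apply: (coalg_unique char0 (G := fun u => F (mono u) - X u)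
   (P := fun u => F (mono u)) (Q := X)) => [||u|u Hu].
- exact: F1.
- exact: (@wexp_nil k U (symA W)).
- rewrite (lin_B (@hcomul_linear k W)) FC (wexp_comul char0 hf) -/X.
  (* With X the exponential, F (x) F - X (x) X = (F - X) (x) F + X (x) (F - X). *)
  rewrite -[RHS](_ : sp u (fun x y => hten (F (mono x)) (F (mono y)) +
    (-1) *: hten (X x) (X y)) = _).
    by rewrite spD spZ scaleN1r.
  apply: sp_ext => x y _ _; rewrite (lin_B (hten_linear_l _)) (lin_B (hten_linear_r _)).
  by rewrite scaleN1r addrA subrK.
apply: funext => n; rewrite Hu -[(F (mono u) - X u) n]/(F (mono u) n - X u n).
rewrite (lin_B (@pr_cogen_linear k W)) /X (pr_cogen_wexp hf f0) subrr.
exact: (lin_0 (@inj1_linear k W)).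
Qed.

End SeriesCoalgebra.

(** * Criterion for a coalgebra map to commute with the codifferentials *)

Section Criterion.
Variables (k : fieldType).
Hypothesis char0 : [pchar k] =i pred0.

Lemma tens_lin_ext (A B W : lmodType k) (f g : tens A B -> W) : linear f -> linear g ->
  (forall a b, f (tpure a b) = g (tpure a b)) -> forall x, f x = g x.
Proof.
move=> lf lg E; apply: pres_ind => [|c [a b] x IH]; first by rewrite (lin_0 lf) (lin_0 lg).
by rewrite lf lg IH -[pres_gen _ _]/(tpure a b) E.
Qed.

Lemma hext_add (V W : lmodType k) (F G : V -> nat -> W) s :
  hext (fun x => F x + G x) s = hext F s + hext G s.
Proof.
apply: funext => n.
exact: (csD n (fun i j => F (s i) j) (fun i j => G (s i) j)).
Qed.

Section TensorMaps.
Variables (U W : gvect k) (F : Sym U -> nat -> Sym W).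
Hypothesis lF : linear F.

Definition tmap : tens (Sym U) (Sym U) -> nat -> tens (Sym W) (Sym W) :=
  tens_lift (fun a b => hten (F a) (F b)).

Lemma tmap_bil1 b : linear (fun a => hten (F a) (F b)).
Proof. by move=> c x y; rewrite lF (@hten_linear_l k _ _). Qed.

Lemma tmap_bil2 a : linear (fun b => hten (F a) (F b)).
Proof. by move=> c x y; rewrite lF (@hten_linear_r k _ _). Qed.

Lemma tmap_linear : linear tmap.
Proof. exact: (tens_lift_linear tmap_bil1 tmap_bil2). Qed.

Lemma tmap_pure a b : tmap (tpure a b) = hten (F a) (F b).
Proof. exact: (tens_lift_pure _ _ tmap_bil1 tmap_bil2). Qed.

Lemma hext_tmap s t : hext tmap (hten s t) = hten (hext F s) (hext F t).
Proof.
apply: (hext_hconv tmap_linear (@tpure_linear_l k _ _) (@tpure_linear_r k _ _)).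
by move=> i j; rewrite tmap_pure.
Qed.

Hypothesis FC : forall w, hcomul (F (mono w)) = sp w (fun u v => hten (F (mono u)) (F (mono v))).

Lemma hcomul_tmap x : hcomul (F x) = tmap (comul x).
Proof.
apply: (lin_ext (F := fun x => hcomul (F x)) (G := fun x => tmap (comul x))) => [||w].
- exact: (linear_comp (@hcomul_linear k W) lF).
- exact: (linear_comp tmap_linear (@comul_linear k U)).
rewrite FC comul_mono (sp_map _ _ tmap_linear).
by apply: sp_ext => u v _ _; rewrite tmap_pure.
Qed.

Lemma hcomul_hext s : hcomul (hext F s) = hext tmap (hcomul s).
Proof.
apply: funext => n; rewrite /hcomul -[hext F s n]/(cs n (fun i j => F (s i) j)).
rewrite -[RHS]/(cs n (fun i j => tmap (comul (s i)) j)).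
rewrite (cs_lin _ _ (@comul_linear k W)); apply: cs_ext => i j _.
by rewrite -hcomul_tmap.
Qed.

End TensorMaps.

Section TensorDerivations.
Variables (W : gvect k) (D : Sym W -> nat -> Sym W).
Hypotheses (lD : linear D) (DC : forall j, is_coderivation (D ^~ j)).

(** The derivation of the tensor square is split into [D (x) 1] and [1 (x) D], because [hext_hconv]
    treats one product of maps at a time. *)
Definition tder_l : tens (Sym W) (Sym W) -> nat -> tens (Sym W) (Sym W) :=
  tens_lift (fun a b => hten (D a) (hconst b)).
Definition tder_r : tens (Sym W) (Sym W) -> nat -> tens (Sym W) (Sym W) :=
  tens_lift (fun a b => hten (hconst (parity a)) (D b)).

Lemma tder_l1 (b : Sym W) : linear (fun a => hten (D a) (hconst b)).
Proof. by move=> c x y; rewrite lD (@hten_linear_l k _ _). Qed.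

Lemma tder_l2 a : linear (fun b : Sym W => hten (D a) (hconst b)).
Proof. by move=> c x y; rewrite (@hconst_linear k _) (@hten_linear_r k _ _). Qed.

Lemma tder_r1 b : linear (fun a : Sym W => hten (hconst (parity a)) (D b)).
Proof.
by move=> c x y; rewrite parity_linear (@hconst_linear k _) (@hten_linear_l k _ _).
Qed.

Lemma tder_r2 (a : Sym W) : linear (fun b => hten (hconst (parity a)) (D b)).
Proof. by move=> c x y; rewrite lD (@hten_linear_r k _ _). Qed.

Lemma tder_l_linear : linear tder_l.
Proof. exact: (tens_lift_linear tder_l1 tder_l2). Qed.

Lemma tder_r_linear : linear tder_r.
Proof. exact: (tens_lift_linear tder_r1 tder_r2). Qed.

Lemma tens_derE j T : tens_der (D ^~ j) T = tder_l T j + tder_r T j.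
Proof.
have lj : linear (D ^~ j) by move=> c x y; rewrite lD.
apply: (tens_lin_ext (f := tens_der (D ^~ j)) (g := fun T => tder_l T j + tder_r T j)).
- exact: tens_der_linear.
- move=> c x y; rewrite tder_l_linear tder_r_linear.
  rewrite -[LHS]/((c *: tder_l x j + tder_l y j) + (c *: tder_r x j + tder_r y j)).
  by rewrite scalerDr addrACA.
move=> a b; rewrite (tens_der_pure _ _ lj) /tder_l /tder_r.
rewrite (tens_lift_pure _ _ tder_l1 tder_l2) (tens_lift_pure _ _ tder_r1 tder_r2).
by rewrite hten1l hten1r.
Qed.

Lemma hcomul_hext_der s : hcomul (hext D s) = hext tder_l (hcomul s) + hext tder_r (hcomul s).
Proof.
rewrite -hext_add; apply: funext => n.
rewrite /hcomul -[hext D s n]/(cs n (fun i j => D (s i) j)).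
rewrite -[RHS]/(cs n (fun i j => tder_l (comul (s i)) j + tder_r (comul (s i)) j)).
rewrite (cs_lin _ _ (@comul_linear k W)); apply: cs_ext => i j _.
by rewrite (proj2 (DC j)) tens_derE.
Qed.

Lemma hext_tder_l s t : hext tder_l (hten s t) = hten (hext D s) t.
Proof.
rewrite -[t in RHS](@hext_of_hconst k (Sym W) _ (fun x => x)).
apply: (hext_hconv tder_l_linear (@tpure_linear_l k _ _) (@tpure_linear_r k _ _)).
by move=> i j; rewrite /tder_l (tens_lift_pure _ _ tder_l1 tder_l2).
Qed.

Lemma hext_tder_r s t : hext tder_r (hten s t) = hten (fun i => parity (s i)) (hext D t).
Proof.
rewrite -(@hext_of_hconst k (Sym W) _ (@parity k W)).
apply: (hext_hconv tder_r_linear (@tpure_linear_l k _ _) (@tpure_linear_r k _ _)).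
by move=> i j; rewrite /tder_r (tens_lift_pure _ _ tder_r1 tder_r2).
Qed.

Lemma hcomul_der w : hcomul (D (mono w)) = sp w (fun u v =>
  hten (D (mono u)) (hconst (mono v)) + hten (hconst (parity (mono u))) (D (mono v))).
Proof.
rewrite -(hext_hconst (mono w) lD) hcomul_hext_der.
have -> : hcomul (hconst (mono w)) =
    sp w (fun u v => hten (hconst (mono u) : nat -> Sym W) (hconst (mono v))).
  apply: funext => n; rewrite sp_coef /hcomul.
  under sp_ext => u v _ _ do rewrite hten1l.
  rewrite /hconst; case: eqP => _; first exact: comul_mono.
  rewrite (lin_0 (@comul_linear k W)) sp_eq0 // => u v _ _.
  exact: (lin_0 (@tpure_linear_r k _ _ _)).
rewrite !(sp_map _ _ (hext_linear tder_l_linear)) (sp_map _ _ (hext_linear tder_r_linear)).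
rewrite -spD; apply: sp_ext => u v _ _; rewrite hext_tder_l hext_tder_r !hext_hconst //.
congr (_ + hten _ _); apply: funext => -[|i] //.
exact: (lin_0 (@parity_linear k W)).
Qed.

End TensorDerivations.

Lemma parity_hom (W : gvect k) p (x : Sym W) : sym_hom p x -> parity x = ksgn k p *: x.
Proof.
move=> [n [c [w [hw ->]]]]; rewrite (lin_sum_scale (@parity_linear k W)) scaler_sumr.
by apply: eq_bigr => i _; rewrite parity_mono hw !scalerA mulrC.
Qed.

(* [G = F D - D' F] is a coderivation along [F], so it takes primitive values, and
   the multiplication is injective on primitive elements. *)
Lemma codiff_commute (U : gvect k) (A : gcalg k) (B : bvinf A)
    (D : Sym U -> nat -> Sym U) (F : Sym U -> nat -> Sym (shift A 2)) :
  linear D -> (forall j, is_coderivation (D ^~ j)) -> D (sym_one U) = 0 -> coalg_mor F ->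
  (forall w, hext (vmexp (size w)) (hext F (D (mono w))) =
             hext (vmexp (size w)) (hext (bv_codiff B) (F (mono w)))) ->
  forall x, hext F (D x) = hext (bv_codiff B) (F x).
Proof.
move=> lD DC D1 [lF hF FC F1] H; set D' := bv_codiff B.
have lD' : linear D' := bv_codiff_linear B.
have DC' : forall j, is_coderivation (D' ^~ j) := bv_codiff_coder B.
apply: lin_ext => [||w].
- exact: (linear_comp (hext_linear lF) lD).
- exact: (linear_comp (hext_linear lD') lF).
pose G w := hext F (D (mono w)) - hext D' (F (mono w)).
apply/eqP; rewrite -subr_eq0; apply/eqP; rewrite -/(G w).
apply: (coalg_unique char0 (G := G) (P := fun u => F (mono u))
   (Q := fun u i => parity (F (mono u) i))) => [||u|u Hu].
- exact: F1.
- rewrite -/(sym_one U) F1; apply: funext => -[|i]; last exact: (lin_0 (@parity_linear k _)).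
  by rewrite [LHS](parity_mono [::]) wdeg_nil scale1r.
(* The difference of (F (x) F)(D (x) 1 + 1 (x) D) and (D' (x) 1 + 1 (x) D')(F (x) F) is regrouped as
   G (x) F plus F (x) G, the second with the parity sign in its left factor. *)
- rewrite (lin_B (@hcomul_linear k _)) (hcomul_hext lF FC) (hcomul_der lD DC).
  rewrite (hcomul_hext_der lD' DC') FC.
  rewrite (sp_map _ _ (hext_linear (tmap_linear lF))).
  rewrite (sp_map _ _ (hext_linear (tder_l_linear lD'))) (sp_map _ _ (hext_linear (tder_r_linear lD'))).
  rewrite -spD -[X in _ - X]scale1r -scaleNr -spZ -spD; apply: sp_ext => x y _ _.
  rewrite (lin_D (hext_linear (tmap_linear lF))) !(hext_tmap lF) !hext_hconst //.
  rewrite (hext_tder_l lD') (hext_tder_r lD') scaleN1r opprD addrACA.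
  rewrite /G (lin_B (hten_linear_l _)) (lin_B (hten_linear_r _)); congr (_ + _).
  congr (_ - _); congr (hten _ _); rewrite parity_mono (lin_Z lF); apply: funext => i.
  rewrite (parity_hom (hF x i)); congr (_ *: _).
  by apply/esym; apply: (@ksgn_cong _ (- i%:Z)); ring.
case: u Hu => [|a u] Hu.
  rewrite /G -/(sym_one U) D1 F1 (lin_0 (hext_linear lF)) hext_hconst // sub0r.
  by rewrite [D' _](bv_codiff_mono B [::]) /= oppr0.
have Gi : G (a :: u) = fun n => inj1 (pr_cogen (G (a :: u) n)) by apply: funext => n; apply: Hu.
have : hext (vmexp (size (a :: u))) (G (a :: u)) = 0.
  by rewrite /G (lin_B (hext_linear (vmexp_linear _))) H subrr.
rewrite Gi /vmexp (hext_mexp_inj1 (@idA_linear k A) (@unshift2_hom k A)).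
(* On primitive values the multiplication is a power of hbar times the identity, hence injective. *)
rewrite -(lin_0 (@hbarX_linear k A (size u))) => /(@hbarX_inj k A) g0.
apply: funext => n; rewrite -[pr_cogen _]/((fun i => pr_cogen (G (a :: u) i)) n) g0.
exact: (lin_0 (@inj1_linear k (shift A 2))).
Qed.

Lemma tens_lift_tmap (U W : gvect k) (F : Sym U -> nat -> Sym W) n x : linear F ->
  tens_lift (fun a b => \sum_(i < n.+1) tpure (F a i) (F b (n - i)%N)) (comul x) =
  tmap F (comul x) n.
Proof.
move=> lF; pose T a b := hten (F a) (F b) n.
have T1 b : linear (T^~ b) by move=> c y z; rewrite /T (tmap_bil1 lF).
have T2 a : linear (T a) by move=> c y z; rewrite /T (tmap_bil2 lF).
apply: (tens_lin_ext (f := tens_lift T) (g := fun t => tmap F t n)).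
- exact: tens_lift_linear.
- by move=> c y z; rewrite (tmap_linear lF).
by move=> a b; rewrite tens_lift_pure // (tmap_pure lF).
Qed.

Lemma hdegree_mono (U W : gvect k) (F : Sym U -> nat -> W) : linear F ->
  (forall w, hhom (wdeg w) (F (mono w))) -> hdegree (A := symG U) 0 F.
Proof.
move=> lF hF p x j [n [c [w [hw ->]]]]; rewrite (lin_sum_scale lF) fct_sumE.
apply: ghom_sum => i _; apply: (ghomZ (c i)).
by rewrite addr0 -(hw i); apply: hF.
Qed.

Lemma mono_hdegree (U W : gvect k) (F : Sym U -> nat -> W) :
  hdegree (A := symG U) 0 F -> forall w, hhom (wdeg w) (F (mono w)).
Proof. by move=> hF w j; have := hF _ _ j (sym_hom_mono w); rewrite addr0. Qed.

Lemma hlinf_morP (U W : gvect k) (D : Sym U -> nat -> Sym U) (D' : Sym W -> nat -> Sym W)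
    (F : Sym U -> nat -> Sym W) :
  is_hlinf_mor D D' F <-> coalg_mor F /\ forall x, hext F (D x) = hext D' (F x).
Proof.
split=> [[[lF hF] FC _ F1 FD]|[cF FD]].
  have {}lF : linear F by apply/hlinearP.
  split=> //; split=> //; first exact: (mono_hdegree hF).
  move=> w; apply: funext => n; rewrite /hcomul FC tens_lift_tmap // comul_mono.
  rewrite (sp_map _ _ (tmap_linear lF)); congr (_ n); apply: sp_ext => u v _ _.
  exact: tmap_pure.
have [lF hF FC F1] := cF; split=> //.
- by split; [apply/hlinearP|apply: hdegree_mono].
- by move=> x n; rewrite tens_lift_tmap // -hcomul_tmap.
(* For the counit, [F] is written as the exponential of its projection, on which [counit_wexp] gives
   the value. *)
move=> x n; pose c n : k^o := if n == 0%N then 1 else 0.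
transitivity (c n *: (counit x : k^o)); last first.
  by rewrite /c; case: eqP => _; rewrite ?scale1r ?scale0r.
apply: (lin_ext (W := k^o) (F := fun x => counit (F x n)) (G := fun x => c n *: (counit x : k^o))) => [||w].
- by move=> d y z; rewrite lF; apply: counit_linear.
- by move=> d y z; rewrite (counit_linear d y z) scalerDr !scalerA mulrC.
have hf u : hhom (wdeg u) (fun i => pr_cogen (F (mono u) i)).
  by move=> i; apply: pr_cogen_hom; apply: hF.
rewrite (coalg_mor_wexp char0 cF) (counit_wexp char0 hf) counit_mono.
by case: w => [|a w]; case: n => [|n]; rewrite /c /= ?scaler0 ?scale0r ?scale1r.
Qed.

Lemma coalg_mor_comp (U V W : gvect k) (F : Sym U -> nat -> Sym V) (G : Sym V -> nat -> Sym W) :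
  coalg_mor F -> coalg_mor G -> coalg_mor (fun x => hext G (F x)).
Proof.
move=> [lF hF FC F1] [lG hG GC G1]; split.
- exact: (linear_comp (hext_linear lG) lF).
- move=> w n; apply: (@ghom_sum k (symG W)) => i _.
  have := @hdegree_mono V (symG W) G lG hG _ _ (n - i)%N (hF w i); move/ghom_eq; apply.
  have /subnK e : (i <= n)%N by rewrite -ltnS.
  by have := congr1 Posz e; rewrite PoszD => <-; ring.
- move=> w; rewrite (hcomul_hext lG GC) FC (sp_map _ _ (hext_linear (tmap_linear lG))).
  by apply: sp_ext => u v _ _; rewrite (hext_tmap lG).
by rewrite F1 hext_hconst.
Qed.

Lemma hlinf_mor_comp (U V W : gvect k) (D : Sym U -> nat -> Sym U) (D' : Sym V -> nat -> Sym V)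
    (D'' : Sym W -> nat -> Sym W) F G : linear D'' ->
  is_hlinf_mor D D' F -> is_hlinf_mor D' D'' G -> is_hlinf_mor D D'' (fun x => hext G (F x)).
Proof.
move=> lD'' /hlinf_morP[cF FD] /hlinf_morP[cG GD]; apply/hlinf_morP; split.
  exact: coalg_mor_comp.
have [lG _ _ _] := cG; move=> x.
rewrite -hext_comp // FD hext_comp // hext_comp //.
by apply: hext_ext => i; rewrite GD.
Qed.

(** Existence in the cofreeness of the symmetric coalgebra: the morphism with projection [f] is the
    exponential of [f] into the symmetric algebra. *)
Lemma coalg_mor_exp (U W : gvect k) (f : Sym U -> nat -> W) : linear f ->
  (forall w, hhom (wdeg w) (f (mono w))) -> f (sym_one U) = 0 ->
  let F := bv_exp (A := symA W) (fun x i => inj1 (f x i)) in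
  [/\ coalg_mor F, forall w, F (mono w) = wexp (fun w i => inj1 (f (mono w) i) : symA W) w &
      forall x n, pr_cogen (F x n) = f x n].
Proof.
move=> lf hf f1 F.
have lg : linear (fun x i => inj1 (f x i) : symA W).
  by move=> c x y; apply: funext => i; rewrite lf; apply: inj1_linear.
have FE w : F (mono w) = wexp (fun w i => inj1 (f (mono w) i) : symA W) w.
  by rewrite /F (bv_exp_mono char0).
have lF : linear F by apply: bv_exp_linear.
split=> //.
  split=> //.
  - by move=> w; rewrite FE; exact: (@wexp_hom k U (symA W) _ (wexp_inj1_hom hf) w).
  - by move=> w; rewrite FE (wexp_comul char0 hf); apply: sp_ext => u v _ _; rewrite !FE.
  by rewrite FE wexp_nil.
move=> x n; apply: (lin_ext (F := fun x => pr_cogen (F x n)) (G := fun x => f x n)) => [||w].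
- by move=> c y z; rewrite lF; apply: pr_cogen_linear.
- by move=> c y z; rewrite lf.
by rewrite FE (pr_cogen_wexp char0 hf f1).
Qed.

End Criterion.

(** * Cumulants *)

Section Divisibility.
Variables (k : fieldType) (V : lmodType k).

Definition hbar_dvd (n : nat) (s : nat -> V) : Prop := forall j, (j < n)%N -> s j = 0.

Lemma hbar_dvd0 n : hbar_dvd n (0 : nat -> V).
Proof. by []. Qed.

Lemma hbar_dvdD n s t : hbar_dvd n s -> hbar_dvd n t -> hbar_dvd n (s + t).
Proof. by move=> hs ht j jn; rewrite -[LHS]/(s j + t j) hs // ht // addr0. Qed.

Lemma hbar_dvdZ n c s : hbar_dvd n s -> hbar_dvd n (c *: s).
Proof. by move=> hs j jn; rewrite -[LHS]/(c *: s j) hs // scaler0. Qed.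

Lemma hbar_dvd_leq m n s : (m <= n)%N -> hbar_dvd n s -> hbar_dvd m s.
Proof. by move=> mn hs j jm; apply: hs; apply: leq_trans mn. Qed.

End Divisibility.

Lemma hbar_dvd_hmul (k : fieldType) (A : gcalg k) m n (s t : nat -> A) :
  hbar_dvd m s -> hbar_dvd n t -> hbar_dvd (m + n) (hmul s t).
Proof.
move=> hs ht j jmn; rewrite hmulE; apply: cs_eq0 => a b abj.
have [am|ma] := ltnP a m; first by rewrite hs // (lin_0 (gmul_linear_l _)).
rewrite ht ?(lin_0 (gmul_linear_r _)) //.
by rewrite -(ltn_add2l m) (leq_ltn_trans _ jmn) // -abj leq_add2r.
Qed.

Lemma has_split (T : Type) (p : pred T) s :
  has p s -> exists xs x ys, s = xs ++ x :: ys /\ p x.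
Proof.
elim: s => [//|x s IH] /= /orP[px|/IH[xs [y [ys [-> py]]]]]; first by exists [::], x, s.
by exists (x :: xs), y, ys.
Qed.

Section Cumulants.
Variables (k : fieldType) (U : gvect k) (A : gcalg k).
Hypothesis char0 : [pchar k] =i pred0.
Variables (Phi : Sym U -> nat -> A) (c : word U -> nat -> A).
Hypotheses (lPhi : linear Phi) (hPhi : hdegree (A := symG U) 0 Phi).
Hypotheses (hc : forall w, hhom (wdeg w) (c w)) (c0 : c [::] = 0).
Hypothesis PhiE : forall w, Phi (mono w) = wexp c w.
Hypothesis c_dv : forall w, hbar_dvd (size w).-1 (c w).
Implicit Types (W X Y Z : word (symA U)) (a b : letter (symA U)).

(** The letters of [W] are themselves elements of S(U), multiplied before [Phi] is applied. For
    [Phi = bv_exp chi], the logarithm [cumulant] of these moments is the composite of [chi] with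
    [bv_p1] ([chi_p1_mono]). *)
Definition moment W : nat -> A := Phi (wprod (fun x : symA U => x) W).
Definition cumulant W : nat -> A := wlog moment W.

Let idV_linear : linear (fun x : symA U => x : symA U).
Proof. by []. Qed.

Let idV_hom p (x : symA U) : ghom p x -> ghom (p + (0 + 0)) (x : symA U).
Proof. by rewrite !addr0. Qed.

Lemma moment_rel : sym_rel moment.
Proof. exact: (rel_lin lPhi (wprod_rel idV_linear idV_hom)). Qed.

Lemma moment_hom W : hhom (wdeg W) (moment W).
Proof.
move=> j; have := hPhi j (wprod_hom (A := symA U) idV_hom W).
by rewrite addr0 mul0r !addr0.
Qed.

Lemma moment_nil : moment [::] = hconst (gone A).
Proof. by rewrite /moment /= [LHS](PhiE [::]) wexp_nil. Qed.

Lemma cumulant_rel : sym_rel cumulant.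
Proof. exact: (wlog_rel moment_rel). Qed.

Lemma cumulant_hom W : hhom (wdeg W) (cumulant W).
Proof. exact: (wlog_hom moment_hom). Qed.

Lemma wexp_cumulant W : wexp cumulant W = moment W.
Proof. exact: (wexp_wlog char0 moment_hom moment_nil). Qed.

Lemma moment_cons a W :
  moment (a :: W) = sp W (fun X Y => hmul (cumulant (a :: X)) (moment Y)).
Proof.
rewrite -wexp_cumulant (wexp_cons char0 cumulant_hom).
by apply: sp_ext => X Y _ _; rewrite wexp_cumulant.
Qed.

(** As [moment] is one on the empty word, it is invertible for convolution. *)
Lemma moment_cancel (h : word (symA U) -> nat -> A) :
  (forall W, sp W (fun X Y => hmul (h X) (moment Y)) = 0) -> forall W, h W = 0.
Proof.
move=> H W; have [N] := ubnP (size W); elim: N W => // N IH W WN.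
rewrite -[h W]hmul1r -(sp_right0 W (fun X Y => hmul (h X) (hconst (gone A)))) -[RHS](H W).
apply: sp_ext => X [|b Y] s _; first by rewrite moment_nil.
rewrite IH ?hmul0l //; rewrite ltnS -s in WN; apply: leq_trans WN.
by rewrite /= addnS ltnS leq_addr.
Qed.

Lemma moment_mul a b d W : lval d = gmul (lval a) (lval b) ->
  moment (d :: W) = moment (a :: b :: W).
Proof. by move=> e; rewrite /moment /= e sym_mulA. Qed.

(* The formula for a cumulant with an entry which is a product; the right-hand side only
   involves words of smaller [excess] (see below). *)
Lemma cumulant_mul a b d W : lval d = gmul (lval a) (lval b) ->
  cumulant (d :: W) = cumulant (a :: b :: W) +
    sp W (fun X Y => ksgn k (ldeg b * wdeg X) *: hmul (cumulant (a :: X)) (cumulant (b :: Y))).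
Proof.
move=> e; apply/eqP; rewrite -subr_eq0; apply/eqP.
pose P W := sp W (fun X Y => ksgn k (ldeg b * wdeg X) *: hmul (cumulant (a :: X)) (cumulant (b :: Y))).
(* After convolution with [moment], both sides expand the moment of [a :: b :: W]. The first term
   collects the splittings with [b] in the cumulant of [a], the second those with [b] in the
   remaining moment, which is expanded once more. *)
apply: (moment_cancel (h := fun W => cumulant (d :: W) - (cumulant (a :: b :: W) + P W))) => {}W.
have lh Y : linear (fun s : nat -> A => hmul s (moment Y)) := hmul_linear_l _.
under sp_ext => X Y _ _ do rewrite (lin_B (lh Y)) (lin_D (lh Y)) -[- (_ + _)]scaleN1r.
rewrite spD spZ spD -moment_cons (moment_mul W e) moment_cons /= scaleN1r.
apply/eqP; rewrite subr_eq0; apply/eqP; congr (_ + _).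
transitivity (sp W (fun X Z => sp Z (fun Y T => ksgn k (ldeg b * wdeg X) *:
   hmul (cumulant (a :: X)) (hmul (cumulant (b :: Y)) (moment T))))).
  apply: sp_ext => X Z _ _; rewrite moment_cons (sp_map _ _ (hmul_linear_r _)).
  by rewrite -spZ.
rewrite -(sp_coassoc W (fun X Y T => ksgn k (ldeg b * wdeg X) *:
   hmul (cumulant (a :: X)) (hmul (cumulant (b :: Y)) (moment T)))).
apply: sp_ext => Z T _ _; rewrite /P (sp_map _ _ (lh T)); apply: sp_ext => X Y _ _.
by rewrite hmulZl hmulA.
Qed.

(** Moments do not see an entry equal to one, so by cancellation [cumulant (a :: X)] is one for
    empty [X] and zero otherwise. *)
Lemma cumulant_one0 a b W : lval a = gone (symA U) -> ldeg a = 0 -> cumulant (a :: b :: W) = 0.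
Proof.
move=> a1 a0.
pose h W := cumulant (a :: W) - (if W is [::] then hconst (gone A) else 0).
rewrite -[LHS]subr0 -[LHS]/(h (b :: W)); move: (b :: W) => {b}W.
apply: moment_cancel => {}W.
have lh Y : linear (fun s : nat -> A => hmul s (moment Y)) := hmul_linear_l _.
under sp_ext => X Y _ _ do rewrite (lin_B (lh Y)) -[- hmul _ _]scaleN1r.
rewrite spD spZ scaleN1r -moment_cons; apply/eqP; rewrite subr_eq0; apply/eqP.
transitivity (moment W); first by rewrite /moment /= a1 sym_mul1l.
rewrite -[LHS](sp_left0 W (fun X Y => moment Y)); apply: sp_ext => -[|? X] Y _ _.
  by rewrite hmul1l.
by rewrite hmul0l.
Qed.

Definition ml (w : word U) : letter (symA U) := @Letter k (symA U) (wdeg w) (mono w) (sym_hom_mono w).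

(** The number of products inside the entries, on which the induction of [cumulant_ml_dv] runs. *)
Definition excess (ws : seq (word U)) := (\sum_(w <- ws) (size w).-1)%N.

Lemma excess_cons w ws : excess (w :: ws) = ((size w).-1 + excess ws)%N.
Proof. by rewrite /excess big_cons. Qed.

Lemma hbar_dvd_sp_ml n ws (H : word (symA U) -> word (symA U) -> nat -> A) :
  (forall xs ys, (size xs + size ys = size ws)%N -> (excess xs + excess ys = excess ws)%N ->
     hbar_dvd n (H (map ml xs) (map ml ys))) ->
  hbar_dvd n (sp (map ml ws) H).
Proof.
elim: ws H => [|w ws IH] H E /=; first by apply: (E [::] [::]); rewrite /excess ?big_nil.
apply: hbar_dvdD; apply: IH => xs ys es ex.
  by apply: (E (w :: xs) ys); rewrite /= ?addSn ?es // !excess_cons -ex addnA.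
by apply: hbar_dvdZ; apply: (E xs (w :: ys)); rewrite /= ?addnS ?es // !excess_cons -ex addnCA.
Qed.

Lemma cumulant_front ws xs w n :
  hbar_dvd n (cumulant (map ml (w :: ws ++ xs))) -> hbar_dvd n (cumulant (map ml (ws ++ w :: xs))).
Proof.
rewrite /= !map_cat /= -(sym_rel_move (map ml ws) (map ml xs) (ml w) cumulant_rel).
set s := ksgn _ _ => /(hbar_dvdZ s); rewrite scalerA.
by rewrite /s ksgn_sq scale1r.
Qed.

(** On a word of letters the moment is [Phi] of the monomial, that is [wexp c], and a map is
    recovered from its exponential. *)
Lemma cumulant_letters (w : word U) : cumulant (map (fun x : letter U => ml [:: x]) w) = c w.
Proof.
have hi p (x : U) : ghom p x -> @ghom k (symA U) (p + (0 + 0)) (inj1 x).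
  by rewrite !addr0; apply: inj1_sym_hom.
have E u : map (fun x : letter U => ml [:: x]) u = map (lmap (U' := symA U) 0 (@inj1 k U)) u.
  apply: eq_map => a; apply: letter_eq.
    by rewrite ldeg_lmap /= wdeg_cons wdeg_nil !addr0.
  by rewrite (lval_lmap hi) inj1_letter.
have hk u : hhom (wdeg u) (cumulant (map (fun x : letter U => ml [:: x]) u)).
  have := cumulant_hom (map (fun x : letter U => ml [:: x]) u).
  by rewrite E wdeg_lmap (_ : (0 + 0 : int) = 0) // mul0r addr0.
rewrite -(wlog_wexp char0 (f := fun u => cumulant (map (fun x : letter U => ml [:: x]) u))) //; last first.
  by rewrite /= /cumulant /wlog big_geq.
rewrite -[RHS](wlog_wexp char0 w hc c0); apply: eq_bigr => r _; congr (_ *: cpow _ _ _).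
apply: funext => u; have -> : (fun u => cumulant (map (fun x : letter U => ml [:: x]) u)) =
    (fun u => cumulant (map (lmap (U' := symA U) 0 (@inj1 k U)) u)).
  by apply: funext => u'; rewrite E.
rewrite -wexp_lmap wexp_cumulant -PhiE -E /moment; congr Phi.
elim: u => [//|a u IH] /=; rewrite IH.
exact: (sym_mul_mono [:: a] u).
Qed.

(** An entry with at least two letters is taken apart by [cumulant_mul]; an empty entry next to
    another one gives zero; otherwise all entries are letters and the cumulant is [c]. *)
Lemma cumulant_ml_dv ws : hbar_dvd (size ws).-1 (cumulant (map ml ws)).
Proof.
have [N] := ubnP (excess ws); elim: N ws => // N IH ws wsN.
have [/has_split[xs [w [ys [e w2]]]]|small] := boolP (has (fun w => 1 < size w)%N ws).
  rewrite e; apply: cumulant_front; rewrite e in wsN.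
  have : (excess (w :: xs ++ ys) < N.+1)%N.
    by move: wsN; rewrite /excess !big_cat !big_cons !big_cat /= addnCA.
  rewrite size_cat /= addnS -size_cat; move: (xs ++ ys) => zs {xs ys e wsN} wN.
  case: w w2 wN => [|x [|y v]] //= _; set v' := y :: v.
  rewrite excess_cons /= ltnS => wN.
  have v'1 : (size v').-1 = size v by [].
  rewrite (@cumulant_mul (ml [:: x]) (ml v')); last first.
    by rewrite /= sym_mul_mono.
  apply: hbar_dvdD.
    apply: (@hbar_dvd_leq _ _ _ (size [:: [:: x], v' & zs]).-1) => //.
    by apply: (IH [:: [:: x], v' & zs]); rewrite !excess_cons /= add0n.
  (* The two cumulants are divisible by hbar to the powers [size us] and [size vs], which add up to
     [size zs]. *)
  apply: hbar_dvd_sp_ml => us vs es ex; apply: hbar_dvdZ; rewrite -es; apply: hbar_dvd_hmul.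
    apply: (IH ([:: x] :: us)); rewrite excess_cons add0n (leq_trans _ wN) //.
    by rewrite addSn ltnS -ex addnCA leq_addr.
  apply: (IH (v' :: vs)); rewrite excess_cons v'1 (leq_trans _ wN) //.
  by rewrite addSn ltnS leq_add2l -ex leq_addl.
have [/has_split[xs [w [ys [e /eqP w0]]]]|nonempty] := boolP (has (fun w => size w == 0)%N ws).
  rewrite e; apply: cumulant_front; rewrite size_cat /= addnS -size_cat.
  move/size0nil: w0 => ->; case: (xs ++ ys) => [//|z zs] /=.
  have -> : cumulant (ml [::] :: ml z :: map ml zs) = 0.
    by apply: cumulant_one0 => //=; apply: wdeg_nil.
  exact: hbar_dvd0.
have [w ->] : exists w, ws = map (fun x : letter U => [:: x]) w.
  elim: ws small nonempty {wsN} => [|w ws IHw] /=; first by exists [::].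
  rewrite !negb_or => /andP[w1 /IHw{}IHw] /andP[w0 /IHw[w' ->]].
  by case: w w1 w0 => [|a [|b w]] //= _ _; exists (a :: w').
by rewrite -map_comp cumulant_letters size_map; apply: c_dv.
Qed.

(** Entries that are not monomials are expanded one at a time by multilinearity; [ws] collects the
    monomials already reached. *)
Lemma cumulant_dv W : hbar_dvd (size W).-1 (cumulant W).
Proof.
suff H ws : hbar_dvd (size ws + size W).-1 (cumulant (map ml ws ++ W)) by apply: (H [::]).
elim: W ws => [|a W IH] ws.
  by rewrite cats0 addn0; apply: cumulant_ml_dv.
(* A homogeneous element of S(U) is by definition a combination of monomials of its degree. *)
have [n [d [w [hw e]]]] := lvalP a.
pose K := sym_lift cumulant : Sym (symA U) -> (nat -> A).
have lK : linear K := sym_lift_linear cumulant_rel.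
have -> : cumulant (map ml ws ++ a :: W) =
    \sum_(i < n) d i *: cumulant (map ml (rcons ws (w i)) ++ W).
  transitivity (K (sym_mul (mono (map ml ws)) (sym_mul (inj1 (lval a)) (mono W)))).
    by rewrite inj1_letter !sym_mul_mono /K sym_lift_mono //; apply: cumulant_rel.
  rewrite e (lin_sum_scale (@inj1_linear k (symA U))).
  rewrite (lin_sum_scale (@sym_mul_linear_l k (symA U) _)).
  rewrite (lin_sum_scale (@sym_mul_linear_r k (symA U) _)) (lin_sum_scale lK).
  apply: eq_bigr => i _; congr (_ *: _).
  rewrite -[mono (w i)]/(lval (ml (w i))) inj1_letter !sym_mul_mono /K sym_lift_mono; last exact: cumulant_rel.
  by rewrite map_rcons cat_rcons.
elim/big_ind: _ => [|s t hs ht|i _]; [exact: hbar_dvd0|exact: hbar_dvdD|apply: hbar_dvdZ].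
rewrite [size (a :: W)]/= -addSnnS -(size_rcons ws (w i)).
exact: IH.
Qed.

End Cumulants.

(** * The BV-infinity algebra of an L-infinity algebra *)

Section Suspension.
Variables (k : fieldType) (V : gvect k).

Definition slet : letter (shift V 1) -> letter (shift V (-1)) :=
  @lmap k (shift V 1) (shift V (-1)) 1 (fun x => x).
Definition dlet : letter (shift V (-1)) -> letter (shift V 1) :=
  @lmap k (shift V (-1)) (shift V 1) (-1) (fun x => x).

Lemma susp_hom p (x : V) :
  @ghom k (shift V 1) p x -> @ghom k (shift V (-1)) (p + (1 + 1)) x.
Proof.
move=> hx; suff: @ghom k V (-1 + (p + (1 + 1))) x by [].
by apply: (ghom_eq (hx : @ghom k V (1 + p) x)); ring.
Qed.

Lemma desusp_hom p (x : V) :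
  @ghom k (shift V (-1)) p x -> @ghom k (shift V 1) (p + (-1 + -1)) x.
Proof.
move=> hx; suff: @ghom k V (1 + (p + (-1 + -1))) x by [].
by apply: (ghom_eq (hx : @ghom k V (-1 + p) x)); ring.
Qed.

Lemma susp2_mono w : susp2 (mono w) = mono (map slet w).
Proof. by apply: (@sym_map_mono _ _ _ 1) => //; apply: susp_hom. Qed.

Lemma susp2_linear : linear (@susp2 k V).
Proof. by apply: (@sym_map_linear _ _ _ 1) => //; apply: susp_hom. Qed.

Lemma desusp2_mono w : desusp2 (mono w) = mono (map dlet w).
Proof. by apply: (@sym_map_mono _ _ _ (-1)) => //; apply: desusp_hom. Qed.

Lemma desusp2_linear : linear (@desusp2 k V).
Proof. by apply: (@sym_map_linear _ _ _ (-1)) => //; apply: desusp_hom. Qed.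

Lemma slet_lval a : lval (slet a) = lval a.
Proof. by rewrite lval_lmap //; apply: susp_hom. Qed.

Lemma dlet_lval a : lval (dlet a) = lval a.
Proof. by rewrite lval_lmap //; apply: desusp_hom. Qed.

Lemma sletK : cancel slet dlet.
Proof.
move=> a; apply: letter_eq; last by rewrite dlet_lval slet_lval.
by rewrite !ldeg_lmap; ring.
Qed.

Lemma dletK : cancel dlet slet.
Proof.
move=> a; apply: letter_eq; last by rewrite slet_lval dlet_lval.
by rewrite !ldeg_lmap; ring.
Qed.

Lemma word_slet (w : word (shift V (-1))) : exists w', w = map slet w'.
Proof. by exists (map dlet w); rewrite (mapK dletK). Qed.

Definition sinj : shift V 1 -> symA (shift V (-1)) := @inj1 k (shift V (-1)).

Lemma sinj_linear : linear sinj.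
Proof. exact: (@inj1_linear k (shift V (-1))). Qed.

Lemma sinj_hom p (x : shift V 1) : ghom p x -> ghom (p + (1 + 1)) (sinj x).
Proof. by move=> /susp_hom; apply: inj1_sym_hom. Qed.

(** By [smexp_mono] this is the double suspension times hbar^(m-n) on S^n. Writing it as the
    multiplication map of the generators [sinj] makes the lemmas on [mexp] available. *)
Definition smexp := mexp sinj.

Lemma smexp_linear m : linear (smexp m).
Proof. exact: (mexp_linear sinj_linear sinj_hom). Qed.

Lemma wprod_sinj w : wprod sinj w = mono (map slet w).
Proof.
elim: w => [//|a w IH] /=; rewrite IH /sinj -(slet_lval a) inj1_letter.
exact: (sym_mul_mono [:: slet a]).
Qed.

Lemma smexp_mono m w : smexp m (mono w) = hbarX (m - size w) (hconst (mono (map slet w))).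
Proof. by rewrite /smexp (mexp_mono sinj_linear sinj_hom) wprod_sinj. Qed.

End Suspension.

(* If [E] and [R] correspond to each other on products of [m] elements, in top weight,
   then they do so on the sum of the [S^i], [i <= m]. *)
Lemma hext_mexp_corr (k : fieldType) (U U' : gvect k) (A A' : gcalg k)
    (th : U -> A) (e : int) (th' : U' -> A') (e' : int)
    (E : A -> nat -> A') (R : Sym U -> nat -> Sym U') :
  linear th -> (forall p x, ghom p x -> ghom (p + (e + e)) (th x)) ->
  linear th' -> (forall p x, ghom p x -> ghom (p + (e' + e')) (th' x)) ->
  linear E -> linear R ->
  (forall w i, wle (size w) (R (mono w) i)) ->
  (forall w, E (wprod th w) = hext (mexp th' (size w)) (R (mono w))) ->
  forall m y, wle m y -> hext E (mexp th m y) = hext (mexp th' m) (R y).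
Proof.
move=> lth hth lth' hth' lE lR Rw ER m y.
have lM := mexp_linear lth hth; have lM' := mexp_linear lth' hth'.
elim=> [|c w x wm _ IH].
  by rewrite (lin_0 (lM _)) (lin_0 lR) (lin_0 (hext_linear lE)) (lin_0 (hext_linear (lM' _))).
rewrite lM lR (hext_linear lE) (hext_linear (lM' _)) IH; congr (_ *: _ + _).
rewrite (mexp_mono lth hth) (hext_hbarX _ _ lE) (hext_hconst _ lE) ER.
by rewrite -(hext_mexp_up lth' hth') ?subnK.
Qed.

Lemma pr_cogen_coder_sum (k : fieldType) (U : gvect k) (l : Sym U -> U) (w : word U) : linear l ->
  pr_cogen (coder_sum l (mono w)) = if (0 < size w)%N then l (mono w) else 0.
Proof.
move=> ll; rewrite coder_sum_mono // (sp_map _ _ (@pr_cogen_linear k U)).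
rewrite -(sp_right0 w (fun u _ => if (0 < size u)%N then l (mono u) else 0)).
apply: sp_ext => u v _ _; case: ifP => _; last first.
  by rewrite (lin_0 (@pr_cogen_linear k U)); case: v.
by rewrite pr_cogen_mul1 counit_mono; case: v => [|b v]; rewrite ?scale1r ?scale0r.
Qed.

Section LinfDecomposition.
Variables (k : fieldType) (g : linf k).
Hypothesis char0 : [pchar k] =i pred0.
Implicit Types (w u v : word (shift g 1)).

Lemma linf_D_linear : linear (@linf_D k g).
Proof. by case: (linf_coder g). Qed.

Definition linf_l (x : Sym (shift g 1)) : shift g 1 := pr_cogen (linf_D x).

Lemma linf_l_linear : linear linf_l.
Proof. exact: (linear_comp (@pr_cogen_linear k _) linf_D_linear). Qed.

Lemma linf_l_hom p x : sym_hom p x -> ghom (p + 1) (linf_l x).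
Proof. by move=> hx; apply: pr_cogen_hom; apply: linf_deg. Qed.

(* Two coderivations with the same projection to the cogenerators are equal. *)
Lemma linf_D_coder x : linf_D x = coder_sum linf_l x.
Proof.
have lD := linf_D_linear; have [_ DC] := linf_coder g.
have ll := linf_l_linear.
have lC := coder_sum_linear ll.
have [_ CC] : is_coderivation (coder_sum linf_l).
  apply: (@coder_sum_coder _ _ _ 0) => // p y hy.
  by rewrite mulr0 subr0; apply: linf_l_hom.
apply: (lin_ext lD lC) => w.
(* [coalg_unique] speaks of series, so the difference is taken as a constant one. *)
pose G w := hconst (linf_D (mono w) - coder_sum linf_l (mono w)).
suff /(congr1 (fun s => s 0%N)) : G w = 0.
  by rewrite /G /hconst /= => /eqP; rewrite subr_eq0 => /eqP.
apply: (coalg_unique char0 (G := G) (P := fun u => hconst (mono u))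
   (Q := fun u => hconst (parity (mono u)))) => [||u|u Hu].
- by [].
- by rewrite parity_mono wdeg_nil scale1r.
- apply: funext => n; rewrite sp_coef /hcomul.
  under sp_ext => x' y' _ _.
    rewrite -[_ n]/(hten (G x') (hconst (mono y')) n + hten (hconst (parity (mono x'))) (G y') n).
    rewrite hten1l hten1r; over.
  case: n => [|n]; last first.
    rewrite /G /hconst /= (lin_0 (@comul_linear k _)) sp_eq0 // => x' y' _ _.
    by rewrite (lin_0 (@tpure_linear_l k _ _ _)) (lin_0 (@tpure_linear_r k _ _ _)) addr0.
  rewrite /G /hconst /= (lin_B (@comul_linear k _)) DC CC !tens_der_comul //.
  rewrite -[X in _ - X]scale1r -scaleNr -spZ -spD; apply: sp_ext => x' y' _ _.
  rewrite (lin_B (@tpure_linear_l k _ _ _)) (lin_B (@tpure_linear_r k _ _ _)) scaleN1r opprD.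
  by rewrite addrACA.
have := Hu 0%N; rewrite /G /hconst /= => e; apply: funext => n; case: eqP => // _.
rewrite e (lin_B (@pr_cogen_linear k _)) (pr_cogen_coder_sum _ ll) -/(linf_l _).
case: u {Hu e} => [|a u] /=; last by rewrite subrr (lin_0 (@inj1_linear k _)).
by rewrite subr0 /linf_l -/(sym_one _) linf_one (lin_0 (@pr_cogen_linear k _)) (lin_0 (@inj1_linear k _)).
Qed.

Lemma wle_linf_D m (x : Sym (shift g 1)) : wle m x -> wle m (linf_D x).
Proof.
elim=> [|c w y wm _ IH]; first by rewrite (lin_0 linf_D_linear); apply: wle_nil.
rewrite linf_D_linear; apply: wleD => //; apply: wleZ.
rewrite linf_D_coder (coder_sum_mono _ linf_l_linear); apply: wle_sp => u v su.
case: ifP => [u0|_]; last exact: wle_nil.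
apply: (@wle_leq _ _ (1 + size v)); first by apply: leq_trans wm; rewrite -su leq_add2r.
by apply: wle_mul; [apply: wle_inj1|apply: wle_mono].
Qed.

Lemma linf_BV_linear : linear (linf_BV g).
Proof.
apply/hlinearP => j c x y; rewrite /linf_BV desusp2_linear.
by rewrite -[@linf_Dn _ _ _]/(coder j.+1 linf_l) (coder_linear _ linf_l_linear) susp2_linear.
Qed.

(* The operator [1/hbar sum hbar^n D_n] is [D] conjugated by [hbar^m] on [S^m]. *)
Lemma linf_BV_mono w : linf_BV g (mono (map (@slet k g) w)) = smexp (size w) (linf_D (mono w)).
Proof.
apply: funext => j; rewrite /linf_BV desusp2_mono (mapK (@sletK k g)).
rewrite -[linf_Dn _ _]/(coder j.+1 linf_l (mono w)) (coder_mono _ _ linf_l_linear) (sp_map _ _ (@susp2_linear k g)).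
rewrite linf_D_coder (coder_sum_mono _ linf_l_linear) (sp_map _ _ (@smexp_linear k g _)) sp_coef.
apply: sp_ext => u v su _; case: (posnP (size u)) => [->|u0] /=.
  by rewrite (lin_0 (@smexp_linear k g _)) (lin_0 (@susp2_linear k g)).
rewrite (inj1_hom (linf_l_hom (sym_hom_mono u))) sym_mul_mono /= smexp_mono -susp2_mono /=.
(* The output has weight [(size v).+1], so [smexp] multiplies it by hbar to the power [(size u).-1];
   the coefficient of hbar^j thus selects [size u = j.+1], the terms of [D_(j+1)]. *)
rewrite -su -[(size v).+1]add1n subnDr /hbarX /hconst subn1.
case: u {su} u0 => [//|a u] _ /=; rewrite eqSS; case: eqP => [->|nj].
  by rewrite leqnn subnn.
rewrite (lin_0 (@susp2_linear k g)); case: leqP => // uj; rewrite subn_eq0 leqNgt ltn_neqAle uj andbT.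
by case: eqP => // e; case: nj.
Qed.

End LinfDecomposition.

(** * The correspondence *)

(* The coalgebra morphism whose projection to the cogenerators is [hbar^(1-n) phi] on [S^n]. *)
Section CogenMorphism.
Variables (k : fieldType) (U1 U2 : gvect k) (t : U1 -> U2) (A : gcalg k).
Hypothesis char0 : [pchar k] =i pred0.
Hypotheses (lt : linear t) (ht : forall p x, ghom p x -> ghom (p + (1 + 1)) (t x)).
Variable phi : Sym U2 -> nat -> A.
Hypotheses (lphi : linear phi) (hphi : hdegree (A := symG U2) 0 phi).
Hypotheses (phi1 : phi (sym_one U2) = 0) (phi_dv : forall w, hbar_dvd (size w).-1 (phi (mono w))).
Implicit Types (w : word U1).

(** Reading the coefficients from [(size w).-1] on is division by hbar^(n-1), exact by [phi_dv]. The
    map [t] of degree two covers both uses: it is the identity of the underlying space, from V[1] to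
    V[-1] in [theta] and from V[2] to V in [chi_mor]. *)
Definition cogen_map : Sym U1 -> nat -> shift A 2 :=
  sym_lift (fun w => (fun j => phi (sym_map 2 t (mono w)) (j + (size w).-1)%N) : nat -> shift A 2).

Let smE w : sym_map 2 t (mono w) = mono (map (lmap 1 t) w).
Proof. exact: (@sym_map_mono _ _ _ 1). Qed.

Let sml : linear (sym_map 2 t).
Proof. exact: (@sym_map_linear _ _ _ 1). Qed.

Lemma cogen_map_rel : sym_rel (fun w =>
  (fun j => phi (sym_map 2 t (mono w)) (j + (size w).-1)%N) : nat -> shift A 2).
Proof.
apply: (rel_size (f := fun n w => (fun j => phi (sym_map 2 t (mono w)) (j + n.-1)%N) : nat -> shift A 2)).
move=> n; apply: (rel_mono (g := fun x => (fun j => phi (sym_map 2 t x) (j + n.-1)%N) : nat -> shift A 2)).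
by move=> c x y; apply: funext => j; rewrite sml lphi.
Qed.

Lemma cogen_map_linear : linear cogen_map.
Proof. exact: (sym_lift_linear cogen_map_rel). Qed.

Lemma cogen_map_mono w j :
  cogen_map (mono w) j = phi (mono (map (lmap 1 t) w)) (j + (size w).-1)%N.
Proof. by rewrite /cogen_map (sym_lift_mono w cogen_map_rel) smE. Qed.

Lemma hbarX_cogen_map w :
  hbarX (size w).-1 (cogen_map (mono w) : nat -> A) = phi (mono (map (lmap 1 t) w)).
Proof.
rewrite -[RHS](@hbarX_low k A (size w).-1) => [|j jw].
  by congr hbarX; apply: funext => j; apply: cogen_map_mono.
by apply: phi_dv; rewrite size_map.
Qed.

(** On n letters, [t] adds degree 2n, the division by hbar^(n-1) removes 2(n-1), and the shift of
    the target accounts for the remaining 2. *)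
Lemma cogen_map_hom w : hhom (wdeg w) (cogen_map (mono w)).
Proof.
move=> j; rewrite cogen_map_mono; case: w => [|a w].
  by rewrite -[mono _]/(sym_one U2) phi1; apply: ghom0.
suff : @ghom k A (2 + (wdeg (a :: w) - 2 * j%:Z))
   (phi (mono (map (lmap 1 t) (a :: w))) (j + (size (a :: w)).-1)%N) by [].
apply: (ghom_eq (mono_hdegree hphi (map (lmap 1 t) (a :: w)) _)).
by rewrite wdeg_lmap /= PoszD -[(size w).+1]addn1 PoszD; ring.
Qed.

Lemma cogen_map_one : cogen_map (sym_one U1) = 0.
Proof.
apply: funext => j; rewrite [LHS](cogen_map_mono [::]).
by rewrite -[mono _]/(sym_one U2) phi1.
Qed.

Definition cogen_mor : Sym U1 -> nat -> Sym (shift A 2) :=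
  bv_exp (A := symA (shift A 2)) (fun x i => inj1 (cogen_map x i)).

Lemma cogen_mor_coalg : coalg_mor cogen_mor.
Proof. by have [] := coalg_mor_exp char0 cogen_map_linear cogen_map_hom cogen_map_one. Qed.

Lemma cogen_mor_pr x n : pr_cogen (cogen_mor x n) = cogen_map x n.
Proof. by have [] := coalg_mor_exp char0 cogen_map_linear cogen_map_hom cogen_map_one. Qed.

Lemma cogen_morE w :
  cogen_mor (mono w) = wexp (fun w i => inj1 (cogen_map (mono w) i) : symA (shift A 2)) w.
Proof. by have [] := coalg_mor_exp char0 cogen_map_linear cogen_map_hom cogen_map_one. Qed.

Lemma wle_cogen_mor w i : wle (size w) (cogen_mor (mono w) i).
Proof. by rewrite cogen_morE; apply: wle_wexp => u j; apply: wle_inj1. Qed.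

Lemma wle_cogen_mor_gen m x : wle m x -> forall i, wle m (cogen_mor x i).
Proof.
have [lF _ _ _] := cogen_mor_coalg.
move=> hx i; elim: hx => [|c w y wm _ IH].
  by rewrite (lin_0 lF); apply: wle_nil.
rewrite lF; apply: wleD => //; apply: wleZ.
exact: (wle_leq wm (wle_cogen_mor w i)).
Qed.

Lemma exp_cogen_mor w :
  bv_exp phi (mono (map (lmap 1 t) w)) = hext (vmexp (size w)) (cogen_mor (mono w)).
Proof.
rewrite (bv_exp_mono char0) // cogen_morE /vmexp.
apply: (@wexp_mexp k char0 U1 U2 (shift A 2) A (fun x => x) 1 1 t
  (fun u => cogen_map (mono u)) (fun u => phi (mono u))).
- exact: idA_linear.
- exact: unshift2_hom.
- exact: cogen_map_hom.
- exact: mono_hdegree.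
by move=> a u; rewrite -(hbarX_cogen_map (a :: u)).
Qed.

End CogenMorphism.

Lemma hext_codiff (k : fieldType) (A : gcalg k) (B : bvinf A) m (s : nat -> Sym (shift A 2)) :
  (forall i, wle m (s i)) ->
  hext (vmexp m) (hext (bv_codiff B) s) = hext B (hext (vmexp m) s).
Proof.
move=> hs; rewrite hext_comp; last exact: vmexp_linear.
rewrite hext_comp; last exact: bv_linear.
by apply: hext_ext => i; apply: vmexp_codiff.
Qed.

(** The coefficient with index [n] is [phi_(n+1)], so the vanishing condition says that [phi] on m
    letters is divisible by hbar^(m-1). *)
Lemma bv_morP (k : fieldType) (U : gvect k) (A : gcalg k) (D : Sym U -> nat -> Sym U)
    (D' : A -> nat -> A) phi : is_bv_mor D D' phi <->
  [/\ linear phi, hdegree (A := symG U) 0 phi, phi (sym_one _) = 0,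
      forall w, hbar_dvd (size w).-1 (phi (mono w)) &
      forall x, hext (bv_exp phi) (D x) = hext D' (bv_exp phi x)].
Proof.
split=> [[[lphi hphi] phi1 H pdv]|[lphi hphi phi1 pdv H]]; split=> //.
- exact/hlinearP.
- by move=> w j jw; apply: pdv; rewrite -ltn_predRL.
- by split=> //; apply/hlinearP.
by move=> n w nw; apply: pdv; rewrite ltn_predRL.
Qed.

Section Correspondence.
Variables (k : fieldType) (g : linf k) (A : gcalg k) (B : bvinf A).
Hypothesis char0 : [pchar k] =i pred0.

Definition hlinf_D : Sym (shift g 1) -> nat -> Sym (shift g 1) := fun x => hconst (linf_D x).

Lemma hlinf_D_linear : linear hlinf_D.
Proof. by move=> c x y; rewrite /hlinf_D (@linf_D_linear k g) (@hconst_linear k _). Qed.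

Lemma hlinf_D_coder j : is_coderivation (hlinf_D ^~ j).
Proof.
case: j => [|j]; first exact: linf_coder.
split=> [c x y|x]; first by rewrite /hlinf_D /hconst /= scaler0 addr0.
rewrite /hlinf_D /hconst /= (lin_0 (@comul_linear k _)).
have T a b : tpure (0 : Sym (shift g 1)) b + tpure (parity a) (0 : Sym (shift g 1)) = 0.
  by rewrite (lin_0 (@tpure_linear_l k _ _ _)) (lin_0 (@tpure_linear_r k _ _ _)) addr0.
apply/esym/(tens_lin_ext (g := fun _ => 0)) => [|c y z|a b].
- by apply: tens_lift_linear => [b|a] c y z; rewrite !T scaler0 addr0.
- by rewrite scaler0 addr0.
by rewrite /tens_der tens_lift_pure // => [b'|a'] c y z; rewrite !T scaler0 addr0.
Qed.

Definition theta (phi : Sym (shift g (-1)) -> nat -> A) : Sym (shift g 1) -> nat -> Sym (shift A 2) :=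
  @cogen_mor k (shift g 1) (shift g (-1)) (fun x => x) A phi.

Section Forward.
Variable phi : Sym (shift g (-1)) -> nat -> A.
Hypotheses (lphi : linear phi) (hphi : hdegree (A := symG (shift g (-1))) 0 phi).
Hypotheses (phi1 : phi (sym_one _) = 0) (phi_dv : forall w, hbar_dvd (size w).-1 (phi (mono w))).

Lemma idS_linear : linear (fun x : shift g 1 => x : shift g (-1)).
Proof. by []. Qed.

Lemma theta_coalg : coalg_mor (theta phi).
Proof. exact: (cogen_mor_coalg char0 idS_linear (@susp_hom k g)). Qed.

Lemma exp_theta w : bv_exp phi (mono (map (@slet k g) w)) = hext (vmexp (size w)) (theta phi (mono w)).
Proof. exact: (exp_cogen_mor char0 idS_linear (@susp_hom k g)). Qed.

Lemma wle_theta w i : wle (size w) (theta phi (mono w) i).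
Proof. exact: (wle_cogen_mor char0 idS_linear (@susp_hom k g)). Qed.

Lemma theta_smexp m y : wle m y ->
  hext (bv_exp phi) (smexp m y) = hext (vmexp m) (theta phi y).
Proof.
have [lF _ _ _] := theta_coalg.
apply: (hext_mexp_corr (@sinj_linear k g) (@sinj_hom k g) (@idA_linear k A) (@unshift2_hom k A)).
- exact: bv_exp_linear.
- exact: lF.
- exact: wle_theta.
by move=> w; rewrite wprod_sinj exp_theta.
Qed.

(** Together with [bv_exp_codiff], this presents both sides of the BV-infinity equation as images
    under [vmexp] of the two sides of the L-infinity equation. *)
Lemma exp_linf_BV w :
  hext (bv_exp phi) (linf_BV g (mono (map (@slet k g) w))) =
  hext (vmexp (size w)) (hext (theta phi) (hlinf_D (mono w))).
Proof.
have [lF _ _ _] := theta_coalg.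
rewrite (linf_BV_mono char0) theta_smexp ?hext_hconst //.
by apply: wle_linf_D => //; apply: wle_mono.
Qed.

Lemma bv_exp_codiff w :
  hext B (bv_exp phi (mono (map (@slet k g) w))) =
  hext (vmexp (size w)) (hext (bv_codiff B) (theta phi (mono w))).
Proof. by rewrite exp_theta hext_codiff // => i; apply: wle_theta. Qed.

Lemma theta_commute :
  (forall x, hext (bv_exp phi) (linf_BV g x) = hext B (bv_exp phi x)) ->
  is_hlinf_mor hlinf_D (bv_codiff B) (theta phi).
Proof.
move=> H; apply/(hlinf_morP char0); split; first exact: theta_coalg.
apply: (codiff_commute char0 hlinf_D_linear hlinf_D_coder _ theta_coalg).
  by rewrite /hlinf_D linf_one (lin_0 (@hconst_linear k _)).
by move=> w; rewrite -exp_linf_BV -bv_exp_codiff H.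
Qed.

Lemma commute_theta :
  (forall x, hext (theta phi) (hlinf_D x) = hext (bv_codiff B) (theta phi x)) ->
  forall x, hext (bv_exp phi) (linf_BV g x) = hext B (bv_exp phi x).
Proof.
move=> H; have lE := bv_exp_linear char0 lphi.
apply: lin_ext => [||w].
- exact: (linear_comp (hext_linear lE) (@linf_BV_linear k g)).
- exact: (linear_comp (hext_linear (@bv_linear k A B)) lE).
have [w' ->] := word_slet w.
by rewrite exp_linf_BV bv_exp_codiff H.
Qed.

End Forward.

Section Backward.
Variable F : Sym (shift g 1) -> nat -> Sym (shift A 2).
Hypothesis cF : coalg_mor F.

Definition theta_inv_word (w : word (shift g (-1))) : nat -> A :=
  hbarX (size w).-1 (fun i => pr_cogen (F (desusp2 (mono w)) i)).
Definition theta_inv : Sym (shift g (-1)) -> nat -> A := sym_lift theta_inv_word.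

Lemma theta_inv_rel : sym_rel theta_inv_word.
Proof.
have [lF _ _ _] := cF.
apply: (rel_size (f := fun n w => hbarX n.-1
   ((fun i => pr_cogen (F (desusp2 (mono w)) i)) : nat -> A))) => n.
apply: (rel_mono (g := fun x => hbarX n.-1 ((fun i => pr_cogen (F (desusp2 x) i)) : nat -> A))).
apply: (linear_comp (@hbarX_linear k A _)) => c x y; apply: funext => i.
rewrite desusp2_linear lF; exact: (@pr_cogen_linear k (shift A 2) c).
Qed.

Lemma theta_inv_linear : linear theta_inv.
Proof. exact: (sym_lift_linear theta_inv_rel). Qed.

Lemma theta_inv_mono w : theta_inv (mono (map (@slet k g) w)) =
  hbarX (size w).-1 ((fun i => pr_cogen (F (mono w) i)) : nat -> A).
Proof.
by rewrite /theta_inv (sym_lift_mono _ theta_inv_rel) /theta_inv_word size_map desusp2_mono (mapK (@sletK k g)).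
Qed.

Lemma theta_inv_one : theta_inv (sym_one _) = 0.
Proof.
have [_ _ _ F1] := cF; rewrite [LHS](theta_inv_mono [::]) hbarX0; apply: funext => i.
rewrite -/(sym_one (shift g 1)) F1 /hconst.
case: eqP => _; first exact: (@pr_cogen_mono k (shift A 2) [::]).
exact: (lin_0 (@pr_cogen_linear k (shift A 2))).
Qed.

Lemma theta_inv_dvd w : hbar_dvd (size w).-1 (theta_inv (mono w)).
Proof.
move=> j jw; rewrite /theta_inv (sym_lift_mono _ theta_inv_rel) /theta_inv_word /hbarX.
by rewrite leqNgt jw.
Qed.

Lemma theta_inv_hom : hdegree (A := symG (shift g (-1))) 0 theta_inv.
Proof.
have [_ hF _ _] := cF; apply: (hdegree_mono theta_inv_linear) => w.
have [[|a w'] ->] := word_slet w.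
  by rewrite -[mono _]/(sym_one (shift g (-1))) theta_inv_one; apply: hhom0.
move=> j; rewrite theta_inv_mono /hbarX; case: leqP => [wj|_]; last exact: ghom0.
set w1 := a :: w'; set i := (j - _)%N.
have h : @ghom k A (2 + (wdeg w1 - 2 * i%:Z)) (pr_cogen (F (mono w1) i)).
  exact: (pr_cogen_hom (hF w1 i)).
apply: (ghom_eq h); rewrite wdeg_lmap.
have -> : j = (i + size w')%N by rewrite subnK.
by rewrite /w1 /= PoszD -[(size w').+1]addn1 PoszD; ring.
Qed.

(** Coalgebra maps are determined by their projections, and there multiplication and division by
    hbar^(n-1) cancel. *)
Lemma theta_invK : theta theta_inv = F.
Proof.
apply: funext; have [lF _ _ _] := cF.
have cT : coalg_mor (theta theta_inv) by apply: theta_coalg; [apply: theta_inv_linear|apply: theta_inv_hom|apply: theta_inv_one].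
have [lT _ _ _] := cT.
apply: lin_ext => // w.
rewrite [LHS](coalg_mor_wexp char0 cT) [RHS](coalg_mor_wexp char0 cF).
apply: (congr1 (fun f => @wexp k (shift g 1) (symA (shift A 2)) f w)).
apply: funext => u; apply: funext => i; congr inj1.
have E := cogen_mor_pr char0 idS_linear (@susp_hom k g) theta_inv_linear theta_inv_hom theta_inv_one.
have E' := cogen_map_mono idS_linear (@susp_hom k g) theta_inv_linear.
rewrite [LHS]E [LHS]E' theta_inv_mono.
by rewrite /hbarX leq_addl addnK.
Qed.

Lemma theta_inv_bv_mor :
  (forall x, hext F (hlinf_D x) = hext (bv_codiff B) (F x)) ->
  is_bv_mor (linf_BV g) B theta_inv.
Proof.
move=> FD; apply/bv_morP; split.
- exact: theta_inv_linear.
- exact: theta_inv_hom.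
- exact: theta_inv_one.
- exact: theta_inv_dvd.
apply: commute_theta; [exact: theta_inv_linear|exact: theta_inv_hom|exact: theta_inv_one|exact: theta_inv_dvd|].
by rewrite theta_invK.
Qed.

End Backward.

Lemma theta_pr phi (lphi : linear phi) (hphi : hdegree (A := symG (shift g (-1))) 0 phi) :
  phi (sym_one _) = 0 -> (forall w, hbar_dvd (size w).-1 (phi (mono w))) ->
  forall w, hbarX (size w).-1 ((fun j => pr_cogen (theta phi (mono w) j)) : nat -> A) =
    phi (mono (map (@slet k g) w)).
Proof.
move=> phi1 pdv w.
rewrite -(hbarX_cogen_map idS_linear (@susp_hom k g) lphi pdv); congr hbarX.
by apply: funext => j; apply: (cogen_mor_pr char0 idS_linear (@susp_hom k g)).
Qed.

Lemma thetaK phi (lphi : linear phi) (hphi : hdegree (A := symG (shift g (-1))) 0 phi) :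
  phi (sym_one _) = 0 -> (forall w, hbar_dvd (size w).-1 (phi (mono w))) ->
  theta_inv (theta phi) = phi.
Proof.
move=> phi1 pdv; have cT := theta_coalg lphi hphi phi1.
apply: funext; apply: lin_ext => // [|w]; first exact: theta_inv_linear.
by have [w' ->] := word_slet w; rewrite theta_inv_mono // theta_pr.
Qed.

End Correspondence.

(** * Naturality *)

Section NaturalitySource.
Variables (k : fieldType) (g' g : linf k).
Hypothesis char0 : [pchar k] =i pred0.
Variable F : Sym (shift g' 1) -> Sym (shift g 1).
Hypothesis morF : is_linf_mor F.

Let lF : linear F. Proof. by case: morF => -[]. Qed.

Definition linf_series (x : Sym (shift g' 1)) : nat -> Sym (shift g 1) := hconst (F x).

Lemma linf_series_linear : linear linf_series.
Proof. by move=> c x y; rewrite /linf_series lF (@hconst_linear k _). Qed.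

Lemma linf_series_coalg : coalg_mor linf_series.
Proof.
have [[_ dF] FC _ F1 _] := morF; split.
- exact: linf_series_linear.
- by move=> w; apply: (@hconst_hom k (symG _)); apply: dF; apply: sym_hom_mono.
- move=> w; apply: funext => n; rewrite sp_coef.
  under sp_ext => u v _ _ do rewrite hten1l.
  rewrite /hcomul /linf_series /hconst; case: eqP => _.
    rewrite FC comul_lift // => [b|a] c x y; rewrite lF.
      by rewrite (@tpure_linear_l k).
    by rewrite (@tpure_linear_r k).
  rewrite (lin_0 (@comul_linear k _)) sp_eq0 // => u v _ _.
  exact: (lin_0 (@tpure_linear_r k _ _ _)).
by rewrite /linf_series F1.
Qed.

Lemma linf_series_mor : is_hlinf_mor (@hlinf_D k g') (@hlinf_D k g) linf_series.
Proof.
apply/(hlinf_morP char0); split=> [|x]; first exact: linf_series_coalg.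
rewrite /hlinf_D hext_hconst; last exact: linf_series_linear.
rewrite [RHS]hext_hconst; last exact: hlinf_D_linear.
by rewrite /linf_series; have [_ _ _ _ ->] := morF.
Qed.

Lemma linf_series_mono w : linf_series (mono w) = wexp (fun u i => inj1 (pr_cogen (linf_series (mono u) i)) : symA (shift g 1)) w.
Proof. exact: (coalg_mor_wexp char0 linf_series_coalg). Qed.

Lemma bv_of_linf_rel j : sym_rel (fun w : word (shift g' (-1)) =>
  if size w == j.+1 then @inj1 k (shift g (-1)) (pr_cogen (F (desusp2 (mono w)))) else 0).
Proof.
apply: (rel_if (pred1 j.+1)).
apply: (rel_mono (g := fun x => @inj1 k (shift g (-1)) (pr_cogen (F (desusp2 x))))) => c x y.
rewrite desusp2_linear lF (@pr_cogen_linear k (shift g 1)).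
exact: (@inj1_linear k (shift g (-1)) c).
Qed.

Lemma bv_of_linf_linear : linear (bv_of_linf F).
Proof. apply/hlinearP => j; exact: (sym_lift_linear (bv_of_linf_rel j)). Qed.

Lemma bv_of_linf_mono w : bv_of_linf F (mono (map (@slet k g') w)) =
  hbarX (size w).-1 (fun i => sinj (pr_cogen (linf_series (mono w) i))).
Proof.
apply: funext => j; rewrite /bv_of_linf (sym_lift_mono _ (bv_of_linf_rel j)).
rewrite size_map desusp2_mono (mapK (@sletK k g')) /hbarX.
have s0 : @sinj k g (pr_cogen (0 : Sym (shift g 1))) = 0.
  by rewrite (lin_0 (@pr_cogen_linear k _)); apply: (lin_0 (@sinj_linear k g)).
case: w => [|a w] /=.
  have [_ _ _ F1 _] := morF; rewrite ?leq0n ?subn0 /linf_series -/(sym_one _) F1 /hconst.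
  case: eqP => // _; rewrite (pr_cogen_mono [::]).
  exact: esym (lin_0 (@sinj_linear k g)).
rewrite eqSS; case: eqP => [->|nj]; first by rewrite leqnn subnn.
case: leqP => // wj; rewrite /linf_series /hconst subn_eq0 leqNgt ltn_neqAle wj andbT.
by case: eqP => [e|_] /=; [case: nj|rewrite s0].
Qed.

Lemma bv_of_linf_hom : hdegree (A := symG (shift g' (-1))) (B := symG (shift g (-1))) 0 (bv_of_linf F).
Proof.
have [_ hH _ _] := linf_series_coalg; apply: (hdegree_mono (W := symG (shift g (-1))) bv_of_linf_linear) => w.
have [[|a w'] ->] := word_slet w.
  move=> j; rewrite /bv_of_linf (sym_lift_mono _ (bv_of_linf_rel j)) /=.
  exact: (ghom0 (symG (shift g (-1)))).
move=> j; rewrite bv_of_linf_mono /hbarX; case: leqP => [wj|_]; last exact: (ghom0 (symG (shift g (-1)))).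
set w1 := a :: w'; set i := (j - _)%N.
have h := sinj_hom (pr_cogen_hom (hH w1 i)).
apply: (ghom_eq h); rewrite wdeg_lmap.
have -> : j = (i + size w')%N by rewrite subnK.
by rewrite /w1 /= PoszD -[(size w').+1]addn1 PoszD; ring.
Qed.

Lemma bv_of_linf_one : bv_of_linf F (sym_one _) = 0.
Proof. by apply: funext => j; rewrite /bv_of_linf (sym_lift_mono _ (bv_of_linf_rel j)). Qed.

(** [F] and [bv_exp (bv_of_linf F)] are exponentials of corresponding maps, so [wexp_mexp] applies
    with [sinj] as the map of generators. *)
Lemma exp_bv_of_linf w :
  bv_exp (A := symA (shift g (-1))) (bv_of_linf F) (mono (map (@slet k g') w)) = smexp (size w) (F (mono w)).
Proof.
rewrite (bv_exp_mono (A := symA (shift g (-1))) char0 _ bv_of_linf_linear).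
have [_ hH _ _] := linf_series_coalg.
have H := @wexp_mexp k char0 (shift g' 1) (shift g' (-1)) (shift g 1) (symA (shift g (-1)))
  (@sinj k g) 1 1 (fun x => x) (fun u i => pr_cogen (linf_series (mono u) i))
  (fun u => bv_of_linf F (mono u)).
rewrite [LHS]H.
- rewrite -linf_series_mono /linf_series [LHS]hext_hconst //; exact: smexp_linear.
- exact: sinj_linear.
- exact: sinj_hom.
- by move=> u i; apply: pr_cogen_hom; apply: hH.
- exact: (mono_hdegree (W := symG (shift g (-1))) bv_of_linf_hom).
by move=> a u; apply: (bv_of_linf_mono (a :: u)).
Qed.

Lemma exp_bv_of_linf_smexp m y : wle m y ->
  hext (bv_exp (A := symA (shift g (-1))) (bv_of_linf F)) (smexp m y) = smexp m (F y).
Proof.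
move=> my; rewrite -[RHS](hext_hconst (F y) (@smexp_linear k g m)).
have H := @hext_mexp_corr k (shift g' 1) (shift g 1) (symA (shift g' (-1))) (symA (shift g (-1)))
  (@sinj k g') 1 (@sinj k g) 1 (bv_exp (A := symA (shift g (-1))) (bv_of_linf F)) linf_series.
apply: H => //.
- exact: sinj_linear.
- exact: sinj_hom.
- exact: sinj_linear.
- exact: sinj_hom.
- exact: (bv_exp_linear (A := symA (shift g (-1))) char0 bv_of_linf_linear).
- exact: linf_series_linear.
- by move=> w i; rewrite linf_series_mono; apply: wle_wexp => u j; apply: wle_inj1.
move=> w; rewrite wprod_sinj exp_bv_of_linf [RHS]hext_hconst //; exact: smexp_linear.
Qed.

Lemma linf_BV_smexp m y : wle m y ->
  hext (linf_BV g) (smexp m y) = smexp m (linf_D y).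
Proof.
move=> my; rewrite -[RHS](hext_hconst (linf_D y) (@smexp_linear k g m)).
have H := @hext_mexp_corr k (shift g 1) (shift g 1) (symA (shift g (-1))) (symA (shift g (-1)))
  (@sinj k g) 1 (@sinj k g) 1 (linf_BV g) (@hlinf_D k g).
apply: H => //.
- exact: sinj_linear.
- exact: sinj_hom.
- exact: sinj_linear.
- exact: sinj_hom.
- exact: linf_BV_linear.
- exact: hlinf_D_linear.
- move=> w i; rewrite /hlinf_D /hconst; case: eqP => _; last exact: wle_nil.
  by apply: wle_linf_D => //; apply: wle_mono.
move=> w; rewrite wprod_sinj (linf_BV_mono char0) [RHS]hext_hconst //; exact: smexp_linear.
Qed.

Lemma wle_linf_mor w : wle (size w) (F (mono w)).
Proof.
have := @wle_wexp k (shift g 1) (shift g' 1) (fun u i => inj1 (pr_cogen (linf_series (mono u) i))) w _ 0%N.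
by rewrite -linf_series_mono; apply => u j; apply: wle_inj1.
Qed.

(** On S^n the two sides are [smexp n] of [F D] and of [D F]. *)
Lemma bv_of_linf_mor : is_bv_mor (A := symA (shift g (-1))) (linf_BV g') (linf_BV g) (bv_of_linf F).
Proof.
have lE := bv_exp_linear (A := symA (shift g (-1))) char0 bv_of_linf_linear.
apply/bv_morP; split.
- exact: bv_of_linf_linear.
- exact: bv_of_linf_hom.
- exact: bv_of_linf_one.
- move=> w; have [w' ->] := word_slet w; rewrite bv_of_linf_mono size_map => j jw.
  by rewrite /hbarX leqNgt jw.
apply: lin_ext => [||w].
- exact: (linear_comp (hext_linear lE) (@linf_BV_linear k g')).
- exact: (linear_comp (hext_linear (@linf_BV_linear k g)) lE).
have [w' ->] := word_slet w.
rewrite (linf_BV_mono char0) exp_bv_of_linf exp_bv_of_linf_smexp; last first.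
  by apply: wle_linf_D => //; apply: wle_mono.
rewrite linf_BV_smexp; last exact: wle_linf_mor.
by have [_ _ _ _ ->] := morF.
Qed.

End NaturalitySource.

Section NaturalityTarget.
Variables (k : fieldType) (U : gvect k) (B : bvinf (symA U)) (A : gcalg k) (B' : bvinf A).
Hypothesis char0 : [pchar k] =i pred0.
Variable chi : Sym U -> nat -> A.
Hypotheses (lchi : linear chi) (hchi : hdegree (A := symG U) 0 chi).
Hypotheses (chi1 : chi (sym_one U) = 0) (chi_dv : forall w, hbar_dvd (size w).-1 (chi (mono w))).
Hypothesis chiB : forall x, hext (bv_exp chi) (B x) = hext B' (bv_exp chi x).

Let Phi := bv_exp chi.

Let lPhi : linear Phi. Proof. exact: bv_exp_linear. Qed.

Let PhiE w : Phi (mono w) = wexp (fun u => chi (mono u)) w.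
Proof. exact: bv_exp_mono. Qed.

Let hPhi : hdegree (A := symG U) 0 Phi.
Proof.
apply: (hdegree_mono lPhi) => w; rewrite PhiE.
by apply: wexp_hom; apply: mono_hdegree.
Qed.

Let hc := mono_hdegree hchi.

Lemma bv_p1_linear : linear (@bv_p1 k (symA U)).
Proof. by move=> c x y; rewrite /bv_p1 pr_cogen_linear (@hconst_linear k _). Qed.

Lemma bv_p1_hom (w : word (symA U)) : hhom (wdeg w) (bv_p1 (mono w)).
Proof. by apply: hconst_hom; apply: pr_cogen_hom; apply: sym_hom_mono. Qed.

(** As [bv_p1] vanishes except on single letters, [wexp_cons] keeps only the splitting with [u]
    empty, which is the recursion of the product. *)
Lemma exp_bv_p1 (w : word (symA U)) :
  bv_exp (A := symA U) (@bv_p1 k (symA U)) (mono w) = hconst (wprod (fun x : symA U => x) w).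
Proof.
rewrite (bv_exp_mono (A := symA U) char0 _ bv_p1_linear).
apply: (wexp_unique char0 (Phi := fun w => hconst (wprod (fun x : symA U => x) w))) => //.
  exact: bv_p1_hom.
move=> a v; rewrite /= -(hmul_hconst (A := symA U)).
rewrite -[LHS](sp_left0 v (fun u v => hmul (A := symA U) (hconst (lval a))
  (hconst (wprod (fun x : symA U => x) v)))).
apply: sp_ext => -[|b u] x _ _; rewrite /bv_p1 pr_cogen_mono //.
by rewrite (lin_0 (@hconst_linear k _)) hmul0l.
Qed.

Definition chi_p1 : Sym (symA U) -> nat -> A := bv_comp chi (@bv_p1 k (symA U)).

Lemma chi_p1_mono w : chi_p1 (mono w) = cumulant Phi w.
Proof.
have lE := bv_exp_linear (A := symA U) char0 bv_p1_linear.
rewrite /chi_p1 /bv_comp (bv_log_mono char0); last exact: (linear_comp (hext_linear lPhi) lE).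
rewrite /cumulant /wlog; apply: eq_bigr => r _; congr (_ *: _).
apply: (congr1 (fun f => @cpow k (symA U) A r f w)); apply: funext => u.
by rewrite exp_bv_p1 hext_hconst.
Qed.

Lemma chi_p1_linear : linear chi_p1.
Proof.
apply: bv_log_linear => //.
exact: (linear_comp (hext_linear lPhi) (bv_exp_linear (A := symA U) char0 bv_p1_linear)).
Qed.

Lemma chi_p1_hom : hdegree (A := symG (symA U)) 0 chi_p1.
Proof.
by apply: (hdegree_mono chi_p1_linear) => w; rewrite chi_p1_mono; apply: cumulant_hom.
Qed.

Lemma chi_p1_one : chi_p1 (sym_one _) = 0.
Proof. by rewrite [LHS](chi_p1_mono [::]) /cumulant /wlog big_geq. Qed.

(** This lets [chi_mor] divide by hbar^(n-1) without leaving power series. *)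
Lemma chi_p1_dv w : hbar_dvd (size w).-1 (chi_p1 (mono w)).
Proof. by rewrite chi_p1_mono; apply: (cumulant_dv char0 lPhi hPhi hc chi1 PhiE chi_dv). Qed.

Lemma exp_chi_p1 w : bv_exp chi_p1 (mono w) = Phi (wprod (fun x : symA U => x) w).
Proof.
rewrite (bv_exp_mono char0 _ chi_p1_linear) -[RHS](wexp_cumulant char0 hPhi PhiE).
apply: (congr1 (fun f => @wexp k (symA U) A f w)); apply: funext => u.
exact: chi_p1_mono.
Qed.

Definition chi_mor : Sym (shift (symA U) 2) -> nat -> Sym (shift A 2) :=
  @cogen_mor k (shift (symA U) 2) (symA U) (fun x => x) A chi_p1.

Lemma chi_mor_coalg : coalg_mor chi_mor.
Proof.
exact: (cogen_mor_coalg char0 (@idA_linear k (symA U)) (@unshift2_hom k (symA U))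
  chi_p1_linear chi_p1_hom chi_p1_one).
Qed.

Lemma wle_chi_mor m x : wle m x -> forall i, wle m (chi_mor x i).
Proof.
exact: (wle_cogen_mor_gen char0 (@idA_linear k (symA U)) (@unshift2_hom k (symA U))
  chi_p1_linear chi_p1_hom chi_p1_one).
Qed.

Lemma chi_mor_pr w :
  hbarX (size w).-1 ((fun j => pr_cogen (chi_mor (mono w) j)) : nat -> A) =
  chi_p1 (unshift2 (mono w)).
Proof.
rewrite unshift2_mono.
rewrite -(hbarX_cogen_map (@idA_linear k (symA U)) (@unshift2_hom k (symA U)) chi_p1_linear chi_p1_dv).
congr hbarX; apply: funext => j.
exact: (cogen_mor_pr char0 (@idA_linear k (symA U)) (@unshift2_hom k (symA U))
  chi_p1_linear chi_p1_hom chi_p1_one).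
Qed.

Lemma chi_mor_vmexp m y : wle m y ->
  hext Phi (vmexp (A := symA U) m y) = hext (vmexp m) (chi_mor y).
Proof.
have [lX _ _ _] := chi_mor_coalg.
apply: (hext_mexp_corr (@idA_linear k (symA U)) (@unshift2_hom k (symA U))
  (@idA_linear k A) (@unshift2_hom k A)) => //.
  by move=> w; apply: wle_chi_mor; apply: wle_mono.
move=> w; rewrite wprod_ulet -exp_chi_p1.
exact: (exp_cogen_mor char0 (@idA_linear k (symA U)) (@unshift2_hom k (symA U))
  chi_p1_linear chi_p1_hom chi_p1_one chi_p1_dv).
Qed.

Lemma chi_mor_vmexp_series m s : (forall i, wle m (s i)) ->
  hext (vmexp m) (hext chi_mor s) = hext Phi (hext (vmexp (A := symA U) m) s).
Proof.
move=> ms; rewrite hext_comp; last exact: vmexp_linear.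
transitivity (hext (fun x => hext Phi (vmexp (A := symA U) m x)) s).
  by apply: hext_ext => i; rewrite chi_mor_vmexp.
exact: esym (hext_comp _ _ lPhi).
Qed.

(** With X for [chi_mor] and E, E' for the multiplications of source and target: E' X D = Phi E D =
    Phi Delta E = Delta' Phi E = Delta' E' X = E' D' X. *)
Lemma chi_mor_mor : is_hlinf_mor (bv_codiff B) (bv_codiff B') chi_mor.
Proof.
apply/(hlinf_morP char0); split; first exact: chi_mor_coalg.
apply: (codiff_commute char0 (@bv_codiff_linear k _ B) (bv_codiff_coder B) _ chi_mor_coalg).
  exact: (bv_codiff_mono B [::]).
move=> w; have mw : wle (size w) (mono w) by apply: wle_mono.
rewrite chi_mor_vmexp_series; last exact: wle_bv_codiff.
rewrite hext_codiff; last exact: wle_chi_mor.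
rewrite vmexp_codiff // -chi_mor_vmexp //.
transitivity (hext (fun x => hext Phi (B x)) (vmexp (A := symA U) (size w) (mono w))).
  exact: (hext_comp _ _ lPhi).
rewrite [RHS]hext_comp; last exact: bv_linear.
by apply: hext_ext => i; apply: chiB.
Qed.

End NaturalityTarget.

Section Composites.
Variables (k : fieldType).
Hypothesis char0 : [pchar k] =i pred0.

Lemma theta_mor (g : linf k) (A : gcalg k) (B : bvinf A) phi :
  is_bv_mor (linf_BV g) B phi -> is_hlinf_mor (@hlinf_D k g) (bv_codiff B) (theta phi).
Proof.
move=> /bv_morP[lphi hphi phi1 pdv H].
exact: (theta_commute char0 lphi hphi phi1 pdv H).
Qed.

Lemma theta_inv_mor (g : linf k) (A : gcalg k) (B : bvinf A) F :
  is_hlinf_mor (@hlinf_D k g) (bv_codiff B) F -> is_bv_mor (linf_BV g) B (theta_inv F).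
Proof. by move=> /(hlinf_morP char0)[cF FD]; apply: theta_inv_bv_mor. Qed.

Lemma theta_invK_mor (g : linf k) (A : gcalg k) (B : bvinf A) (F : Sym (shift g 1) -> _) :
  is_hlinf_mor (@hlinf_D k g) (bv_codiff B) F -> theta (theta_inv F) = F.
Proof. by move=> /(hlinf_morP char0)[cF FD]; apply: theta_invK. Qed.

(** Both naturality statements reduce to this: [theta_inv F] is the logarithm of its exponential,
    and the hypothesis identifies that exponential with the composite one. *)
Lemma theta_inv_comp (g : linf k) (U' : gvect k) (A : gcalg k) (B : bvinf A) F
    (psi : Sym U' -> nat -> A) (phi : Sym (shift g (-1)) -> nat -> symA U') :
  is_hlinf_mor (@hlinf_D k g) (bv_codiff B) F ->
  linear psi -> linear phi ->
  (forall w, hext (bv_exp psi) (bv_exp phi (mono (map (@slet k g) w))) =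
     hext (vmexp (size w)) (F (mono w))) ->
  theta_inv F = bv_comp psi phi.
Proof.
move=> mF lpsi lphi H; have /bv_morP[lP hP P1 Pdv _] := theta_inv_mor mF.
rewrite -[LHS](bv_log_exp char0 lP hP P1) /bv_comp; congr bv_log.
apply: funext; apply: lin_ext => [||w].
- exact: bv_exp_linear.
- exact: (linear_comp (hext_linear (bv_exp_linear char0 lpsi)) (bv_exp_linear (A := symA U') char0 lphi)).
have [w' ->] := word_slet w.
by rewrite H (exp_theta char0 lP hP P1 Pdv) (theta_invK_mor mF).
Qed.

End Composites.

Lemma sval_inj (T : Type) (P : T -> Prop) (x y : {x : T | P x}) : sval x = sval y -> x = y.
Proof.
case: x y => [x px] [y py] /= e; move: px py; rewrite e => px py.
by congr exist; apply: Prop_irrelevance.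
Qed.

Theorem theorem5p1 (k : fieldType) (char0 : [pchar k] =i pred0) :
  exists Theta : forall (g : linf k) (A : gcalg k) (B : bvinf A),
      bv_hom (linf_BV g) B ->
      hlinf_hom (fun x => hconst (linf_D x) : nat -> Sym (shift g 1)) (bv_codiff B),
  [/\ (* bijection *)
      forall (g : linf k) (A : gcalg k) (B : bvinf A), bijective (@Theta g A B),
      (* the projection of Theta phi to cogenerators is hbar^(1-n) phi on S^n *)
      forall (g : linf k) (A : gcalg k) (B : bvinf A) (phi : bv_hom (linf_BV g) B)
             (w : word (shift g 1)),
        hbarX (size w).-1 (fun j => pr_cogen (sval (@Theta g A B phi) (mono w) j) : A) =
        sval phi (susp2 (mono w)),
      (* naturality in g *)
      forall (g' g : linf k) (A : gcalg k) (B : bvinf A)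
             (F : linf_hom g' g) (phi : bv_hom (linf_BV g) B),
        exists (Fbv : bv_hom (A := symA (shift g (-1)))
                        (linf_BV g') (linf_BV g))
               (phiF : bv_hom (linf_BV g') B),
          [/\ sval Fbv = bv_of_linf (sval F),
              sval phiF = bv_comp (sval phi) (sval Fbv) &
              sval (@Theta g' A B phiF) =
              fun x => sval (@Theta g A B phi) (sval F x)]
    & (* naturality in V *)
      forall (g : linf k) (U : gvect k) (B : bvinf (symA U))
             (A' : gcalg k) (B' : bvinf A')
             (chi : bv_hom B B') (phi : bv_hom (linf_BV g) B),
        exists (chiphi : bv_hom (linf_BV g) B')
               (X : hlinf_hom (bv_codiff B) (bv_codiff B')),
          [/\ sval chiphi = bv_comp (sval chi) (sval phi),
              forall w : word (shift (symA U) 2),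
                hbarX (size w).-1 (fun j => pr_cogen (sval X (mono w) j) : A') =
                bv_comp (sval chi) (@bv_p1 k (symA U)) (unshift2 (mono w)) &
              sval (@Theta g A' B' chiphi) =
              fun x => hext (sval X) (sval (@Theta g (symA U) B phi) x)]].
Proof.
exists (fun g A B phi => exist _ (theta (sval phi)) (theta_mor char0 (svalP phi))).
split=> [g A B|g A B phi w|g' g A B F phi|g U B A' B' chi phi].
- exists (fun F => exist _ (theta_inv (sval F)) (theta_inv_mor char0 (svalP F))).
    move=> phi; apply: sval_inj => /=.
    by have /bv_morP[lphi hphi phi1 pdv _] := (svalP phi); apply: thetaK.
  by move=> F; apply: sval_inj; apply: (theta_invK_mor char0 (svalP F)).
- have /bv_morP[lphi hphi phi1 pdv _] := svalP phi.
  by rewrite susp2_mono; apply: theta_pr.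
- have mF := svalP F; have /bv_morP[lphi hphi phi1 pdv _] := svalP phi.
  pose G x := theta (sval phi) (sval F x).
  have [lT _ _ _] := theta_coalg char0 lphi hphi phi1.
  have mG : is_hlinf_mor (@hlinf_D k g') (bv_codiff B) G.
    have := hlinf_mor_comp char0 (@bv_codiff_linear k _ B) (linf_series_mor char0 mF)
      (theta_mor char0 (svalP phi)).
    by congr is_hlinf_mor; apply: funext => x; rewrite hext_hconst.
  (* The composite is formed among L-infinity morphisms and carried back. That it is a BV-infinity
     morphism and that the square commutes then follow from [theta_inv_mor] and [theta_invK_mor];
     the formula for [bv_comp] remains. *)
  exists (exist _ _ (bv_of_linf_mor char0 mF)), (exist _ _ (theta_inv_mor char0 mG)).
  split=> //=; last exact: theta_invK_mor mG.
  apply: (theta_inv_comp char0 mG lphi (bv_of_linf_linear mF)) => w.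
  rewrite (exp_bv_of_linf char0 mF) theta_smexp //.
  exact: wle_linf_mor.
have /bv_morP[lphi hphi phi1 pdv _] := svalP phi.
have /bv_morP[lchi hchi chi1 cdv chiB] := svalP chi.
have mX := chi_mor_mor char0 lchi hchi chi1 cdv chiB.
have mG := hlinf_mor_comp char0 (@bv_codiff_linear k _ B') (theta_mor char0 (svalP phi)) mX.
exists (exist _ _ (theta_inv_mor char0 mG)), (exist _ _ mX); split=> /=.
(* Multiplication maps are moved outwards: exp(chi) exp(phi) = exp(chi) E F = E' X F, up to the
   powers of hbar. *)
- apply: (theta_inv_comp char0 mG lchi lphi) => w.
  rewrite (exp_theta char0 lphi hphi phi1 pdv) (chi_mor_vmexp_series char0 lchi hchi chi1 cdv) //.
  by move=> i; apply: wle_theta.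
- by move=> w; apply: chi_mor_pr.
exact: theta_invK_mor mG.
Qed.
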